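(* Let $b>a>0$ and let $\tau(t)=t$ for $t=1,2,\dots$. Suppose that $\mathbf{E}X_1^2<\infty$ and $\mathbf{E}Y_1<\infty$. Then, as $t\to+\infty$, the degree $d(v_t)$ of the vertex $v_t$ in the random graph $G_{X,Y}$ converges in distribution to the random variable $$d_*=\sum_{j=1}^{\Lambda_1}\varkappa_j,$$ where $\varkappa_1,\varkappa_2,\dots$ are independent and identically distributed random variables, independent of the random variable $\Lambda_1$, with distributions given, for $r=0,1,2,\dots$, by $$\mathbf{P}(\varkappa_1=r)=\frac{r+1}{\mathbf{E}\Lambda_2}\,\mathbf{P}(\Lambda_2=r+1)\qquad\text{and}\qquad \mathbf{P}(\Lambda_i=r)=\mathbf{E}\,e^{-\lambda_i}\frac{\lambda_i^r}{r!},\quad i=1,2.$$ Here $\lambda_1=2(b^{1/2}-a^{1/2})\,a_1Y_1$ and $\lambda_2=2(a^{-1/2}-b^{-1/2})\,b_1X_1$, where $a_1=\mathbf{E}X_1$ and $b_1=\mathbf{E}Y_1$.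
   Context: Model. Let $X=\{X_i\}_{i\ge 1}$ and $Y=\{Y_j\}_{j\ge 1}$ be two sequences of non-negative random variables; each sequence is i.i.d., and the two sequences are independent of each other. Let $b>a>0$ be fixed numbers and let $\{\tau(t)\}_{t\ge1}$ be a nondecreasing positive sequence with $\tau(t)\to+\infty$. Given $X,Y$, let $H_{X,Y}$ be the random bipartite graph with bipartition $V=\{v_1,v_2,\dots\}$ and $W=\{w_1,w_2,\dots\}$ in which the edges $\{w_i,v_j\}$ are inserted (conditionally) independently with probabilities $$p_{ij}=\min\Bigl\{1,\frac{X_iY_j}{\sqrt{ij}}\Bigr\}\,\mathbb{I}_{\{a\tau(j)\le i\le b\tau(j)\}}.$$ The random intersection graph $G_{X,Y}$ is the graph on the vertex set $V$ in which two distinct vertices $u,v\in V$ are adjacent (written $u\sim v$) whenever they have a common neighbour in $H_{X,Y}$. $d(v_t)$ denotes the degree of $v_t$ in $G_{X,Y}$. Convention for the degenerate case: if $\mathbf{E}\Lambda_2=0$ (i.e. $a_1b_1=0$), then $\Lambda_1=0$ almost surely and $d_*$ is understood to be $0$. *)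

(* Defs.v *)
From HB Require Import structures.
From mathcomp Require Import all_boot all_order all_algebra finmap.
From mathcomp Require Import all_classical all_reals all_analysis.
From mathcomp Require Import measurable_realfun.

Set Implicit Arguments.
Unset Strict Implicit.
Unset Printing Implicit Defensive.

Import Order.TTheory GRing.Theory Num.Theory.
Import numFieldNormedType.Exports.

Local Open Scope classical_set_scope.
Local Open Scope ring_scope.

Section Independence.
Context d (Omega : measurableType d) (R : realType) (P : probability Omega R).

Definition sigma_of_family d' (T' : measurableType d') (I : Type)
    (F : I -> {RV P >-> T'}) : set_system Omega :=
  <<s \bigcup_i preimage_set_system setT (F i) measurable >>.

Definition mutually_independent d' (T' : measurableType d') (I : choiceType)
    (F : I -> {RV P >-> T'}) : Prop :=
  forall (J : {fset I}) (A : I -> set T'), (forall i, measurable (A i)) ->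
    P (\bigcap_(i in [set` J]) F i @^-1` A i)
      = (\prod_(i <- J) P (F i @^-1` A i))%E.

Definition identically_distributed d' (T' : measurableType d') (I : Type)
    (F : I -> {RV P >-> T'}) : Prop :=
  forall i j A, measurable A -> distribution P (F i) A = distribution P (F j) A.

Definition iid d' (T' : measurableType d') (I : choiceType)
    (F : I -> {RV P >-> T'}) : Prop :=
  mutually_independent F /\ identically_distributed F.

Definition independent_systems (G H : set_system Omega) : Prop :=
  forall A B, G A -> H B -> P (A `&` B) = (P A * P B)%E.

(* [q] is a version of the conditional probability of the event [A] given the
   sub-sigma-algebra [G]. *)
Definition is_cond_prob (G : set_system Omega) (A : set Omega)
    (q : Omega -> R) : Prop :=
  (forall B, measurable B -> G (q @^-1` B)) /\
  (forall C, G C -> P (C `&` A) = (\int[P]_(w in C) (q w)%:E)%E).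

(* The events [A i] are conditionally independent given [G], with conditional
   probabilities [q i] (take [J] a singleton). *)
Definition cond_independent_events (G : set_system Omega) (I : choiceType)
    (A : I -> set Omega) (q : I -> Omega -> R) : Prop :=
  forall J : {fset I},
    is_cond_prob G (\bigcap_(i in [set` J]) A i) (fun w => \prod_(i <- J) q i w).

End Independence.
Arguments mutually_independent {d Omega R} P {d' T' I} F.
Arguments identically_distributed {d Omega R} P {d' T' I} F.
Arguments iid {d Omega R} P {d' T' I} F.

(* The limit is real-valued, the sequence may take the value +oo, and the two
   sides may live on different probability spaces. *)
Definition cvg_in_distribution d (Omega : measurableType d) d'
    (Omega' : measurableType d') (R : realType) (P : probability Omega R)
    (P' : probability Omega' R)
    (D : nat -> {RV P >-> \bar R}) (D' : {RV P' >-> R}) : Prop :=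
  forall x : R, {for x, continuous (cdf D')} ->
    P [set w | (D t w <= x%:E)%E] @[t --> \oo] --> cdf D' x.
Arguments cvg_in_distribution {d Omega d' Omega' R} P P' D D'.

Section Model.
Context d (Omega : measurableType d) (R : realType) (P : probability Omega R).

(* All sequences of the model are indexed from 1 on paper; here the index [k]
   of [X], [Y], of the rows of [E], and of the vertices stands for [k.+1].
   Only [tau] keeps its original argument. *)
Definition edge_prob (a b : R) (tau : nat -> R) (X Y : nat -> {RV P >-> R})
    (i j : nat) (w : Omega) : R :=
  if a * tau j.+1 <= i.+1%:R <= b * tau j.+1
  then Num.min 1 (X i w * Y j w / Num.sqrt (i.+1%:R * j.+1%:R)) else 0.

(* [E i j w] says that the edge between the attribute [w_i] and the vertex
   [v_j] is present in the bipartite graph. *)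
Record bipartite_model (a b : R) (tau : nat -> R) (X Y : nat -> {RV P >-> R})
    (E : nat -> nat -> {RV P >-> bool}) : Prop := BipartiteModel {
  model_ab : 0 < a < b ;
  model_tau_gt0 : forall t, (0 < t)%N -> 0 < tau t ;
  model_tau_nondecreasing :
    forall s t, (0 < s)%N -> (s <= t)%N -> tau s <= tau t ;
  model_tau_infty : tau t @[t --> \oo] --> +oo ;
  model_X_ge0 : forall i w, 0 <= X i w ;
  model_Y_ge0 : forall j w, 0 <= Y j w ;
  model_X_iid : iid P X ;
  model_Y_iid : iid P Y ;
  model_XY_independent :
    independent_systems P (sigma_of_family X) (sigma_of_family Y) ;
  model_edges :
    cond_independent_events P
      <<s sigma_of_family X `|` sigma_of_family Y >>
      (fun e : nat * nat => [set w | E e.1 e.2 w])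
      (fun e : nat * nat => edge_prob a b tau X Y e.1 e.2) }.

Definition ri_adjacent (E : nat -> nat -> {RV P >-> bool}) (w : Omega)
    (u v : nat) : Prop :=
  u <> v /\ exists i, E i u w /\ E i v w.

Definition degree (E : nat -> nat -> {RV P >-> bool}) (v : nat) (w : Omega) :
    \bar R :=
  counting [set u | ri_adjacent E w u v].

Lemma measurable_adjacent (E : nat -> nat -> {RV P >-> bool}) (u v : nat) :
  measurable [set w | ri_adjacent E w u v].
Proof.
have [->|/eqP uv] := eqVneq u v.
  by rewrite (_ : [set _ | _] = set0)// -subset0 => w [].
rewrite (_ : [set _ | _] =
    \bigcup_i (E i u @^-1` [set true] `&` E i v @^-1` [set true])); last first.
  apply/seteqP; split => w /=.
    by move=> [_ [i [Eu Ev]]]; exists i.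
  by move=> [i _ [Eu Ev]]; split => //; exists i; rewrite Eu Ev.
apply: bigcup_measurable => i _.
by apply: measurableI; rewrite -[X in measurable X]setTI; exact: measurable_funP.
Qed.

Lemma measurable_degree (E : nat -> nat -> {RV P >-> bool}) (v : nat) :
  measurable_fun [set: Omega] (degree E v).
Proof.
rewrite (_ : degree E v = (fun w =>
    (\sum_(0 <= u <oo) (\1_[set w' | ri_adjacent E w' u v] w)%:E)%E)); last first.
  apply/funext => w; rewrite /degree counting_dirac.
  apply: eq_eseriesr => u _; rewrite /dirac !indicE.
  by congr (_%:R%:E); congr nat_of_bool; apply/idP/idP; rewrite !inE.
apply: ge0_emeasurable_sum => [u w _ _|u _]; first by rewrite lee_fin.
apply/measurable_EFinP; apply: measurable_indic; exact: measurable_adjacent.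
Qed.

HB.instance Definition _ (E : nat -> nat -> {RV P >-> bool}) (v : nat) :=
  isMeasurableFun.Build _ _ _ _ (degree E v) (measurable_degree E v).

End Model.

Section Limit.
Context d (Omega : measurableType d) (R : realType) (P : probability Omega R).

(* [kappa j] is the summand with number [j.+1]. *)
Definition dstar (Lambda1 Lambda2 : {RV P >-> nat})
    (kappa : nat -> {RV P >-> nat}) (w : Omega) : R :=
  if ('E_P[fun w' => (Lambda2 w')%:R] == 0)%E then 0
  else (\sum_(j < Lambda1 w) kappa j w)%:R.

Lemma measurable_dstar (Lambda1 Lambda2 : {RV P >-> nat})
    (kappa : nat -> {RV P >-> nat}) :
  measurable_fun [set: Omega] (dstar Lambda1 Lambda2 kappa).
Proof.
rewrite /dstar; case: ('E_P[_] == _)%E; first exact: measurable_cst.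
have msum n : measurable_fun [set: Omega]
    (fun w => (\sum_(j < n) kappa j w)%:R : R).
  under eq_fun do rewrite natr_sum.
  apply: measurable_sum => j.
  by apply: (@measurableT_comp _ _ _ _ _ _ (fun k : nat => k%:R : R)).
move=> _ B mB; rewrite setTI.
rewrite (_ : _ @^-1` B = \bigcup_n (Lambda1 @^-1` [set n] `&`
    (fun w => (\sum_(j < n) kappa j w)%:R : R) @^-1` B)); last first.
  apply/seteqP; split => w /=; first by exists (Lambda1 w).
  by move=> [n _ [<-]].
apply: bigcup_measurable => n _; apply: measurableI.
  by rewrite -[X in measurable X]setTI; exact: measurable_funP.
by rewrite -[X in measurable X]setTI; exact: msum.
Qed.

HB.instance Definition _ (Lambda1 Lambda2 : {RV P >-> nat})
    (kappa : nat -> {RV P >-> nat}) :=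
  isMeasurableFun.Build _ _ _ _ (dstar Lambda1 Lambda2 kappa)
    (measurable_dstar Lambda1 Lambda2 kappa).

End Limit.

(* [poisson_pmf] is not used because its value at rate 0 is the constant 1,
   whereas here a rate that vanishes must give the Dirac mass at 0. *)
Definition mixed_poisson d (Omega : measurableType d) d'
    (Omega' : measurableType d') (R : realType) (P : probability Omega R)
    (P' : probability Omega' R) (lambda : Omega -> R)
    (Lambda : {RV P' >-> nat}) : Prop :=
  forall r : nat, P' (Lambda @^-1` [set r])
    = 'E_P[fun w => (expR (- lambda w) * lambda w ^+ r / r`!%:R)%R]%E.

(* Main.v *)
Require Import Defs.
From HB Require Import structures.
From mathcomp Require Import all_boot all_order all_algebra finmap.
From mathcomp Require Import all_classical all_reals all_analysis.
From mathcomp Require Import measurable_realfun.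
From mathcomp Require Import ring lra.

(* Let L be the number of paths v_t - w_i - v_u, i.e. the degree of v_t counted
   with multiplicity.  Given X and Y, the edges are independent, so that
     E (s^L | X, Y) = prod_i (1 - p_it (1 - prod_u (1 - (1 - s) p_iu))),
   the inner product ranging over u <> t.  A law of large numbers in L1 for
   weighted sums of i.i.d. variables (with weights 1 / sqrt (i t), whose sums are
   Riemann sums) replaces the inner product by exp (- (1 - s) g2 b1 X_i) and the
   outer one by exp (- g1 Y_t E (X (1 - exp (- (1 - s) g2 b1 X)))), where
   g1 = 2 (sqrt b - sqrt a) and g2 = 2 (1 / sqrt a - 1 / sqrt b).  The
   expectation of the latter is the generating function of d_*, and pointwise
   convergence of generating functions on ]0, 1[ implies convergence of the point
   probabilities.  Finally d(v_t) differs from L only if v_t shares two neighbours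
   with some v_u; once Y_t is bounded, this has vanishing probability. *)

Set Implicit Arguments.
Unset Strict Implicit.
Unset Printing Implicit Defensive.

Import Order.TTheory GRing.Theory Num.Theory.
Import numFieldNormedType.Exports.

Local Open Scope classical_set_scope.
Local Open Scope ring_scope.

(** * Expectations of integrable random variables *)

(** The obstacle is integrability: [X] has two moments and [Y] only one, whereas a Poisson
    approximation of the products leaves errors quadratic in the edge probabilities, hence in [Y].
    In each such square one factor is kept as [c x y] and the other is bounded by [trunc_err] at the
    level [M = (t+1)^(1/4)]: every weight met near [v_t] is of order [1/(t+1)], so [c M^2] tends to
    0, and the two indicators leave tails of integrable variables. [Y_t] multiplies all these terms
    and would create its own square; it is bounded by a constant [K] fixed before [t], at the price
    of the probability of [Y_t > K], the same for every [t]. Conditional expectations are never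
    formed. The hypothesis on the edges prescribes the expectations of products of distinct edges,
    and the generating function of L is affine in each edge, so that these products determine its
    expectation. The constants g1 and g2 come from the same Riemann sum of [1 / sqrt x]: since
    [tau(t) = t], the range [a u <= i <= b u] reads [i / b <= u <= i / a], and exchanging attributes
    and vertices turns [[a, b]] into [[1/b, 1/a]]. *)

Section Expectation.
Context d (T : measurableType d) (R : realType) (P : probability T R).
Implicit Types f g h : T -> R.

Definition intg f := P.-integrable [set: T] (EFin \o f).

Definition Ex f : R := \int[P]_(w in [set: T]) f w.

Lemma intg_measurable f : intg f -> measurable_fun setT f.
Proof. by move=> /measurable_int /measurable_EFinP. Qed.

Lemma intg_ext f g : f =1 g -> intg f -> intg g.
Proof. by move=> /funext ->. Qed.

Lemma Ex_ext f g : f =1 g -> Ex f = Ex g.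
Proof. by move=> /funext ->. Qed.

Lemma intg_cst c : intg (fun=> c).
Proof. exact: finite_measure_integrable_cst. Qed.

Lemma intgD f g : intg f -> intg g -> intg (fun w => f w + g w).
Proof. by move=> If Ig; have := integrableD measurableT If Ig. Qed.

Lemma intgB f g : intg f -> intg g -> intg (fun w => f w - g w).
Proof. by move=> If Ig; have := integrableB measurableT If Ig. Qed.

Lemma intgZ c f : intg f -> intg (fun w => c * f w).
Proof. by move=> If; have := integrableZl measurableT c If. Qed.

Lemma intgZr c f : intg f -> intg (fun w => f w * c).
Proof. by move=> /(intgZ c); apply: intg_ext => w; rewrite mulrC. Qed.

Lemma intg_sum I (s : seq I) (Q : pred I) (F : I -> T -> R) :
  (forall i, Q i -> intg (F i)) -> intg (fun w => \sum_(i <- s | Q i) F i w).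
Proof.
move=> IF; elim: s => [|i s ih].
  by apply: (intg_ext _ (intg_cst 0)) => w; rewrite big_nil.
have [Qi|Qi] := boolP (Q i).
  by apply: (intg_ext _ (intgD (IF i Qi) ih)) => w; rewrite big_cons Qi.
by apply: (intg_ext _ ih) => w; rewrite big_cons (negbTE Qi).
Qed.

Lemma intg_le f g : measurable_fun setT f -> (forall w, `|f w| <= g w) ->
  intg g -> intg f.
Proof.
move=> mf fg Ig; apply: (le_integrable measurableT _ _ Ig).
  exact/measurable_EFinP.
by move=> w _ /=; rewrite lee_fin (le_trans (fg w))// ler_norm.
Qed.

Lemma intg_bounded f (M : R) : measurable_fun setT f ->
  (forall w, `|f w| <= M) -> intg f.
Proof. by move=> mf fM; exact: (intg_le mf fM (intg_cst M)). Qed.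

Lemma intg_indic (A : set T) : measurable A -> intg (\1_A).
Proof. exact: integrable_indic. Qed.

Lemma intg_norm f : intg f -> intg (fun w => `|f w|).
Proof. by move=> /integrable_norm. Qed.

Lemma intgM_bounded f g (M : R) : measurable_fun setT g ->
  (forall w, `|g w| <= M) -> intg f -> intg (fun w => g w * f w).
Proof.
move=> mg gM If; apply: (intg_le _ _ (intgZ M (intg_norm If))).
  exact: measurable_funM mg (intg_measurable If).
by move=> w; rewrite normrM ler_wpM2r.
Qed.

Lemma Ex_cst c : Ex (fun=> c) = c.
Proof. by rewrite /Ex Rintegral_cst// (congr1 fine (probability_setT P)) mulr1. Qed.

Lemma ExD f g : intg f -> intg g -> Ex (fun w => f w + g w) = Ex f + Ex g.
Proof. exact: RintegralD. Qed.

Lemma ExB f g : intg f -> intg g -> Ex (fun w => f w - g w) = Ex f - Ex g.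
Proof. exact: RintegralB. Qed.

Lemma ExZ c f : intg f -> Ex (fun w => c * f w) = c * Ex f.
Proof. exact: RintegralZl. Qed.

Lemma ExZr c f : intg f -> Ex (fun w => f w * c) = Ex f * c.
Proof. exact: RintegralZr. Qed.

Lemma Ex_sum I (s : seq I) (Q : pred I) (F : I -> T -> R) :
  (forall i, Q i -> intg (F i)) ->
  Ex (fun w => \sum_(i <- s | Q i) F i w) = \sum_(i <- s | Q i) Ex (F i).
Proof.
move=> IF; elim: s => [|i s ih].
  by under Ex_ext do rewrite big_nil; rewrite Ex_cst big_nil.
rewrite big_cons; case: ifPn => Qi.
  under Ex_ext do rewrite big_cons Qi.
  by rewrite ExD ?ih//; [exact: IF|exact: intg_sum].
by under Ex_ext do rewrite big_cons (negbTE Qi).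
Qed.

Lemma le_Ex f g : intg f -> intg g -> (forall w, f w <= g w) -> Ex f <= Ex g.
Proof. by move=> If Ig fg; apply: le_Rintegral. Qed.

Lemma Ex_ge0 f : (forall w, 0 <= f w) -> 0 <= Ex f.
Proof. by move=> f0; apply: Rintegral_ge0. Qed.

Lemma le_norm_Ex f : intg f -> `|Ex f| <= Ex (fun w => `|f w|).
Proof. exact: le_normr_Rintegral. Qed.

Lemma Ex_indic (A : set T) : measurable A -> Ex \1_A = fine (P A).
Proof. by move=> mA; rewrite /Ex /Rintegral integral_indic// setIT. Qed.

Lemma EFin_Ex f : intg f -> (Ex f)%:E = (\int[P]_w (f w)%:E)%E.
Proof. by move=> If; rewrite fineK//; exact: integrable_fin_num. Qed.

Lemma intg_ge0 f : measurable_fun setT f -> (forall w, 0 <= f w) ->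
  (\int[P]_w (f w)%:E < +oo)%E -> intg f.
Proof.
move=> mf f0 foo; apply/integrableP; split; first exact/measurable_EFinP.
by under eq_integral do rewrite gee0_abs ?lee_fin ?f0//.
Qed.

Lemma Ex_cvg (F : nat -> T -> R) f g : (forall n, measurable_fun setT (F n)) ->
  intg g -> (forall n w, `|F n w| <= g w) ->
  (forall w, F n w @[n --> \oo] --> f w) ->
  Ex (F n) @[n --> \oo] --> Ex f.
Proof.
move=> mF Ig Fg Ff.
have mf : measurable_fun setT f.
  by apply: (measurable_fun_cvg mF) => w _; exact: Ff.
have IF n : intg (F n) by exact: intg_le (mF n) (Fg n) Ig.
have fg w : `|f w| <= g w.
  apply: (@closed_cvg _ _ _ eventually_filter (fun n => `|F n w|) [set x | x <= g w]).
  - exact: closed_le.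
  - by apply: nearW => n /=.
  - by apply: cvg_norm; exact: Ff.
have If : intg f by exact: intg_le mf fg Ig.
have [||||| _ _] := @dominated_convergence _ _ _ P _ measurableT
  (fun n => EFin \o F n) (EFin \o f) (EFin \o g).
- by move=> n; exact/measurable_EFinP.
- exact/measurable_EFinP.
- by apply: aeW => w _; apply: cvg_EFin; [exact: nearW|exact: Ff].
- exact: Ig.
- by apply: aeW => w n _; rewrite lee_fin.
by move=> h; apply: (@fine_cvg R nat _ _ _ (Ex f)); rewrite EFin_Ex.
Qed.

End Expectation.

Arguments Ex_ext {d T R P f g}.

(** * Independence *)

Section IndependentExpectation.
Context d (T : measurableType d) (R : realType) (P : probability T R).
Import HBNNSimple.
Local Open Scope ereal_scope.

(* Approximating [f] from below by simple functions extends the product rule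
   from the indicators of the events [Z @^-1` A] to [f \o Z]. *)
Lemma ge0_integralM_indep d' (T' : measurableType d') (W : T -> R) (Z : T -> T')
    (f : T' -> R) :
  intg P W -> (forall w, 0 <= W w)%R ->
  measurable_fun setT Z ->
  (forall A, measurable A -> \int[P]_w (W w * \1_(Z @^-1` A) w)%:E
    = \int[P]_w (W w)%:E * P (Z @^-1` A)) ->
  measurable_fun setT f -> (forall y, 0 <= f y)%R ->
  \int[P]_w (W w * f (Z w))%:E = \int[P]_w (W w)%:E * \int[P]_w (f (Z w))%:E.
Proof.
move=> IW W0 mZ WZ mf f0; have mW := intg_measurable IW.
have mf' : measurable_fun [set: T'] (EFin \o f) by exact/measurable_EFinP.
pose g n : T' -> R := nnsfun_approx measurableT mf' n.
have gf y : (g n y)%:E @[n --> \oo] --> (f y)%:E.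
  by apply: (cvg_nnsfun_approx measurableT mf') => // z _; rewrite lee_fin.
have ndg m n y : (m <= n)%N -> (g m y <= g n y)%R.
  by move=> mn; have /lefP := nd_nnsfun_approx measurableT mf' mn; apply.
have g0 n y : (0 <= g n y)%R by [].
have mZA A : measurable A -> measurable (Z @^-1` A).
  by move=> mA; rewrite -[X in measurable X]setTI; exact: mZ.
have mgZ n : measurable_fun setT (fun w => g n (Z w)).
  exact: measurableT_comp.
have W0' : 0 <= \int[P]_w (W w)%:E.
  by apply: integral_ge0 => w _; rewrite lee_fin.
have simple n : \int[P]_w (W w * g n (Z w))%:E
    = \int[P]_w (W w)%:E * \int[P]_w (g n (Z w))%:E.
  pose s := fset_set (range (g n)).
  have gE w : g n (Z w)
      = (\sum_(y <- s) `|y| * \1_(Z @^-1` (g n @^-1` [set y])) w)%R.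
    rewrite {1}/g fimfunE/= fsbig_finite//= big_seq [RHS]big_seq.
    apply: eq_bigr => y; rewrite in_fset_set// inE => -[z _ <-].
    by rewrite ger0_norm.
  have mgy y : measurable (Z @^-1` (g n @^-1` [set y])).
    by apply: mZA; rewrite -[X in measurable X]setTI; exact: measurable_funP.
  transitivity (\int[P]_w (\sum_(y <- s)
      `|y|%:E * (W w * \1_(Z @^-1` (g n @^-1` [set y])) w)%:E)).
    apply: eq_integral => w _; rewrite gE mulr_sumr -sumEFin.
    by apply: eq_bigr => y _; rewrite mulrCA.
  transitivity (\int[P]_w (W w)%:E * \int[P]_w (\sum_(y <- s)
      `|y|%:E * (\1_(Z @^-1` (g n @^-1` [set y])) w)%:E)); last first.
    by congr (_ * _); apply: eq_integral => w _; rewrite gE -sumEFin.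
  have mW1 y : measurable_fun setT
      (fun w => (W w * \1_(Z @^-1` (g n @^-1` [set y])) w)%:E).
    by apply/measurable_EFinP; apply: measurable_funM.
  have m1 y : measurable_fun setT
      (fun w => (\1_(Z @^-1` (g n @^-1` [set y])) w)%:E : \bar R).
    by apply/measurable_EFinP.
  rewrite ge0_integral_sum//; last 2 first.
  - by move=> y; exact: measurable_funeM.
  - by move=> y w _; rewrite -EFinM lee_fin !mulr_ge0.
  rewrite ge0_integral_sum//; last by move=> y; exact: measurable_funeM.
  rewrite ge0_sume_distrr; last first.
    by move=> y _; apply: integral_ge0 => w _; rewrite lee_fin mulr_ge0.
  apply: eq_bigr => y _; rewrite !ge0_integralZl//; last first.
    by move=> w _; rewrite lee_fin mulr_ge0.
  rewrite WZ; first by rewrite integral_indic// setIT muleCA.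
  by rewrite -[X in measurable X]setTI; exact: measurable_funP.
have c1 : \int[P]_w (W w * g k (Z w))%:E @[k --> \oo]
    --> \int[P]_w (W w * f (Z w))%:E.
  have -> : (fun w => (W w * f (Z w))%:E)
      = (fun w => limn (fun n => (W w * g n (Z w))%:E)).
    apply/funext => w; apply/esym/cvg_lim => //.
    under eq_fun do rewrite EFinM.
    by rewrite EFinM; exact: cvgeZl.
  apply: cvg_monotone_convergence => //.
  - by move=> n; apply/measurable_EFinP; exact: measurable_funM.
  - by move=> n w _; rewrite lee_fin mulr_ge0.
  - by move=> w _ m k mk; rewrite lee_fin ler_wpM2l// ndg.
have c2 : \int[P]_w (g k (Z w))%:E @[k --> \oo] --> \int[P]_w (f (Z w))%:E.
  have -> : (fun w => (f (Z w))%:E) = (fun w => limn (fun n => (g n (Z w))%:E)).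
    by apply/funext => w; apply/esym/cvg_lim.
  apply: cvg_monotone_convergence => //.
  - by move=> n; apply/measurable_EFinP.
  - by move=> n w _; rewrite lee_fin.
  - by move=> w _ m k mk; rewrite lee_fin ndg.
have IW' : \int[P]_w (W w)%:E \is a fin_num by rewrite -EFin_Ex.
have c3 := cvgeZl IW' c2.
have E : (fun k => \int[P]_w (W w * g k (Z w))%:E)
    = (fun k => \int[P]_w (W w)%:E * \int[P]_w (g k (Z w))%:E).
  by apply/funext => k; exact: simple.
by rewrite E in c1; exact: (cvg_unique (@ereal_hausdorff R) c1 c3).
Qed.

End IndependentExpectation.

Section IndependentProducts.
Context d (T : measurableType d) (R : realType) (P : probability T R).
Implicit Types f g h U V W : T -> R.

Lemma intgM_indic W (A : set T) : measurable A ->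
  (forall w, 0 <= W w) -> intg P W -> intg P (fun w => W w * \1_A w).
Proof.
move=> mA W0 IW; apply: (intg_ext (f := fun w => \1_A w * W w)).
  by move=> w; rewrite mulrC.
apply: (@intgM_bounded _ _ _ _ _ _ 1) => // w.
by rewrite ger0_norm// indicE; case: (_ \in _).
Qed.

(** [W] is tested against indicators of [Z] only, so [W] may itself be a product already treated;
    the value being finite, integrability of the new product comes with it. *)
Lemma Ex_mul_comp d' (T' : measurableType d') W (Z : T -> T') (f : T' -> R) :
  intg P W -> (forall w, 0 <= W w) -> measurable_fun setT Z ->
  (forall A, measurable A ->
    Ex P (fun w => W w * \1_(Z @^-1` A) w) = Ex P W * fine (P (Z @^-1` A))) ->
  measurable_fun setT f -> (forall y, 0 <= f y) ->
  intg P (fun w => f (Z w)) ->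
  intg P (fun w => W w * f (Z w)) /\
  Ex P (fun w => W w * f (Z w)) = Ex P W * Ex P (fun w => f (Z w)).
Proof.
move=> IW W0 mZ WZ mf f0 IfZ.
have mZA A : measurable A -> measurable (Z @^-1` A).
  by move=> mA; rewrite -[X in measurable X]setTI; exact: mZ.
have E : (\int[P]_w (W w * f (Z w))%:E)%E
    = (Ex P W * Ex P (fun w => f (Z w)))%:E.
  rewrite (ge0_integralM_indep IW W0 mZ)//; first by rewrite EFinM !EFin_Ex.
  move=> A mA; have mA' := mZA A mA; rewrite -(EFin_Ex (intgM_indic mA' W0 IW)).
  by rewrite WZ// EFinM EFin_Ex// fineK// fin_num_measure.
split; last by rewrite [LHS]/Ex /Rintegral E.
apply: intg_ge0.
- apply: measurable_funM; [exact: intg_measurable IW|exact: intg_measurable IfZ].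
- by move=> w; rewrite mulr_ge0.
- by rewrite E ltry.
Qed.

Lemma Ex_mul_indep U V : intg P U -> (forall w, 0 <= U w) ->
  intg P V -> (forall w, 0 <= V w) ->
  (forall A B, measurable A -> measurable B ->
    P (U @^-1` A `&` V @^-1` B) = (P (U @^-1` A) * P (V @^-1` B))%E) ->
  intg P (fun w => U w * V w) /\ Ex P (fun w => U w * V w) = Ex P U * Ex P V.
Proof.
move=> IU U0 IV V0 UV.
have [mU mV] := (intg_measurable IU, intg_measurable IV).
have mUA A : measurable A -> measurable (U @^-1` A).
  by move=> mA; rewrite -[X in measurable X]setTI; exact: mU.
have mVA A : measurable A -> measurable (V @^-1` A).
  by move=> mA; rewrite -[X in measurable X]setTI; exact: mV.
(* [Ex_mul_comp] wants a function nonnegative on the whole line; the identity is replaced by the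
   absolute value, which agrees with it on the values of [U] and [V]. *)
have UE : (fun w => `|U w|) = U by apply/funext => w; rewrite ger0_norm.
have VE : (fun w => `|V w|) = V by apply/funext => w; rewrite ger0_norm.
have half B : measurable B ->
    Ex P (fun w => U w * \1_(V @^-1` B) w) = Ex P U * fine (P (V @^-1` B)).
  move=> mB; have mB' := mVA B mB.
  have [|||||||_] := @Ex_mul_comp _ _ (\1_(V @^-1` B)) U (fun x => `|x|).
  - exact: intg_indic.
  - by [].
  - by [].
  - move=> A mA; have mA' := mUA A mA; rewrite Ex_indic//.
    rewrite (Ex_ext (g := \1_(U @^-1` A `&` V @^-1` B))); last first.
      by move=> w; rewrite indicI mulrC.
    rewrite Ex_indic//; last exact: measurableI.
    by rewrite UV// fineM ?fin_num_measure// mulrC.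
  - exact: normr_measurable.
  - by [].
  - by rewrite UE.
  rewrite UE Ex_indic// mulrC => <-.
  by apply: Ex_ext => w; rewrite [in RHS]ger0_norm 1?mulrC.
have [|||] := @Ex_mul_comp _ _ U V (fun x => `|x|) IU U0 mV half.
- exact: normr_measurable.
- by [].
- by rewrite VE.
suff -> : (fun w => U w * `|V w|) = (fun w => U w * V w) by rewrite VE.
by apply/funext => w; rewrite ger0_norm.
Qed.

Lemma mutually_independent_indic d' (T' : measurableType d') (I : choiceType)
    (F : I -> {RV P >-> T'}) (A : I -> set T') (s : seq I) :
  mutually_independent P F -> uniq s -> (forall i, measurable (A i)) ->
  Ex P (fun w => \prod_(i <- s) \1_(F i @^-1` A i) w)
    = \prod_(i <- s) fine (P (F i @^-1` A i)).
Proof.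
move=> iF us mA.
have mFA i : measurable (F i @^-1` A i).
  by rewrite -[X in measurable X]setTI; exact: measurable_funP.
have memE i : [set` seq_fset tt s] i <-> i \in s.
  by rewrite -(seq_fsetE tt s i).
rewrite (Ex_ext (g := \1_(\bigcap_(i in [set` seq_fset tt s]) F i @^-1` A i))); last first.
  move=> w; rewrite indicE; case: (asboolP ((\bigcap_(i in [set` seq_fset tt s]) F i @^-1` A i) w)) => [h|h].
    rewrite mem_set// big_seq big1// => i si; rewrite indicE mem_set//.
    by apply: h; apply/memE.
  rewrite memNset//; apply/eqP; rewrite prodf_seq_eq0.
  apply/hasP; apply: contrapT => /hasP/hasPn h'; apply: h => i /memE /h'.
  by apply: contraPP => nA; rewrite indicE memNset// eqxx.
rewrite Ex_indic; last first.
  by apply: fin_bigcap_measurable => //; exact: finite_fset.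
have pE : perm_eq (seq_fset tt s) s by rewrite (perm_trans (seq_fset_perm _ _))// undup_id.
rewrite (iF (seq_fset tt s) A mA) (perm_big _ pE)/=.
elim: s {us pE memE} => [|i s ih]; first by rewrite !big_nil.
rewrite !big_cons fineM ?fin_num_measure ?ih//.
elim: s {ih} => [|j s ih]; first by rewrite big_nil.
by rewrite big_cons fin_numM// fin_num_measure.
Qed.

Lemma intg_Ex_prod d' (T' : measurableType d') (I : choiceType)
    (F : I -> {RV P >-> T'}) (f : I -> T' -> R) (s : seq I) :
  mutually_independent P F -> uniq s ->
  (forall i, measurable_fun setT (f i)) -> (forall i y, 0 <= f i y) ->
  (forall i, i \in s -> intg P (fun w => f i (F i w))) ->
  intg P (fun w => \prod_(i <- s) f i (F i w)) /\
  Ex P (fun w => \prod_(i <- s) f i (F i w))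
    = \prod_(i <- s) Ex P (fun w => f i (F i w)).
Proof.
move=> iF us mf f0 If.
have mFA i A : measurable A -> measurable (F i @^-1` A).
  by move=> mA; rewrite -[X in measurable X]setTI; exact: measurable_funP.
(* Strengthened for the induction: the indices in [s] carry their functions, those in [r] still
   carry indicators. Moving [j] from [r] to [s] is one use of [Ex_mul_comp]. *)
suff: forall (r : seq I) (A : I -> set T'), uniq (s ++ r) ->
    (forall i, measurable (A i)) ->
    intg P (fun w => (\prod_(i <- s) f i (F i w)) *
      \prod_(i <- r) \1_(F i @^-1` A i) w) /\
    Ex P (fun w => (\prod_(i <- s) f i (F i w)) *
      \prod_(i <- r) \1_(F i @^-1` A i) w)
    = (\prod_(i <- s) Ex P (fun w => f i (F i w))) *
      \prod_(i <- r) fine (P (F i @^-1` A i)).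
  move=> h; have [||] := h [::] (fun=> setT); rewrite ?cats0//.
  rewrite big_nil mulr1.
  suff -> : (fun w => (\prod_(i <- s) f i (F i w)) *
      \prod_(i <- [::]) \1_(F i @^-1` (fun=> setT) i) w)
      = (fun w => \prod_(i <- s) f i (F i w)) by [].
  by apply/funext => w; rewrite big_nil mulr1.
elim: s us If => [_ _|j s ih /= /andP[js us] If] r A /=.
  move=> ur mA; rewrite big_nil mul1r -mutually_independent_indic//.
  have E : (fun w => \prod_(i <- [::]) f i (F i w) *
      \prod_(i <- r) \1_(F i @^-1` A i) w)
      = (fun w => \prod_(i <- r) \1_(F i @^-1` A i) w).
    by apply/funext => w; rewrite big_nil mul1r.
  rewrite E; split => //; apply: (@intg_bounded _ _ _ _ _ 1).
    by apply: measurable_prod => i _; exact/measurable_indic/mFA.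
  move=> w; rewrite ger0_norm; last by rewrite prodr_ge0.
  by apply: prodr_ile1 => i _; rewrite indicE ler0n lern1 leq_b1.
move=> /andP[jsr usr] mA.
have jr : j \notin r by move: jsr; rewrite mem_cat negb_or => /andP[].
have {}ih := ih us (fun i si => If i (mem_behead (s := j :: s) si)).
pose W w := (\prod_(i <- s) f i (F i w)) * \prod_(i <- r) \1_(F i @^-1` A i) w.
have [IW EW] := ih r A usr mA.
have [] := @Ex_mul_comp _ _ W (F j) (f j).
- exact: IW.
- by move=> w; rewrite mulr_ge0// prodr_ge0.
- exact: measurable_funP.
(* The product rule against an event of [F j] is the induction hypothesis with [j] put into [r] and
   [A j] changed to [B]. *)
- move=> B mB; have [||_] := ih (j :: r) (fun i => if i == j then B else A i).
  + by rewrite -(cat1s j r) uniq_catCA /= jsr.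
  + by move=> i; case: ifP.
  have rE (Q : set T' -> I -> R) : \prod_(i <- r) Q (if i == j then B else A i) i
      = \prod_(i <- r) Q (A i) i.
    rewrite big_seq [RHS]big_seq; apply: eq_bigr => i ir.
    by case: eqP ir jr => // -> ->.
  rewrite big_cons eqxx (rE (fun X i => fine (P (F i @^-1` X)))) => E.
  rewrite [Ex P W]EW mulrAC -mulrA -E; apply: Ex_ext => w.
  by rewrite big_cons eqxx (rE (fun X i => \1_(F i @^-1` X) w)) /W -mulrA; congr (_ * _); rewrite mulrC.
- exact: mf.
- exact: f0.
- by apply: If; rewrite mem_head.
move=> IWF EWF.
have WE : (fun w => (\prod_(i <- j :: s) f i (F i w)) *
    \prod_(i <- r) \1_(F i @^-1` A i) w) = (fun w => W w * f j (F j w)).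
  by apply/funext => w; rewrite big_cons /W -mulrA mulrC.
by rewrite WE; split => //; rewrite EWF [Ex P W]EW [in RHS]big_cons mulrC mulrA.
Qed.

End IndependentProducts.

(** * Elementary inequalities and Riemann sums *)

Section RealInequalities.
Context (R : realType).
Implicit Types x y q : R.

Lemma expRN_le1 x : 0 <= x -> expR (- x) <= 1.
Proof. by move=> x0; rewrite -expR0 ler_expR oppr_le0. Qed.

Lemma dist_expRN x y : 0 <= x -> 0 <= y ->
  `|expR (- x) - expR (- y)| <= `|x - y|.
Proof.
wlog xy : x y / x <= y => [hw x0 y0|x0 y0].
  have [/hw->//|/ltW/hw h] := leP x y.
  by rewrite distrC (distrC x) h.
have e : expR (- y) <= expR (- x) by rewrite ler_expR lerN2.
rewrite ger0_norm ?subr_ge0// distrC ger0_norm ?subr_ge0//.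
have -> : expR (- x) - expR (- y) = expR (- x) * (1 - expR (- (y - x))).
  by rewrite mulrBr mulr1 -expRD; congr (_ - expR _); ring.
have h : 1 - expR (- (y - x)) <= y - x.
  by have := expR_ge1Dx (- (y - x)); lra.
have h0 : 0 <= 1 - expR (- (y - x)) by rewrite subr_ge0 expRN_le1// subr_ge0.
by rewrite (le_trans _ h)// ler_piMl// expRN_le1.
Qed.

Lemma dist_1B_expRN q : 0 <= q -> `|1 - q - expR (- q)| <= q ^+ 2.
Proof.
move=> q0; have h1 := expR_ge1Dx (- q); have h2 := expR_ge1Dx q.
rewrite distrC ger0_norm; last by lra.
have : expR (- q) <= (1 + q)^-1.
  by rewrite expRN lef_pV2// posrE ?expR_gt0//; lra.
move=> h3; suff : (1 + q)^-1 <= 1 - q + q ^+ 2 by lra.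
rewrite -[_^-1]mul1r ler_pdivrMr; last by lra.
by have : 0 <= q ^+ 3 by [rewrite exprn_ge0]; lra.
Qed.

Lemma dist_prod I (s : seq I) (u v : I -> R) :
  (forall i, 0 <= u i <= 1) -> (forall i, 0 <= v i <= 1) ->
  `|\prod_(i <- s) u i - \prod_(i <- s) v i| <= \sum_(i <- s) `|u i - v i|.
Proof.
move=> u01 v01; elim: s => [|i s ih]; first by rewrite !big_nil subrr normr0.
rewrite !big_cons.
set pu := \prod_(j <- s) u j; set pv := \prod_(j <- s) v j.
have -> : u i * pu - v i * pv = (u i - v i) * pu + v i * (pu - pv) by ring.
rewrite (le_trans (ler_normD _ _))// !normrM lerD//.
- rewrite ler_piMr// ger0_norm; first by apply: prodr_ile1 => j _.
  by apply: prodr_ge0 => j _; case/andP: (u01 j).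
- rewrite (le_trans _ ih)// ler_piMl// ger0_norm; by case/andP: (v01 i).
Qed.

Lemma prod_expRN I (s : seq I) (u : I -> R) :
  \prod_(i <- s) expR (- u i) = expR (- \sum_(i <- s) u i).
Proof.
elim: s => [|i s ih]; first by rewrite !big_nil oppr0 expR0.
by rewrite !big_cons ih -expRD opprD.
Qed.

End RealInequalities.

Section RiemannSum.
Context (R : realType).

(** A sum over the indices of an interval is compared with a telescoping sum over all indices once
    the square roots are clamped to [[lo, hi]]: every increment is nonnegative, and it is zero if
    its cell lies outside [[lo, hi]]. *)
Let clamp (lo hi x : R) := Num.max lo (Num.min hi x).

Let clampS lo hi x y : x <= y ->
  0 <= clamp lo hi y - clamp lo hi x <= y - x.
Proof.
rewrite /clamp => xy; case: (leP hi y) => ?; case: (leP hi x) => ?;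
  case: (leP lo hi) => ?; case: (leP lo x) => ?; case: (leP lo y) => ?;
  apply/andP; split; lra.
Qed.

Let clampE lo hi x : lo <= x <= hi -> clamp lo hi x = x.
Proof.
rewrite /clamp => /andP[? ?]; case: (leP hi x) => ?.
  by case: (leP lo hi) => ?; lra.
by case: (leP lo x) => ?; lra.
Qed.

Let clamp_bounds lo hi x : lo <= hi -> lo <= clamp lo hi x <= hi.
Proof. by move=> lohi; rewrite /clamp le_max lexx/= ge_max lohi ge_min lexx. Qed.

Let clamp_lo lo hi x : x <= lo -> clamp lo hi x = lo.
Proof. by move=> xlo; rewrite /clamp max_l// ge_min xlo orbT. Qed.

(** Comparison of [1 / sqrt x] with the integral of [1 / sqrt y] over [[x, x + 1]]; [sqrtr_subS_ge]
    is the one over [[x - 1, x]]. *)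
Lemma sqrtrS_sub_le (x : R) : 0 < x ->
  2 * (Num.sqrt (x + 1) - Num.sqrt x) <= (Num.sqrt x)^-1.
Proof.
move=> x0; have s0 : 0 < Num.sqrt x by rewrite sqrtr_gt0.
have s1 : 0 <= Num.sqrt (x + 1) by exact: sqrtr_ge0.
rewrite -[_^-1]mul1r ler_pdivlMr//.
have e1 : Num.sqrt x ^+ 2 = x by rewrite sqr_sqrtr// ltW.
have e2 : Num.sqrt (x + 1) ^+ 2 = x + 1 by rewrite sqr_sqrtr//; lra.
have : 0 <= (Num.sqrt (x + 1) - Num.sqrt x) ^+ 2 by rewrite sqr_ge0.
by lra.
Qed.

Lemma sqrtr_subS_ge (x : R) : 1 <= x ->
  (Num.sqrt x)^-1 <= 2 * (Num.sqrt x - Num.sqrt (x - 1)).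
Proof.
move=> x1; have s0 : 0 < Num.sqrt x by rewrite sqrtr_gt0; lra.
rewrite -[_^-1]mul1r ler_pdivrMr//.
have e1 : Num.sqrt x ^+ 2 = x by rewrite sqr_sqrtr//; lra.
have e2 : Num.sqrt (x - 1) ^+ 2 = x - 1 by rewrite sqr_sqrtr//; lra.
have : 0 <= (Num.sqrt x - Num.sqrt (x - 1)) ^+ 2 by rewrite sqr_ge0.
by lra.
Qed.

(* Indices start at 0: [n] and [k] stand for the vertices numbered [n+1] and
   [k+1], and the weight is the deterministic part [1 / sqrt (i j)] of [p_ij]. *)
Definition riemann_weight (al be : R) (n k : nat) : R :=
  if al * n.+1%:R <= k.+1%:R <= be * n.+1%:R
  then (Num.sqrt (k.+1%:R * n.+1%:R))^-1 else 0.

Lemma riemann_weight_ge0 al be n k : 0 <= riemann_weight al be n k.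
Proof. by rewrite /riemann_weight; case: ifP => // _; rewrite invr_ge0 sqrtr_ge0. Qed.

Lemma riemann_weight_le al be n k : 0 < al ->
  riemann_weight al be n k <= (Num.sqrt al)^-1 * n.+1%:R^-1.
Proof.
move=> al0; rewrite /riemann_weight; case: ifP => [/andP[h _]|_]; last first.
  by rewrite mulr_ge0// invr_ge0 ?sqrtr_ge0.
have n0 : 0 < n.+1%:R :> R by [].
have -> : (Num.sqrt al)^-1 * n.+1%:R^-1
    = (Num.sqrt (al * (n.+1%:R * n.+1%:R)))^-1 :> R.
  by rewrite sqrtrM ?(ltW al0)// -expr2 sqrtr_sqr ger0_norm// invfM.
rewrite lef_pV2 ?posrE ?sqrtr_gt0 ?mulr_gt0//.
by rewrite ler_psqrt ?nnegrE ?mulr_ge0 ?(ltW al0)// mulrA ler_pM2r.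
Qed.

Let weightE al be n k : riemann_weight al be n k
  = (if al * n.+1%:R <= k.+1%:R <= be * n.+1%:R
     then (Num.sqrt k.+1%:R)^-1 else 0) / Num.sqrt n.+1%:R.
Proof.
rewrite /riemann_weight; case: ifP => _; last by rewrite mul0r.
by rewrite sqrtrM// invfM.
Qed.

Lemma sum_riemann_weight_le al be n N : al <= be ->
  \sum_(k < N) riemann_weight al be n k
    <= 2 * (Num.sqrt be - Num.sqrt (al - n.+1%:R^-1)).
Proof.
move=> albe; have n0 : 0 < n.+1%:R :> R by [].
(* An index of the range has [k >= al (n+1) - 1], where [k] is the left end of the cell [[k, k+1]].
   Where this bound is negative, its [Num.sqrt] is 0. *)
set lo := Num.sqrt (al * n.+1%:R - 1); set hi := Num.sqrt (be * n.+1%:R).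
have bd k : (if al * n.+1%:R <= k.+1%:R <= be * n.+1%:R
     then (Num.sqrt k.+1%:R)^-1 else 0)
   <= 2 * (clamp lo hi (Num.sqrt k.+1%:R) - clamp lo hi (Num.sqrt k%:R)).
  have kk : Num.sqrt k%:R <= Num.sqrt k.+1%:R :> R.
    by rewrite ler_wsqrtr// ler_nat.
  case: ifP => [/andP[h1 h2]|_]; last first.
    by rewrite mulr_ge0//; case/andP: (clampS lo hi kk).
  have k1 : Num.sqrt k.+1%:R <= hi by rewrite ler_wsqrtr.
  have k2 : lo <= Num.sqrt k%:R.
    by rewrite ler_wsqrtr//; move: h1; rewrite -natr1; lra.
  rewrite !clampE; last 2 first.
  - by rewrite k2 (le_trans kk).
  - by rewrite k1 (le_trans k2).
  have := @sqrtr_subS_ge k.+1%:R; rewrite -{4}natr1 addrK; apply.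
  by rewrite ler1n.
under eq_bigr do rewrite weightE; rewrite -mulr_suml.
rewrite ler_pdivrMr ?sqrtr_gt0//.
apply: (@le_trans _ _ (2 * (clamp lo hi (Num.sqrt N%:R) - clamp lo hi (Num.sqrt 0%:R)))).
  rewrite -(big_mkord xpredT (fun k => if al * n.+1%:R <= k.+1%:R <= be * n.+1%:R
     then (Num.sqrt k.+1%:R)^-1 else 0 : R)).
  rewrite -(telescope_sumr (fun k => clamp lo hi (Num.sqrt k%:R)))// mulr_sumr.
  by apply: ler_sum => k _; exact: bd.
rewrite -mulrA ler_pM2l//.
have -> : (Num.sqrt be - Num.sqrt (al - n.+1%:R^-1)) * Num.sqrt n.+1%:R = hi - lo.
  rewrite mulrBl; congr (_ - _).
    by rewrite /hi mulrC -sqrtrM ?(ltW n0)// mulrC.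
  by rewrite /lo mulrC -sqrtrM ?(ltW n0)// mulrBr divff ?gt_eqF// mulrC.
have lohi : lo <= hi.
  by rewrite ler_wsqrtr//; have := ler_pM2r n0 al be; rewrite albe; lra.
have /andP[_] := clamp_bounds (Num.sqrt N%:R) lohi.
by have /andP[] := clamp_bounds (Num.sqrt 0%:R) lohi; lra.
Qed.

Lemma sum_riemann_weight_ge al be n N : 0 < al -> be * n.+1%:R <= N%:R ->
  2 * (Num.sqrt be - Num.sqrt (al + n.+1%:R^-1))
    <= \sum_(k < N) riemann_weight al be n k.
Proof.
move=> al0 bN; have n0 : 0 < n.+1%:R :> R by [].
(* If [k + 1] is below the range, the cell [[k+1, k+2]] ends before [al (n+1) + 1], so clamping
   makes it vanish. *)
set lo := Num.sqrt (al * n.+1%:R + 1); set hi := Num.sqrt (be * n.+1%:R).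
have aln : 0 < al * n.+1%:R by rewrite mulr_gt0.
have lohi : (Num.sqrt be - Num.sqrt (al + n.+1%:R^-1)) * Num.sqrt n.+1%:R = hi - lo.
  rewrite mulrBl; congr (_ - _).
    by rewrite /hi mulrC -sqrtrM ?(ltW n0)// mulrC.
  by rewrite /lo mulrC -sqrtrM ?(ltW n0)// mulrDr divff ?gt_eqF// mulrC.
have bd k : 2 * (clamp lo hi (Num.sqrt k.+2%:R) - clamp lo hi (Num.sqrt k.+1%:R))
    <= (if al * n.+1%:R <= k.+1%:R <= be * n.+1%:R
     then (Num.sqrt k.+1%:R)^-1 else 0).
  have kk : Num.sqrt k.+1%:R <= Num.sqrt k.+2%:R :> R.
    by rewrite ler_wsqrtr// ler_nat.
  case: ifP => [_|/negbT].
    have := @sqrtrS_sub_le k.+1%:R (ltr0Sn _ _); rewrite natr1; apply: le_trans.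
    by rewrite ler_pM2l//; case/andP: (clampS lo hi kk).
  rewrite negb_and -!ltNge => /orP[h|h].
    have h1 : Num.sqrt k.+2%:R <= lo.
      by rewrite ler_wsqrtr// -natr1; lra.
    have h2 := le_trans kk h1.
    by rewrite !clamp_lo// subrr mulr0.
  have h1 : hi <= Num.sqrt k.+1%:R by rewrite ler_wsqrtr// ltW.
  have h2 := le_trans h1 kk.
  by rewrite /clamp (min_idPl h1) (min_idPl h2) subrr mulr0.
under eq_bigr do rewrite weightE; rewrite -mulr_suml.
rewrite ler_pdivlMr ?sqrtr_gt0// -mulrA lohi.
apply: (@le_trans _ _ (2 * (clamp lo hi (Num.sqrt N.+1%:R) - clamp lo hi (Num.sqrt 1%:R)))); last first.
  rewrite -(big_mkord xpredT (fun k => if al * n.+1%:R <= k.+1%:R <= be * n.+1%:R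
     then (Num.sqrt k.+1%:R)^-1 else 0 : R)).
  rewrite -(telescope_sumr (fun k => clamp lo hi (Num.sqrt k.+1%:R)))// mulr_sumr.
  by apply: ler_sum => k _; exact: bd.
rewrite ler_pM2l//.
have h1 : Num.sqrt 1%:R <= lo by rewrite ler_wsqrtr//; lra.
have h2 : hi <= Num.sqrt N.+1%:R.
  by rewrite ler_wsqrtr// (le_trans bN)// ler_nat.
by rewrite (clamp_lo _ h1) lerD2r /clamp (min_idPl h2) le_max lexx orbT.
Qed.

Lemma cvg_sum_riemann_weight al be (N : nat -> nat) : 0 < al -> al < be ->
  (forall n, be * n.+1%:R <= (N n)%:R) ->
  \sum_(k < N n) riemann_weight al be n k @[n --> \oo]
    --> 2 * (Num.sqrt be - Num.sqrt al).
Proof.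
move=> al0 albe bN.
have sc : continuous (@Num.sqrt R) by exact: sqrt_continuous.
have h1 : al + n.+1%:R^-1 @[n --> \oo] --> al.
  rewrite -[X in _ --> X]addr0; apply: cvgD; first exact: cvg_cst.
  exact: cvg_harmonic.
have h2 : al - n.+1%:R^-1 @[n --> \oo] --> al.
  rewrite -[X in _ --> X]subr0; apply: cvgB; first exact: cvg_cst.
  exact: cvg_harmonic.
apply: (@squeeze_cvgr _ _ _ _
  (fun n => 2 * (Num.sqrt be - Num.sqrt (al + n.+1%:R^-1)))
  (fun n => 2 * (Num.sqrt be - Num.sqrt (al - n.+1%:R^-1)))).
- apply: nearW => n; rewrite sum_riemann_weight_le ?(ltW albe)// andbT.
  exact: sum_riemann_weight_ge.
- apply: cvgMl_tmp; apply: cvgB; first exact: cvg_cst.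
  exact: (cvg_comp _ _ h1 (sc al)).
- apply: cvgMl_tmp; apply: cvgB; first exact: cvg_cst.
  exact: (cvg_comp _ _ h2 (sc al)).
Qed.

End RiemannSum.

(** * Weighted L1 law of large numbers *)

Section RootSequence.
Context (R : realType).

(** Its inverse is the truncation level [M] of the whole development: [M] tends to infinity while
    [M^2 / (n+1)] still tends to 0. *)
Definition root4_harmonic (n : nat) : R := Num.sqrt (Num.sqrt (n.+1%:R^-1)).

Lemma root4_harmonic_gt0 n : 0 < root4_harmonic n.
Proof. by rewrite !sqrtr_gt0 invr_gt0. Qed.

Lemma root4_harmonic_exp4 n : root4_harmonic n ^+ 4 = n.+1%:R^-1.
Proof.
have -> : root4_harmonic n ^+ 4 = (root4_harmonic n ^+ 2) ^+ 2.
  by rewrite -exprM.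
by rewrite !sqr_sqrtr// ?sqrtr_ge0// invr_ge0.
Qed.

Lemma cvg_root4_harmonic : root4_harmonic n @[n --> \oo] --> (0 : R).
Proof.
have sc : continuous (@Num.sqrt R) by exact: sqrt_continuous.
have h := cvg_comp _ _ (@cvg_harmonic R) (sc 0).
rewrite sqrtr0 in h; have := cvg_comp _ _ h (sc 0).
by rewrite sqrtr0.
Qed.

Lemma near_le_root4_harmonicV (x : R) :
  \forall n \near \oo, x <= (root4_harmonic n)^-1.
Proof.
have [x0|x0] := ltP 0 x; last first.
  by apply: nearW => n; rewrite (le_trans x0)// invr_ge0 ltW// root4_harmonic_gt0.
have /cvgrPdist_lt/(_ x^-1) := cvg_root4_harmonic.
rewrite invr_gt0 => /(_ x0); apply: filterS => n.
rewrite sub0r normrN gtr0_norm ?root4_harmonic_gt0// => h.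
by rewrite -[x]invrK lef_pV2 ?posrE ?invr_gt0 ?root4_harmonic_gt0// ltW.
Qed.

End RootSequence.

Section WeakLaw.
Context d (T : measurableType d) (R : realType) (P : probability T R).

Lemma iid_Ex d' (T' : measurableType d') (Z : nat -> {RV P >-> T'})
    (phi : T' -> R) :
  identically_distributed P Z -> measurable_fun setT phi ->
  (forall y, 0 <= phi y) -> intg P (fun w => phi (Z 0%N w)) ->
  forall k, intg P (fun w => phi (Z k w)) /\
    Ex P (fun w => phi (Z k w)) = Ex P (fun w => phi (Z 0%N w)).
Proof.
move=> iZ mphi phi0 I0 k.
have mZ j : measurable_fun setT (fun w => phi (Z j w)).
  by apply: measurableT_comp.
have E j : (\int[P]_w (phi (Z j w))%:E
    = \int[distribution P (Z j)]_y (phi y)%:E)%E.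
  rewrite (@ge0_integral_distribution _ _ _ _ _ P (Z j) (EFin \o phi))//.
  exact/measurable_EFinP.
have Ek : (\int[P]_w (phi (Z k w))%:E = \int[P]_w (phi (Z 0%N w))%:E)%E.
  by rewrite !E; apply: eq_measure_integral => A mA _; exact: iZ.
split; last by rewrite /Ex /Rintegral Ek.
apply: intg_ge0 => //; rewrite Ek -(EFin_Ex I0).
exact: ltry.
Qed.

Lemma iid_Ex_pair d' (T' : measurableType d') (Z : nat -> {RV P >-> T'})
    (phi psi : T' -> R) (j k : nat) :
  iid P Z -> j != k ->
  measurable_fun setT phi -> (forall y, 0 <= phi y) ->
  intg P (fun w => phi (Z 0%N w)) ->
  measurable_fun setT psi -> (forall y, 0 <= psi y) ->
  intg P (fun w => psi (Z 0%N w)) ->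
  intg P (fun w => phi (Z j w) * psi (Z k w)) /\
  Ex P (fun w => phi (Z j w) * psi (Z k w))
    = Ex P (fun w => phi (Z 0%N w)) * Ex P (fun w => psi (Z 0%N w)).
Proof.
move=> [indZ idZ] jk mphi phi0 Iphi mpsi psi0 Ipsi.
pose f i := if i == j then phi else psi.
have kj : (k == j) = false by rewrite eq_sym (negbTE jk).
have [||||] := @intg_Ex_prod _ _ _ P _ _ nat Z f [:: j; k] indZ.
- by rewrite /= inE jk.
- by move=> i; rewrite /f; case: ifP.
- by move=> i y; rewrite /f; case: ifP.
- move=> i _; rewrite /f; case: ifP => _; first exact: (iid_Ex idZ mphi phi0 Iphi i).1.
  exact: (iid_Ex idZ mpsi psi0 Ipsi i).1.
have -> : (fun w => \prod_(i <- [:: j; k]) f i (Z i w))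
    = (fun w => phi (Z j w) * psi (Z k w)).
  by apply/funext => w; rewrite !big_cons big_nil mulr1 /f eqxx kj.
rewrite !big_cons big_nil mulr1 /f eqxx kj.
by rewrite (iid_Ex idZ mphi phi0 Iphi j).2 (iid_Ex idZ mpsi psi0 Ipsi k).2.
Qed.

Lemma sum_sqr_weights n (u : nat -> R) :
  (\sum_(j < n) u j) ^+ 2 = \sum_(j < n) \sum_(k < n) u j * u k.
Proof. by rewrite expr2 mulr_suml; under eq_bigr do rewrite mulr_sumr. Qed.

(* Truncating at [(root4_harmonic n)^-1 = (n+1)^(1/4)] leaves a variance of
   order (n+1)^(-1/2), so Chebyshev's inequality in the form
   [|z| <= r + z^2 / r] with [r = (n+1)^(-1/4)] controls the L1 norm. *)
Lemma weighted_L1_law_of_large_numbers d' (T' : measurableType d')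
    (Z : nat -> {RV P >-> T'}) (phi : T' -> R) (c : nat -> nat -> R)
    (N : nat -> nat) (gamma A : R) :
  iid P Z -> measurable_fun setT phi -> (forall y, 0 <= phi y) ->
  intg P (fun w => phi (Z 0%N w)) ->
  (forall n k, 0 <= c n k <= A * n.+1%:R^-1) ->
  \sum_(k < N n) c n k @[n --> \oo] --> gamma ->
  Ex P (fun w => `|\sum_(k < N n) c n k * phi (Z k w)
    - gamma * Ex P (fun w => phi (Z 0%N w))|) @[n --> \oo] --> 0.
Proof.
move=> iZ mphi phi0 I0 cA cg.
have [indZ idZ] := iZ.
set m := Ex P _.
pose r n : R := root4_harmonic R n.
have r0 n : 0 < r n by exact: root4_harmonic_gt0.
pose psi n y : R := Num.min (phi y) (r n)^-1.
have mpsi n : measurable_fun setT (psi n).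
  by apply: measurable_minr => //; exact: measurable_cst.
have psi0 n y : 0 <= psi n y by rewrite le_min phi0 invr_ge0 ltW.
have psiM n y : psi n y <= (r n)^-1 by rewrite ge_min lexx orbT.
have psile n y : psi n y <= phi y by rewrite ge_min lexx.
have mpsiZ n k : measurable_fun setT (fun w => psi n (Z k w)).
  exact: measurableT_comp.
have Ipsi n k : intg P (fun w => psi n (Z k w)).
  by apply: (@intg_bounded _ _ _ _ _ (r n)^-1) => // w; rewrite ger0_norm.
pose g n := Ex P (fun w => psi n (Z 0%N w)).
have Epsi n k : Ex P (fun w => psi n (Z k w)) = g n.
  by have [] := iid_Ex idZ (mpsi n) (psi0 n) (Ipsi n 0%N) k.
have g0 n : 0 <= g n by apply: Ex_ge0 => w.
have Iphi k := (iid_Ex idZ mphi phi0 I0 k).1.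
have Ephi k := (iid_Ex idZ mphi phi0 I0 k).2.
pose S n := \sum_(k < N n) c n k.
have c0 n k : 0 <= c n k by case/andP: (cA n k).
have S0 n : 0 <= S n by apply: sumr_ge0.
pose V n w := \sum_(k < N n) c n k * psi n (Z k w).
have IV n : intg P (V n) by apply: intg_sum => k _; exact: intgZ.
have EV n : Ex P (V n) = S n * g n.
  rewrite Ex_sum => [|k _]; last exact: intgZ.
  by rewrite mulr_suml; apply: eq_bigr => k _; rewrite ExZ// Epsi.
have Ipair n j k : intg P (fun w => psi n (Z j w) * psi n (Z k w)).
  apply: (@intgM_bounded _ _ _ _ _ _ (r n)^-1) => // w.
  by rewrite ger0_norm.
(* Independence gives [g n ^+ 2] off the diagonal; on the diagonal the truncation level bounds the
   square. *)
have Epair n j k : Ex P (fun w => psi n (Z j w) * psi n (Z k w))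
    <= g n ^+ 2 + (j == k)%:R * (r n) ^- 2.
  have [<-|jk] := eqVneq j k.
    rewrite mul1r (le_trans (y := (r n) ^- 2))//; last by rewrite lerDr sqr_ge0.
    rewrite -(@Ex_cst _ _ _ P ((r n) ^- 2)); apply: le_Ex => //; first exact: intg_cst.
    by move=> w; rewrite -exprVn expr2 ler_pM.
  by rewrite mul0r addr0 (iid_Ex_pair iZ jk _ _ _ _ _ _).2// expr2.
have V2E n w : V n w ^+ 2 = \sum_(j < N n) \sum_(k < N n)
    (c n j * c n k) * (psi n (Z j w) * psi n (Z k w)).
  rewrite /V (sum_sqr_weights _ (fun k => c n k * psi n (Z k w))).
  by apply: eq_bigr => j _; apply: eq_bigr => k _; ring.
have IV2 n : intg P (fun w => V n w ^+ 2).
  under eq_fun do rewrite V2E.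
  by apply: intg_sum => j _; apply: intg_sum => k _; exact: intgZ.
have EV2 n : Ex P (fun w => V n w ^+ 2) <= (S n * g n) ^+ 2 + A * r n ^+ 2 * S n.
  under Ex_ext do rewrite V2E.
  rewrite Ex_sum => [|j _]; last by apply: intg_sum => k _; exact: intgZ.
  have -> : (S n * g n) ^+ 2 + A * r n ^+ 2 * S n
      = \sum_(j < N n) \sum_(k < N n) c n j * c n k * g n ^+ 2
        + \sum_(k < N n) A * r n ^+ 2 * c n k.
    rewrite -mulr_sumr; congr (_ + _).
    rewrite exprMn (sum_sqr_weights _ (c n)) mulr_suml.
    by apply: eq_bigr => j _; rewrite mulr_suml.
  rewrite -big_split/=; apply: ler_sum => j _.
  rewrite Ex_sum => [|k _]; last exact: intgZ.
  rewrite (le_trans (y := \sum_(k < N n) (c n j * c n k * g n ^+ 2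
      + c n j * c n k * ((j == k :> nat)%:R * (r n) ^- 2))))//.
    apply: ler_sum => k _; rewrite ExZ// -mulrDr ler_wpM2l//.
    by rewrite mulr_ge0.
  rewrite big_split/= lerD2l (bigD1 j)//= eqxx mul1r big1 ?addr0; last first.
    by move=> k /negbTE kj; rewrite (_ : (j == k :> nat) = false) ?mul0r ?mulr0// eq_sym.
  have /andP[_ h] := cA n j.
  have h' : c n j * (r n) ^- 2 <= A * r n ^+ 2.
    rewrite ler_pdivrMr ?exprn_gt0// -mulrA -exprD root4_harmonic_exp4//.
  by rewrite -mulrA [leRHS]mulrC ler_wpM2l.
have IVg n : intg P (fun w => (V n w - S n * g n) ^+ 2).
  apply: (intg_ext (f := fun w => V n w ^+ 2 - 2 * (S n * g n) * V n w
      + (S n * g n) ^+ 2)).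
    by move=> w; ring.
  apply: intgD; last exact: intg_cst.
  by apply: intgB => //; exact: intgZ.
have EVg n : Ex P (fun w => (V n w - S n * g n) ^+ 2) <= A * r n ^+ 2 * S n.
  rewrite (Ex_ext (g := fun w => V n w ^+ 2 - 2 * (S n * g n) * V n w
      + (S n * g n) ^+ 2)); last by move=> w; ring.
  rewrite ExD; [|by apply: intgB => //; exact: intgZ|exact: intg_cst].
  rewrite ExB//; last exact: intgZ.
  rewrite ExZ// EV Ex_cst; have := EV2 n; lra.
(* In order: the slack of the inequality [|z| <= r + z^2 / r], the variance divided by [r], the mean
   lost by truncating, the error in the centring. *)
pose B n := r n + A * r n * S n + S n * (m - g n) + `|S n * g n - gamma * m|.
have dev n w : `|\sum_(k < N n) c n k * phi (Z k w) - gamma * m|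
    <= r n + (r n)^-1 * (V n w - S n * g n) ^+ 2
       + \sum_(k < N n) c n k * (phi (Z k w) - psi n (Z k w))
       + `|S n * g n - gamma * m|.
  set D := \sum_(k < N n) c n k * (phi (Z k w) - psi n (Z k w)).
  have DE : \sum_(k < N n) c n k * phi (Z k w) = D + V n w.
    by rewrite -big_split; apply: eq_bigr => k _ /=; ring.
  have D0 : 0 <= D by apply: sumr_ge0 => k _; rewrite mulr_ge0// subr_ge0.
  have q (z : R) : `|z| <= r n + (r n)^-1 * z ^+ 2.
    rewrite -(ler_pM2l (r0 n)) mulrDr mulrA divff ?gt_eqF// mul1r.
    rewrite -(real_normK (num_real z)).
    by have := sqr_ge0 (`|z| - r n / 2); have := r0 n; have := sqr_ge0 (r n); nra.
  have -> : \sum_(k < N n) c n k * phi (Z k w) - gamma * m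
    = (V n w - S n * g n) + D + (S n * g n - gamma * m) by rewrite DE; ring.
  rewrite (le_trans (ler_normD _ _))// lerD2r.
  by rewrite (le_trans (ler_normD _ _))// (ger0_norm D0) lerD2r.
have ID n : intg P (fun w => \sum_(k < N n) c n k * (phi (Z k w) - psi n (Z k w))).
  by apply: intg_sum => k _; apply: intgZ; exact: intgB.
have IF n : intg P (fun w => `|\sum_(k < N n) c n k * phi (Z k w) - gamma * m|).
  apply: intg_norm; apply: intgB; last exact: intg_cst.
  by apply: intg_sum => k _; exact: intgZ.
have bound n : Ex P (fun w => `|\sum_(k < N n) c n k * phi (Z k w) - gamma * m|)
    <= B n.
  have I1 : intg P (fun w => r n + (r n)^-1 * (V n w - S n * g n) ^+ 2).
    by apply: intgD; [exact: intg_cst|exact: intgZ].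
  apply: (le_trans (le_Ex (IF n) _ (dev n))).
    by apply: intgD; [exact: intgD|exact: intg_cst].
  rewrite ExD; [|exact: intgD|exact: intg_cst].
  rewrite ExD// ExD; [|exact: intg_cst|exact: intgZ].
  rewrite !Ex_cst ExZ// /B lerD2r lerD//.
    rewrite lerD2l; have := EVg n; rewrite -(ler_pM2l (r0 n)) => h.
    rewrite mulrC ler_pdivrMr//; have := EVg n; rewrite expr2; lra.
  rewrite Ex_sum => [|k _]; last by apply: intgZ; exact: intgB.
  rewrite mulr_suml; apply: ler_sum => k _.
  by rewrite ExZ ?ExB//; [rewrite Ephi Epsi|exact: intgB].
have cvgr : r n @[n --> \oo] --> 0 by exact: cvg_root4_harmonic.
have cvgg : g n @[n --> \oo] --> m.
  apply: (Ex_cvg (g := fun w => phi (Z 0%N w))) => //.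
    by move=> n w; rewrite ger0_norm.
  move=> w; apply: cvg_near_cst.
  apply: filterS (near_le_root4_harmonicV (phi (Z 0%N w))) => n h.
  by rewrite /psi; apply/eqP; rewrite min_l.
have cvgB0 : B n @[n --> \oo] --> 0.
  have -> : 0 = 0 + A * 0 * gamma + gamma * (m - m) + `|gamma * m - gamma * m|.
    by rewrite mulr0 mul0r !subrr mulr0 normr0 !addr0.
  apply: cvgD; [apply: cvgD; [apply: cvgD => //|]|].
  - by apply: cvgM => //; apply: cvgMl_tmp.
  - by apply: cvgM => //; apply: cvgB => //; exact: cvg_cst.
  - by apply: cvg_norm; apply: cvgB; [exact: cvgM|exact: cvg_cst].
apply: (squeeze_cvgr _ (cvg_cst 0) cvgB0); apply: nearW => n.
by rewrite bound andbT Ex_ge0.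
Qed.

End WeakLaw.

(** * Multiaffine functions and generating functions *)

Section Multiaffine.
Context (R : realType) (K : choiceType).
Implicit Types (D : seq K) (F G : (K -> R) -> R).

(** Polynomials of degree at most one in each variable of [D]. Since no variable is squared, the
    expansion contains only products of distinct variables, those whose expectations the edge model
    prescribes. The recursion peels off one variable at a time, [G] and [H] being constant in it. *)
Fixpoint multiaffine D F : Prop :=
  if D is e :: D' then
    e \notin D' /\ exists G H, [/\ multiaffine D' G, multiaffine D' H &
      F =1 (fun x => G x + x e * H x)]
  else exists c, F =1 (fun=> c).

Lemma multiaffine_uniq D F : multiaffine D F -> uniq D.
Proof.
elim: D F => [//|e D ih] F /= [eD [G [H [/ih uD _ _]]]].
by rewrite eD uD.
Qed.

Lemma multiaffine_cst D c : uniq D -> multiaffine D (fun=> c).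
Proof.
elim: D c => [c _|e D ih c /= /andP[eD uD]]; first by exists c.
split => //; exists (fun=> c), (fun=> 0); split; [exact: ih|exact: ih|].
by move=> x; rewrite mulr0 addr0.
Qed.

Lemma multiaffineZ D c F : multiaffine D F -> multiaffine D (fun x => c * F x).
Proof.
elim: D F => [F [k Fk]|e D ih F [eD [G [H [/ih MG /ih MH FE]]]]].
  by exists (c * k) => x; rewrite Fk.
split => //; eexists; eexists; split; [exact: MG|exact: MH|].
by move=> x; rewrite FE mulrDr mulrCA.
Qed.

Lemma multiaffineD D F G : multiaffine D F -> multiaffine D G ->
  multiaffine D (fun x => F x + G x).
Proof.
elim: D F G => [F G [k Fk] [l Gl]|e D ih F G].
  by exists (k + l) => x; rewrite Fk Gl.
move=> [eD [F1 [F2 [M1 M2 FE]]]] [_ [G1 [G2 [M3 M4 GE]]]].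
split => //; eexists; eexists; split; [exact: ih _ _ M1 M3|exact: ih _ _ M2 M4|].
by move=> x; rewrite FE GE; ring.
Qed.

Lemma multiaffineM D D' F G : multiaffine D F -> multiaffine D' G ->
  uniq (D ++ D') -> multiaffine (D ++ D') (fun x => F x * G x).
Proof.
elim: D F => [F [c Fc] MG _|e D ih F [eD [F1 [F2 [M1 M2 FE]]]] MG] /=.
  have -> : (fun x => F x * G x) = (fun x => c * G x).
    by apply/funext => x; rewrite Fc.
  exact: multiaffineZ.
move=> /andP[eDD uDD]; split => //.
eexists; eexists; split; [exact: ih _ M1 MG uDD|exact: ih _ M2 MG uDD|].
by move=> x; rewrite FE; ring.
Qed.

Lemma multiaffine_prod (I : Type) (s : seq I) (D : I -> seq K)
    (F : I -> (K -> R) -> R) :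
  (forall i, multiaffine (D i) (F i)) -> uniq (flatten [seq D i | i <- s]) ->
  multiaffine (flatten [seq D i | i <- s]) (fun x => \prod_(i <- s) F i x).
Proof.
move=> MF; elim: s => [_|i s ih /= u].
  by exists 1 => x; rewrite big_nil.
have -> : (fun x => \prod_(j <- i :: s) F j x)
    = (fun x => F i x * \prod_(j <- s) F j x).
  by apply/funext => x; rewrite big_cons.
by apply: multiaffineM => //; apply: ih; move: u; rewrite cat_uniq => /and3P[].
Qed.

Lemma multiaffine_cons D e F G : e \notin D -> multiaffine D F ->
  multiaffine D G -> multiaffine (e :: D) (fun x => F x + x e * G x).
Proof. by move=> eD MF MG; split => //; exists F, G. Qed.

Lemma multiaffine_bounded D F : multiaffine D F ->
  exists M, forall x : K -> R, (forall e, 0 <= x e <= 1) -> `|F x| <= M.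
Proof.
elim: D F => [F [c Fc]|e D ih F [_ [G [H [/ih[M MG] /ih[M' MH] FE]]]]].
  by exists `|c| => x _; rewrite Fc.
exists (M + M') => x x01; rewrite FE (le_trans (ler_normD _ _))// lerD ?MG//.
rewrite normrM (le_trans _ (MH x x01))// ler_piMl//.
by case/andP: (x01 e) => x0 x1; rewrite ger0_norm.
Qed.

Lemma multiaffine_measurable D F d (T : measurableType d) (u : K -> T -> R) :
  multiaffine D F -> (forall e, measurable_fun setT (u e)) ->
  measurable_fun setT (fun w => F (u^~ w)).
Proof.
move=> MF mu; elim: D F MF => [F [c Fc]|e D ih F [_ [G [H [/ih MG /ih MH FE]]]]].
  by under eq_fun do rewrite Fc; exact: measurable_cst.
under eq_fun do rewrite FE.
by apply: measurable_funD => //; exact: measurable_funM.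
Qed.

(* Expectations of products determine those of multiaffine functions; this is
   how probabilities of edges replace the edges inside a generating function. *)
Lemma Ex_multiaffine d (T : measurableType d) (P : probability T R)
    (u v : K -> T -> R) (phi : T -> R) D F :
  (forall e, measurable_fun setT (u e)) ->
  (forall e, measurable_fun setT (v e)) ->
  (forall e w, 0 <= u e w <= 1) -> (forall e w, 0 <= v e w <= 1) ->
  intg P phi ->
  (forall s, uniq s -> Ex P (fun w => phi w * \prod_(e <- s) u e w)
    = Ex P (fun w => phi w * \prod_(e <- s) v e w)) ->
  multiaffine D F ->
  Ex P (fun w => phi w * F (u^~ w)) = Ex P (fun w => phi w * F (v^~ w)).
Proof.
move=> mu mv u01 v01 Iphi uv MF.
have prod01 (z : K -> T -> R) r w : (forall e w, 0 <= z e w <= 1) ->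
    `|\prod_(e <- r) z e w| <= 1.
  move=> z01; rewrite ger0_norm; first by apply: prodr_ile1 => e _.
  by apply: prodr_ge0 => e _; case/andP: (z01 e w).
have I (z : K -> T -> R) r D' G : (forall e, measurable_fun setT (z e)) ->
    (forall e w, 0 <= z e w <= 1) -> multiaffine D' G ->
    intg P (fun w => phi w * \prod_(e <- r) z e w * G (z^~ w)).
  move=> mz z01 MG; have [M GM] := multiaffine_bounded MG.
  apply: (intg_ext (f := fun w => (\prod_(e <- r) z e w * G (z^~ w)) * phi w)).
    by move=> w; ring.
  apply: (@intgM_bounded _ _ _ _ _ _ M) => //.
    apply: measurable_funM; last exact: multiaffine_measurable MG mz.
    by apply: measurable_prod => e _.
  move=> w; rewrite normrM (le_trans _ (GM (z^~ w) _))//.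
  by rewrite ler_piMl// prod01.
(* Strengthened for the induction: [r] holds the variables already pulled out of [F]. In
   [G + x e * H], the part [H] moves [e] into [r]; at the end only monomials are left. *)
suff: forall r, uniq (r ++ D) ->
    Ex P (fun w => phi w * \prod_(e <- r) u e w * F (u^~ w))
    = Ex P (fun w => phi w * \prod_(e <- r) v e w * F (v^~ w)).
  move=> /(_ [::] (multiaffine_uniq MF)).
  under Ex_ext do rewrite big_nil mulr1.
  by under [X in _ = X -> _]Ex_ext do rewrite big_nil mulr1.
elim: D F MF => [F [c Fc] r|e D ih F [eD [G [H [MG MH FE]]]] r].
  rewrite cats0 => ur.
  have I0 (z : K -> T -> R) : (forall e, measurable_fun setT (z e)) ->
      (forall e w, 0 <= z e w <= 1) ->
      Ex P (fun w => phi w * \prod_(e <- r) z e w * F (z^~ w))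
      = Ex P (fun w => phi w * \prod_(e <- r) z e w) * c.
    move=> mz z01; rewrite -ExZr; last first.
      have := I z r [::] (fun=> 1) mz z01 (@multiaffine_cst [::] 1 isT).
      by under eq_fun do rewrite mulr1.
    by apply: Ex_ext => w; rewrite Fc.
  by rewrite !I0// uv.
rewrite -cat_rcons => ur.
have split (z : K -> T -> R) : (forall e, measurable_fun setT (z e)) ->
      (forall e w, 0 <= z e w <= 1) ->
    Ex P (fun w => phi w * \prod_(e <- r) z e w * F (z^~ w))
    = Ex P (fun w => phi w * \prod_(e <- r) z e w * G (z^~ w))
    + Ex P (fun w => phi w * \prod_(e <- rcons r e) z e w * H (z^~ w)).
  move=> mz z01; rewrite -ExD; [|exact: (I z r D G)|exact: (I z (rcons r e) D H)].
  apply: Ex_ext => w; rewrite FE -cats1 big_cat big_seq1/=; ring.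
rewrite !split//; congr (_ + _); last exact: ih.
apply: ih => //.
by apply: subseq_uniq ur; rewrite cat_subseq// subseq_rcons.
Qed.

End Multiaffine.

Section GeneratingFunction.
Context (R : realType) d (T : measurableType d) (P : probability T R).

(** The remainder lives where [L] exceeds [n], and there [s ^+ L] is at most [s ^+ n.+1]. *)
Lemma pgf_expansion (L : T -> nat) (s : R) n : 0 <= s <= 1 ->
  measurable_fun setT L ->
  `|Ex P (fun w => s ^+ L w)
    - \sum_(k < n.+1) Ex P (fun w => (L w == k)%:R) * s ^+ k| <= s ^+ n.+1.
Proof.
move=> /andP[s0 s1] mL.
have mf (f : nat -> R) : measurable_fun setT (fun w => f (L w)).
  by apply: (@measurableT_comp _ _ _ _ _ _ f).
have I1 : intg P (fun w => s ^+ L w).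
  apply: (@intg_bounded _ _ _ _ _ 1); first exact: (mf (fun k => s ^+ k)).
  by move=> w; rewrite ger0_norm ?exprn_ge0// exprn_ile1.
have I2 k : intg P (fun w => (L w == k)%:R).
  apply: (@intg_bounded _ _ _ _ _ 1); first exact: (mf (fun j => (j == k)%:R)).
  by move=> w; case: (_ == _); rewrite ?normr1 ?normr0.
rewrite (eq_bigr (fun k : 'I_n.+1 => Ex P (fun w => (L w == k)%:R * s ^+ k))); last first.
  by move=> k _; rewrite ExZr.
rewrite -Ex_sum => [|k _]; last exact: intgZr.
have I3 : intg P (fun w => \sum_(k < n.+1) (L w == k)%:R * s ^+ k).
  by apply: intg_sum => k _; exact: intgZr.
rewrite -ExB// (le_trans (le_norm_Ex _))//; first exact: intgB.
rewrite -[leRHS](@Ex_cst _ _ _ P); apply: le_Ex.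
- by apply: intg_norm; exact: intgB.
- exact: intg_cst.
move=> w; have [Ln|nL] := ltnP (L w) n.+1.
  rewrite (bigD1 (Ordinal Ln))//= eqxx mul1r big1 ?addr0 ?subrr ?normr0 ?exprn_ge0//.
  move=> k /negbTE kL; rewrite (_ : (L w == k) = false) ?mul0r//.
  by apply/negbTE; rewrite eq_sym -val_eqE/= in kL *; rewrite kL.
rewrite big1 ?subr0; last first.
  by move=> k _; rewrite (gtn_eqF (leq_trans (ltn_ord k) nL)) mul0r.
by rewrite ger0_norm ?exprn_ge0// ler_wiXn2l.
Qed.

End GeneratingFunction.

Lemma cvg_sumr (R : realType) (I : Type) (s : seq I) (F : I -> nat -> R)
    (l : I -> R) : (forall i, F i t @[t --> \oo] --> l i) ->
  \sum_(i <- s) F i t @[t --> \oo] --> \sum_(i <- s) l i.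
Proof.
move=> Fl; elim: s => [|i s ih].
  by under eq_fun do rewrite big_nil; rewrite big_nil; exact: cvg_cst.
by under eq_fun do rewrite big_cons; rewrite big_cons; exact: cvgD.
Qed.

(** Strong induction on [n]: once the coefficients below [n] are known to converge, subtracting them
    and dividing by [s ^+ n] leaves the coefficient [n] up to an error of order [s], and [s] is as
    small as desired. *)
Lemma pgf_continuity (R : realType) d (T : measurableType d)
    (P : probability T R) d' (T' : measurableType d') (P' : probability T' R)
    (L : nat -> T -> nat) (Q : T' -> nat) :
  (forall t, measurable_fun setT (L t)) -> measurable_fun setT Q ->
  (forall s : R, 0 < s < 1 ->
    Ex P (fun w => s ^+ L t w) @[t --> \oo] --> Ex P' (fun w => s ^+ Q w)) ->
  forall n, Ex P (fun w => (L t w == n)%:R) @[t --> \oo]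
    --> Ex P' (fun w => (Q w == n)%:R).
Proof.
move=> mL mQ cvgs n.
have [n' nn] := ubnP n; elim: n' n nn => // n' ih n; rewrite ltnS => nn.
pose p t k := Ex P (fun w => (L t w == k)%:R).
pose q k := Ex P' (fun w => (Q w == k)%:R).
apply/cvgrPdist_le => eps eps0.
(* The final error is [eps / 3 + 2 * s]; the bound 1/2 keeps [s] in the interval where convergence
   is assumed. *)
pose s : R := Num.min (1 / 2) (eps / 3).
have s01 : 0 < s < 1.
  rewrite lt_min gt_min divr_gt0// divr_gt0//=; apply/orP; left; lra.
have s01' : 0 <= s <= 1 by case/andP: s01 => /ltW -> /ltW ->.
have [s0 s1] := andP s01.
have sn : 0 < s ^+ n by rewrite exprn_gt0.
(* Difference of the two series from the coefficient [n] on; it tends to 0 by the induction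
   hypothesis. *)
pose D t := (Ex P' (fun w => s ^+ Q w) - \sum_(k < n) q k * s ^+ k)
  - (Ex P (fun w => s ^+ L t w) - \sum_(k < n) p t k * s ^+ k).
have cD : D t @[t --> \oo] --> 0.
  rewrite -[X in _ --> X](subrr (Ex P' (fun w => s ^+ Q w) - \sum_(k < n) q k * s ^+ k)).
  apply: cvgB; first exact: cvg_cst.
  apply: cvgB; first exact: cvgs.
  apply: cvg_sumr => k; apply: cvgMr_tmp; apply: ih.
  exact: leq_trans (ltn_ord k) nn.
have : 0 < s ^+ n * (eps / 3) by rewrite mulr_gt0// divr_gt0.
move/cvgrPdist_le : cD => /[apply]; apply: filterS => t.
rewrite sub0r normrN => Dt.
have h1 := pgf_expansion P n s01' (mL t).
have h2 := pgf_expansion P' n s01' mQ.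
rewrite !big_ord_recr/= in h1 h2.
have key : `|(q n - p t n) * s ^+ n| <= s ^+ n * (eps / 3) + 2 * s ^+ n.+1.
  rewrite -/(q n) -/(p t n) in h1 h2 *.
  have -> : (q n - p t n) * s ^+ n
    = D t - (Ex P' (fun w => s ^+ Q w) - (\sum_(k < n) q k * s ^+ k + q n * s ^+ n))
      + (Ex P (fun w => s ^+ L t w) - (\sum_(k < n) p t k * s ^+ k + p t n * s ^+ n)).
    by rewrite /D; ring.
  rewrite (le_trans (ler_normD _ _))//.
  have := ler_normB (D t) (Ex P' (fun w => s ^+ Q w) - (\sum_(k < n) q k * s ^+ k + q n * s ^+ n)).
  rewrite /p /q in h1 h2 *; lra.
have s3 : s <= eps / 3 by rewrite ge_min lexx orbT.
move: key; rewrite normrM (gtr0_norm sn).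
have -> : s ^+ n * (eps / 3) + 2 * s ^+ n.+1 = (eps / 3 + 2 * s) * s ^+ n.
  by rewrite exprS; ring.
rewrite ler_pM2r//.
by rewrite /p /q; lra.
Qed.

(** * Deterministic bound for the conditional generating function *)

Section ConditionalGeneratingFunction.
Context (R : realType).
Implicit Types (c x y M sg : R).

(* Dominates [min 1 (c x y)]: by [c M^2] if [x, y <= M], and by 1 otherwise. *)
Definition trunc_err M c x y : R := c * M ^+ 2 + (M < x)%R%:R + (M < y)%R%:R.

Lemma trunc_err_ge0 M c x y : 0 <= c -> 0 <= trunc_err M c x y.
Proof. by move=> c0; rewrite /trunc_err !addr_ge0// mulr_ge0// sqr_ge0. Qed.

Lemma min1_le_trunc_err M c x y : 0 <= c -> 0 <= x -> 0 <= y -> 0 <= M ->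
  Num.min 1 (c * x * y) <= trunc_err M c x y.
Proof.
move=> c0 x0 y0 M0; rewrite /trunc_err.
have cM : 0 <= c * M ^+ 2 by rewrite mulr_ge0// sqr_ge0.
have [Mx|xM] := ltP M x.
  rewrite ge_min; by case: (M < y)%R => /=; apply/orP; left; lra.
have [My|yM] := ltP M y; first by rewrite ge_min; apply/orP; left => /=; lra.
by rewrite ge_min !addr0 -mulrA expr2 ler_wpM2l ?orbT// ler_pM.
Qed.

(** Two errors, each at most [q * p] with [q = c x y] and [p = min 1 q]: the quadratic one between
    [1 - z] and [expR (- z)], and the one for dropping the minimum, where [q - p <= q * p] since
    [p = 1] if [q >= 1]. Then [p] alone is bounded by [trunc_err], which keeps the bound linear in
    [y] up to an indicator. *)
Lemma dist_edge_expRN M c x y sg : 0 <= c -> 0 <= x -> 0 <= y -> 0 <= M ->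
  0 <= sg <= 1 ->
  `|1 - sg * Num.min 1 (c * x * y) - expR (- (sg * (c * x * y)))|
    <= 2 * (c * x * y) * trunc_err M c x y.
Proof.
move=> c0 x0 y0 M0 /andP[s0 s1].
have := min1_le_trunc_err c0 x0 y0 M0.
set q := c * x * y; set r := trunc_err _ _ _ _; set p := Num.min 1 q => pr.
have q0 : 0 <= q by rewrite !mulr_ge0.
have p0 : 0 <= p by rewrite le_min ler01.
have pq : p <= q by rewrite ge_min lexx orbT.
have p1 : p <= 1 by rewrite ge_min lexx.
have qp : q - p <= q * p.
  rewrite /p; case: (leP 1 q) => h; first by rewrite mulr1; lra.
  by rewrite subrr mulr_ge0.
have h1 := dist_1B_expRN (mulr_ge0 s0 p0).
have h2 : `|expR (- (sg * p)) - expR (- (sg * q))| <= sg * (q - p).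
  rewrite (le_trans (dist_expRN _ _)) ?mulr_ge0//.
  by rewrite -mulrBr normrM (ger0_norm s0) distrC ger0_norm ?subr_ge0.
have -> : 1 - sg * p - expR (- (sg * q)) = (1 - sg * p - expR (- (sg * p)))
    + (expR (- (sg * p)) - expR (- (sg * q))) by ring.
rewrite (le_trans (ler_normD _ _))//.
have h3 : (sg * p) ^+ 2 <= q * p.
  rewrite exprMn expr2 -[leRHS]mul1r ler_pM ?mulr_ge0 ?sqr_ge0//.
    by rewrite mulr_ile1.
  by rewrite expr2 ler_wpM2r.
have h4 : sg * (q - p) <= q * p.
  by rewrite (le_trans _ qp)// ler_piMl// subr_ge0.
have h5 : q * p <= q * r by rewrite ler_wpM2l.
rewrite -mulrA; lra.
Qed.

Variables (c : nat -> nat -> R) (x y : nat -> R).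
Hypotheses (c0 : forall i u, 0 <= c i u) (x0 : forall i, 0 <= x i)
  (y0 : forall u, 0 <= y u).

Let p i u := Num.min 1 (c i u * x i * y u).

Let p01 i u : 0 <= p i u <= 1.
Proof. by rewrite le_min ge_min lexx ler01 !mulr_ge0. Qed.

(** Four replacements, one per error term. For each [i], inside the parenthesis: the outer factor by
    an exponential, the inner product by an exponential, the weighted sum of the [y u] by [g]. Then,
    in the last summand, the outer exponent by [y t * k]. The targets [g] and [k] are any
    nonnegative numbers here; the laws of large numbers supply them. *)
Lemma dist_pgf_expRN (s r : seq nat) (t : nat) M sg g k :
  0 <= M -> 0 <= sg <= 1 -> 0 <= g -> 0 <= k ->
  `|\prod_(i <- s) (1 + p i t * (\prod_(u <- r) (1 + p i u * - sg) - 1))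
     - expR (- (y t * k))|
  <= \sum_(i <- s) c i t * x i * y t *
       (2 * trunc_err M (c i t) (x i) (y t)
        + \sum_(u <- r) 2 * (c i u * x i * y u) * trunc_err M (c i u) (x i) (y u)
        + x i * `|\sum_(u <- r) c i u * y u - g|)
     + y t * `|\sum_(i <- s) c i t * (x i * (1 - expR (- (sg * g * x i)))) - k|.
Proof.
move=> M0 /andP[sg0 sg1] g0 k0.
pose pi i := \prod_(u <- r) (1 + p i u * - sg).
pose eta i := expR (- (sg * \sum_(u <- r) c i u * x i * y u)).
pose h i := expR (- (sg * g * x i)).
have q0 i u : 0 <= c i u * x i * y u by rewrite !mulr_ge0.
have f01 i u : 0 <= 1 + p i u * - sg <= 1.
  have /andP[a1 a2] := p01 i u; have : 0 <= p i u * sg by rewrite mulr_ge0.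
  by have : p i u * sg <= 1 by [rewrite mulr_ile1]; move=> *; apply/andP; split; lra.
have pi01 i : 0 <= pi i <= 1.
  apply/andP; split; last by apply: prodr_ile1 => u _.
  by apply: prodr_ge0 => u _; case/andP: (f01 i u).
have exp01 (z : R) : 0 <= z -> 0 <= expR (- z) <= 1.
  by move=> z0; rewrite expR_ge0 expRN_le1.
have eta01 i : 0 <= eta i <= 1 by rewrite exp01// mulr_ge0// sumr_ge0.
have h01 i : 0 <= h i <= 1 by rewrite exp01// !mulr_ge0.
have inner i : `|pi i - eta i|
    <= \sum_(u <- r) 2 * (c i u * x i * y u) * trunc_err M (c i u) (x i) (y u).
  rewrite /eta mulr_sumr -prod_expRN.
  apply: (le_trans (dist_prod _ _ _)) => //.
    by move=> u; rewrite exp01// mulr_ge0.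
  apply: ler_sum => u _; rewrite (_ : 1 + p i u * - sg = 1 - sg * p i u); last by ring.
  by apply: dist_edge_expRN => //; rewrite sg0.
have inner2 i : `|eta i - h i| <= x i * `|\sum_(u <- r) c i u * y u - g|.
  apply: (le_trans (dist_expRN _ _)).
  - by rewrite mulr_ge0// sumr_ge0.
  - by rewrite !mulr_ge0.
  have -> : sg * (\sum_(u <- r) c i u * x i * y u) - sg * g * x i
      = sg * (x i * (\sum_(u <- r) c i u * y u - g)).
    have -> : \sum_(u <- r) c i u * x i * y u = x i * \sum_(u <- r) c i u * y u.
      by rewrite mulr_sumr; apply: eq_bigr => u _; ring.
    by ring.
  rewrite normrM (ger0_norm sg0) normrM (ger0_norm (x0 i)).
  by rewrite ler_piMl// mulr_ge0.
have factor i : `|1 + p i t * (pi i - 1)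
      - expR (- (c i t * x i * y t * (1 - h i)))|
    <= c i t * x i * y t * (2 * trunc_err M (c i t) (x i) (y t)
        + \sum_(u <- r) 2 * (c i u * x i * y u) * trunc_err M (c i u) (x i) (y u)
        + x i * `|\sum_(u <- r) c i u * y u - g|).
  have /andP[pi0 pi1] := pi01 i; have /andP[h0 h1] := h01 i.
  (* The outer factor is again of the form [1 - sg * min 1 q], with [1 - pi i] as the new [sg]. *)
  have s1 : 0 <= 1 - pi i <= 1 by apply/andP; split; lra.
  have := dist_edge_expRN (c0 i t) (x0 i) (y0 t) M0 s1.
  set q := c i t * x i * y t => d1.
  have d2 : `|expR (- ((1 - pi i) * q)) - expR (- (q * (1 - h i)))|
      <= q * (`|pi i - eta i| + `|eta i - h i|).
    apply: (le_trans (dist_expRN _ _)).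
    - by rewrite mulr_ge0 ?q0//; lra.
    - by rewrite mulr_ge0 ?q0//; lra.
    have -> : (1 - pi i) * q - q * (1 - h i) = - (q * ((pi i - eta i) + (eta i - h i))).
      by ring.
    by rewrite normrN normrM ger0_norm ?q0// ler_wpM2l ?q0// ler_normD.
  have -> : 1 + p i t * (pi i - 1) - expR (- (q * (1 - h i)))
    = (1 - (1 - pi i) * Num.min 1 q - expR (- ((1 - pi i) * q)))
     + (expR (- ((1 - pi i) * q)) - expR (- (q * (1 - h i)))).
    by rewrite /p -/q; ring.
  rewrite (le_trans (ler_normD _ _))//.
  have d3 := ler_wpM2l (q0 i t) (lerD (inner i) (inner2 i)).
  rewrite -/q in d3; have := lerD d1 (le_trans d2 d3); move=> /le_trans; apply.
  by rewrite le_eqVlt; apply/orP; left; apply/eqP; ring.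
have outer : `|\prod_(i <- s) (1 + p i t * (pi i - 1))
    - \prod_(i <- s) expR (- (c i t * x i * y t * (1 - h i)))|
    <= \sum_(i <- s) c i t * x i * y t * (2 * trunc_err M (c i t) (x i) (y t)
        + \sum_(u <- r) 2 * (c i u * x i * y u) * trunc_err M (c i u) (x i) (y u)
        + x i * `|\sum_(u <- r) c i u * y u - g|).
  apply: (le_trans (dist_prod _ _ _)).
  - move=> i; have /andP[a1 a2] := p01 i t; have /andP[b1 b2] := pi01 i.
    have b3 : 0 <= 1 - pi i by lra.
    have : 0 <= p i t * (1 - pi i) by rewrite mulr_ge0.
    have : p i t * (1 - pi i) <= 1 by rewrite mulr_ile1//; lra.
    by move=> *; apply/andP; split; lra.
  - by move=> i; rewrite exp01// mulr_ge0// subr_ge0; case/andP: (h01 i).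
  - by apply: ler_sum => i _; exact: factor.
have last : `|\prod_(i <- s) expR (- (c i t * x i * y t * (1 - h i)))
     - expR (- (y t * k))|
    <= y t * `|\sum_(i <- s) c i t * (x i * (1 - h i)) - k|.
  rewrite prod_expRN; apply: (le_trans (dist_expRN _ _)).
  - apply: sumr_ge0 => i _; rewrite mulr_ge0// subr_ge0.
    by case/andP: (h01 i).
  - by rewrite mulr_ge0.
  have -> : \sum_(i <- s) c i t * x i * y t * (1 - h i) - y t * k
      = y t * (\sum_(i <- s) c i t * (x i * (1 - h i)) - k).
    by rewrite mulrBr mulr_sumr; congr (_ - _); apply: eq_bigr => i _; ring.
  by rewrite normrM ger0_norm.
set A := \prod_(i <- s) _ in outer *.
set B := \prod_(i <- s) _ in outer last.
have -> : A - expR (- (y t * k)) = (A - B) + (B - expR (- (y t * k))) by ring.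
by rewrite (le_trans (ler_normD _ _))// lerD.
Qed.

End ConditionalGeneratingFunction.

(** * Expectations of functions of X and Y *)

Section SigmaMeasurable.
Context d (T : measurableType d) (R : realType) (P : probability T R).

Definition sigma_measurable d' (T' : measurableType d')
    (F : nat -> {RV P >-> T'}) (f : T -> R) :=
  forall B, measurable B -> sigma_of_family F (f @^-1` B).

(** [g_sigma_algebraType] takes the generated sigma-algebra as the ambient structure, so that the
    closure properties of measurable functions yield events of [sigma_of_family F]. *)
Lemma sigma_measurable_fun d' (T' : measurableType d')
    (F : nat -> {RV P >-> T'}) (f : T -> R) :
  measurable_fun [set: g_sigma_algebraType
    (\bigcup_i preimage_set_system setT (F i) measurable)] f ->
  sigma_measurable F f.
Proof. by move=> mf B mB; have := mf measurableT B mB; rewrite setTI. Qed.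

Lemma measurable_family d' (T' : measurableType d')
    (F : nat -> {RV P >-> T'}) i :
  measurable_fun [set: g_sigma_algebraType
    (\bigcup_i preimage_set_system setT (F i) measurable)] (F i).
Proof.
move=> _ B mB; rewrite setTI; apply: sub_sigma_algebra.
by exists i => //; exists B => //; rewrite setTI.
Qed.

Lemma sigma_measurable_comp d' (T' : measurableType d')
    (F : nat -> {RV P >-> T'}) i (phi : T' -> R) :
  measurable_fun setT phi -> sigma_measurable F (fun w => phi (F i w)).
Proof.
move=> mphi; apply: sigma_measurable_fun.
by apply: (measurableT_comp mphi); exact: measurable_family.
Qed.

Lemma sigma_of_family_measurable d' (T' : measurableType d')
    (F : nat -> {RV P >-> T'}) : sigma_of_family F `<=` measurable.
Proof.
apply: smallest_sub; first exact: sigma_algebra_measurable.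
move=> _ [i _ [B mB <-]]; rewrite setTI.
by rewrite -[X in measurable X]setTI; exact: measurable_funP.
Qed.

Lemma measurable_ltr_nat (M : R) : measurable_fun setT (fun x : R => (M < x)%R%:R : R).
Proof.
rewrite (_ : (fun x : R => (M < x)%R%:R) = \1_(`]M, +oo[%classic)).
  by apply: measurable_indic; exact: measurable_itv.
by apply/funext => x; rewrite indicE mem_setE in_itv/= andbT.
Qed.

(** Dominated convergence with the bound [f]: at each point the level [(n+1)^(1/4)] eventually
    exceeds [g w]. *)
Lemma cvg_Ex_tail (f g : T -> R) : intg P f -> (forall w, 0 <= f w) ->
  measurable_fun setT g ->
  Ex P (fun w => f w * ((root4_harmonic R n)^-1 < g w)%R%:R) @[n --> \oo] --> 0.
Proof.
move=> If f0 mg; rewrite -[X in _ --> X](Ex_cst P).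
apply: (Ex_cvg (g := f)) => //.
- move=> n; apply: measurable_funM; first exact: intg_measurable If.
  by apply: (measurableT_comp (measurable_ltr_nat _)).
- move=> n w; rewrite normrM ger0_norm// ler_piMr//.
  by case: (_ < _); rewrite ?normr1 ?normr0.
- move=> w; apply: cvg_near_cst.
  apply: filterS (near_le_root4_harmonicV (g w)) => n h.
  by apply/eqP; rewrite ltNge h mulr0.
Qed.

End SigmaMeasurable.

Section NonnegativeIid.
Context d (T : measurableType d) (R : realType) (P : probability T R).
Context (Z : nat -> {RV P >-> R}).
Hypotheses (iZ : iid P Z) (Z0 : forall i w, 0 <= Z i w).

(** Composing with the absolute value makes a function that is nonnegative on the half-line
    nonnegative everywhere, as the general lemmas require; on the values of [Z] nothing changes. *)
Let normZ (phi : R -> R) i :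
  (fun w => phi `|Z i w|) = (fun w => phi (Z i w)).
Proof. by apply/funext => w; rewrite ger0_norm. Qed.

Let mnorm (phi : R -> R) : measurable_fun setT phi ->
  measurable_fun setT (fun x : R => phi `|x|).
Proof. by move=> mphi; apply: (measurableT_comp mphi). Qed.

Lemma Ex_iid (phi : R -> R) i : measurable_fun setT phi ->
  (forall x, 0 <= x -> 0 <= phi x) -> intg P (fun w => phi (Z 0%N w)) ->
  intg P (fun w => phi (Z i w)) /\
  Ex P (fun w => phi (Z i w)) = Ex P (fun w => phi (Z 0%N w)).
Proof.
move=> mphi phi0 I0; have := @iid_Ex _ _ _ P _ _ Z (fun x => phi `|x|) iZ.2 (mnorm mphi).
by rewrite normZ => /(_ (fun y => phi0 _ (normr_ge0 y)) I0 i); rewrite normZ.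
Qed.

Lemma Ex_iid_pair (phi psi : R -> R) j k : j != k ->
  measurable_fun setT phi -> (forall x, 0 <= x -> 0 <= phi x) ->
  intg P (fun w => phi (Z 0%N w)) ->
  measurable_fun setT psi -> (forall x, 0 <= x -> 0 <= psi x) ->
  intg P (fun w => psi (Z 0%N w)) ->
  intg P (fun w => phi (Z j w) * psi (Z k w)) /\
  Ex P (fun w => phi (Z j w) * psi (Z k w))
    = Ex P (fun w => phi (Z 0%N w)) * Ex P (fun w => psi (Z 0%N w)).
Proof.
move=> jk mphi phi0 Iphi mpsi psi0 Ipsi.
have := @iid_Ex_pair _ _ _ P _ _ Z (fun x => phi `|x|) (fun x => psi `|x|)
  j k iZ jk (mnorm mphi) (fun y => phi0 _ (normr_ge0 y)).
rewrite !normZ => /(_ Iphi (mnorm mpsi) (fun y => psi0 _ (normr_ge0 y)) Ipsi).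
have -> // : (fun w => phi `|Z j w| * psi `|Z k w|)
   = (fun w => phi (Z j w) * psi (Z k w)).
by apply/funext => w; rewrite !ger0_norm.
Qed.

Lemma weighted_L1_lln (phi : R -> R) (c : nat -> nat -> R)
    (N : nat -> nat) (gamma A : R) :
  measurable_fun setT phi -> (forall x, 0 <= x -> 0 <= phi x) ->
  intg P (fun w => phi (Z 0%N w)) ->
  (forall n k, 0 <= c n k <= A * n.+1%:R^-1) ->
  \sum_(k < N n) c n k @[n --> \oo] --> gamma ->
  Ex P (fun w => `|\sum_(k < N n) c n k * phi (Z k w)
    - gamma * Ex P (fun w => phi (Z 0%N w))|) @[n --> \oo] --> 0.
Proof.
move=> mphi phi0 Iphi cA cg.
have := @weighted_L1_law_of_large_numbers _ _ _ P _ _ Z (fun x => phi `|x|)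
  c N gamma A iZ (mnorm mphi) (fun y => phi0 _ (normr_ge0 y)).
rewrite normZ => /(_ Iphi cA cg).
set f := (F in F @ _ --> _); set g := (F in _ -> F @ _ --> _).
suff -> : f = g by [].
apply/funext => n; apply: Ex_ext => w; congr (`|_ - _|).
by apply: eq_bigr => k _; rewrite ger0_norm.
Qed.

End NonnegativeIid.

Section ModelExpectations.
Context d (Omega : measurableType d) (R : realType) (P : probability Omega R).
Context (X Y : nat -> {RV P >-> R}).
Hypotheses (iX : iid P X) (iY : iid P Y)
  (X0 : forall i w, 0 <= X i w) (Y0 : forall i w, 0 <= Y i w)
  (XY : independent_systems P (sigma_of_family X) (sigma_of_family Y)).

Lemma Ex_XY_mul (U V : Omega -> R) :
  sigma_measurable X U -> (forall w, 0 <= U w) -> intg P U ->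
  sigma_measurable Y V -> (forall w, 0 <= V w) -> intg P V ->
  intg P (fun w => U w * V w) /\ Ex P (fun w => U w * V w) = Ex P U * Ex P V.
Proof.
move=> sU U0 IU sV V0 IV; apply: Ex_mul_indep => // A B mA mB.
by apply: XY; [exact: sU|exact: sV].
Qed.

Lemma Ex_XY (phi psi : R -> R) i u :
  measurable_fun setT phi -> (forall x, 0 <= x -> 0 <= phi x) ->
  intg P (fun w => phi (X 0%N w)) ->
  measurable_fun setT psi -> (forall x, 0 <= x -> 0 <= psi x) ->
  intg P (fun w => psi (Y 0%N w)) ->
  intg P (fun w => phi (X i w) * psi (Y u w)) /\
  Ex P (fun w => phi (X i w) * psi (Y u w))
    = Ex P (fun w => phi (X 0%N w)) * Ex P (fun w => psi (Y 0%N w)).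
Proof.
move=> mphi phi0 Iphi mpsi psi0 Ipsi.
have [IX EX] := Ex_iid iX X0 i mphi phi0 Iphi.
have [IY EY] := Ex_iid iY Y0 u mpsi psi0 Ipsi.
rewrite -EX -EY; apply: Ex_XY_mul => //.
- exact: sigma_measurable_comp.
- by move=> w; exact: phi0.
- exact: sigma_measurable_comp.
- by move=> w; exact: psi0.
Qed.

Lemma Ex_XXY (phi phi' psi : R -> R) i j u : i != j ->
  measurable_fun setT phi -> (forall x, 0 <= x -> 0 <= phi x) ->
  intg P (fun w => phi (X 0%N w)) ->
  measurable_fun setT phi' -> (forall x, 0 <= x -> 0 <= phi' x) ->
  intg P (fun w => phi' (X 0%N w)) ->
  measurable_fun setT psi -> (forall x, 0 <= x -> 0 <= psi x) ->
  intg P (fun w => psi (Y 0%N w)) ->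
  intg P (fun w => phi (X i w) * phi' (X j w) * psi (Y u w)) /\
  Ex P (fun w => phi (X i w) * phi' (X j w) * psi (Y u w))
    = Ex P (fun w => phi (X 0%N w)) * Ex P (fun w => phi' (X 0%N w))
      * Ex P (fun w => psi (Y 0%N w)).
Proof.
move=> ij mphi phi0 Iphi mphi' phi0' Iphi' mpsi psi0 Ipsi.
have [IX EX] := Ex_iid_pair iX X0 ij mphi phi0 Iphi mphi' phi0' Iphi'.
have [IY EY] := Ex_iid iY Y0 u mpsi psi0 Ipsi.
rewrite -EX -EY; apply: Ex_XY_mul => //.
- apply: sigma_measurable_fun; apply: measurable_funM.
    by apply: (measurableT_comp mphi); exact: measurable_family.
  by apply: (measurableT_comp mphi'); exact: measurable_family.
- by move=> w; rewrite mulr_ge0 ?phi0 ?phi0'.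
- exact: sigma_measurable_comp.
- by move=> w; exact: psi0.
Qed.

Lemma Ex_X_abs_sum_Y (phi : R -> R) i (s : seq nat) (c : nat -> R) g :
  measurable_fun setT phi -> (forall x, 0 <= x -> 0 <= phi x) ->
  intg P (fun w => phi (X 0%N w)) -> intg P (Y 0%N) ->
  intg P (fun w => phi (X i w) * `|\sum_(u <- s) c u * Y u w - g|) /\
  Ex P (fun w => phi (X i w) * `|\sum_(u <- s) c u * Y u w - g|)
    = Ex P (fun w => phi (X 0%N w))
      * Ex P (fun w => `|\sum_(u <- s) c u * Y u w - g|).
Proof.
move=> mphi phi0 Iphi IY0.
have [IX EX] := Ex_iid iX X0 i mphi phi0 Iphi.
have IY u : intg P (Y u).
  exact: (Ex_iid iY Y0 u (@measurable_id _ _ setT) (fun x h => h) IY0).1.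
rewrite -EX; apply: Ex_XY_mul => //.
- exact: sigma_measurable_comp.
- by move=> w; exact: phi0.
- apply: sigma_measurable_fun; apply: measurableT_comp => //.
  apply: measurable_funB => //; apply: measurable_sum => u.
  by apply: measurable_funM => //; exact: measurable_family.
- apply: intg_norm; apply: intgB; last exact: intg_cst.
  by apply: intg_sum => u _; exact: intgZ.
Qed.

End ModelExpectations.

(** * Edge weights *)

Section HasExpectation.
Context d (T : measurableType d) (R : realType) (P : probability T R).
Implicit Types f g : T -> R.

(** Integrability and value travel together, because linearity of [Ex] asks for the integrability of
    each summand; expectations of nested sums are then computed along the expression. *)
Definition has_Ex f v := intg P f /\ Ex P f = v.

Lemma has_ExD f g u v : has_Ex f u -> has_Ex g v ->
  has_Ex (fun w => f w + g w) (u + v).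
Proof. by move=> [If <-] [Ig <-]; split; [exact: intgD|exact: ExD]. Qed.

Lemma has_ExZ k f v : has_Ex f v -> has_Ex (fun w => k * f w) (k * v).
Proof. by move=> [If <-]; split; [exact: intgZ|exact: ExZ]. Qed.

Lemma has_Ex_sum I (s : seq I) (F : I -> T -> R) v :
  (forall i, has_Ex (F i) (v i)) ->
  has_Ex (fun w => \sum_(i <- s) F i w) (\sum_(i <- s) v i).
Proof.
move=> FE; split; first by apply: intg_sum => i _; exact: (FE i).1.
rewrite Ex_sum => [|i _]; last exact: (FE i).1.
by apply: eq_bigr => i _; exact: (FE i).2.
Qed.

End HasExpectation.

Section EdgeWeights.
Context (R : realType) (a b : R).
Hypotheses (a0 : 0 < a) (ab : a < b).

Let b0 : 0 < b. Proof. exact: lt_trans a0 ab. Qed.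

Definition edge_weight (i u : nat) : R := riemann_weight a b u i.

(* Exceeds the index of every [w_i] that can be adjacent to [v_t] and of every
   [v_u] that can share such a neighbour, whence the two summands. *)
Definition edge_range (t : nat) : nat := (Num.truncn ((b + b / a) * t.+1%:R)).+1.

Lemma edge_weight_ge0 i u : 0 <= edge_weight i u.
Proof. exact: riemann_weight_ge0. Qed.

Lemma edge_weight_neq0 i u : edge_weight i u != 0 ->
  a * u.+1%:R <= i.+1%:R <= b * u.+1%:R.
Proof. by rewrite /edge_weight /riemann_weight; case: ifP => //; rewrite eqxx. Qed.

(** Turns the sums over the vertices at a fixed attribute into the Riemann sums already treated,
    with the attribute as normalizing index. *)
Lemma edge_weight_sym i u : edge_weight i u = riemann_weight b^-1 a^-1 i u.
Proof.
rewrite /edge_weight /riemann_weight [u.+1%:R * i.+1%:R]mulrC.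
congr (if _ then _ else _); rewrite andbC; congr (_ && _).
  by rewrite ler_pdivrMl.
by rewrite ler_pdivlMl.
Qed.

Lemma edge_weight_le i u : edge_weight i u <= (Num.sqrt a)^-1 * u.+1%:R^-1.
Proof. exact: (riemann_weight_le _ _ _ a0). Qed.

Lemma edge_weight_le' i u : edge_weight i u <= Num.sqrt b * i.+1%:R^-1.
Proof.
have b'0 : 0 < b^-1 by rewrite invr_gt0.
rewrite edge_weight_sym (le_trans (riemann_weight_le _ _ _ b'0))//.
by rewrite sqrtrV ?(ltW b0)// invrK.
Qed.

(** A positive weight to [v_t] forces [i + 1 >= a (t + 1)]; hence every weight at [w_i], whatever
    [u], is of order [1 / (t+1)]. *)
Lemma edge_weight_le2 i u t : edge_weight i t != 0 ->
  edge_weight i u <= (Num.sqrt b / a) * t.+1%:R^-1.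
Proof.
move=> /edge_weight_neq0/andP[h _]; rewrite (le_trans (edge_weight_le' _ _))//.
rewrite -mulrA ler_wpM2l ?sqrtr_ge0// -invfM lef_pV2 ?posrE//.
by rewrite mulr_gt0.
Qed.

Lemma edge_range_ge t : b * t.+1%:R <= (edge_range t)%:R.
Proof.
apply: (@le_trans _ _ ((b + b / a) * t.+1%:R)).
  by rewrite ler_wpM2r// lerDl divr_ge0 ?ltW.
by rewrite ltW// truncnS_gt.
Qed.

Lemma edge_range_ge' t : b / a * t.+1%:R <= (edge_range t)%:R.
Proof.
apply: (@le_trans _ _ ((b + b / a) * t.+1%:R)).
  by rewrite ler_wpM2r// lerDr ltW.
by rewrite ltW// truncnS_gt.
Qed.

Lemma edge_weight_row i t : edge_weight i t != 0 -> (i < edge_range t)%N.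
Proof.
move=> /edge_weight_neq0/andP[_ h]; rewrite -(ler_nat R).
exact: le_trans h (edge_range_ge t).
Qed.

Lemma edge_weight_col i u t : edge_weight i t != 0 -> edge_weight i u != 0 ->
  (u < edge_range t)%N.
Proof.
move=> /edge_weight_neq0/andP[_ h1] /edge_weight_neq0/andP[h2 _].
rewrite -(ler_nat R); apply: le_trans (edge_range_ge' t).
by rewrite -mulrAC ler_pdivlMr// mulrC (le_trans h2).
Qed.

Lemma sum_edge_weight_row N t :
  \sum_(i <- index_iota 0 N) edge_weight i t <= 2 * Num.sqrt b.
Proof.
rewrite big_mkord (le_trans (sum_riemann_weight_le _ _ (ltW ab)))//.
by rewrite ler_pM2l// gerBl sqrtr_ge0.
Qed.

Lemma sum_edge_weight_col N i :
  \sum_(u <- index_iota 0 N) edge_weight i u <= 2 * (Num.sqrt a)^-1.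
Proof.
under eq_bigr do rewrite edge_weight_sym.
have ba : b^-1 <= a^-1 by rewrite lef_pV2 ?posrE// ltW.
rewrite big_mkord (le_trans (sum_riemann_weight_le _ _ ba))//.
by rewrite -sqrtrV ?(ltW a0)// ler_pM2l// gerBl sqrtr_ge0.
Qed.

Lemma cvg_sum_edge_weight_row :
  \sum_(i < edge_range t) edge_weight i t @[t --> \oo]
    --> 2 * (Num.sqrt b - Num.sqrt a).
Proof. by apply: cvg_sum_riemann_weight => // t; exact: edge_range_ge. Qed.

Lemma cvg_sum_edge_weight_col (N : nat -> nat) :
  (forall i, a^-1 * i.+1%:R <= (N i)%:R) ->
  \sum_(u < N i) edge_weight i u @[i --> \oo]
    --> 2 * ((Num.sqrt a)^-1 - (Num.sqrt b)^-1).
Proof.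
move=> Na; rewrite -!sqrtrV ?ltW//.
have -> : (fun i => \sum_(u < N i) edge_weight i u)
    = (fun i => \sum_(u < N i) riemann_weight b^-1 a^-1 i u).
  by apply/funext => i; apply: eq_bigr => u _; exact: edge_weight_sym.
apply: cvg_sum_riemann_weight => //; first by rewrite invr_gt0.
by rewrite ltf_pV2 ?posrE.
Qed.

Lemma edge_weight_far i u (N : nat) : a^-1 * i.+1%:R <= N%:R -> (N <= u)%N ->
  edge_weight i u = 0.
Proof.
move=> aN Nu; apply/eqP; apply: contraT => /edge_weight_neq0/andP[h _].
move: Nu; rewrite leqNgt -(ler_nat R) => /negP; case.
by apply: le_trans aN; rewrite mulrC ler_pdivlMr// mulrC.
Qed.

End EdgeWeights.

(** * Convergence of the conditional generating function *)

Section ModelBounds.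
Context d (Omega : measurableType d) (R : realType) (P : probability Omega R).
Context (a b : R) (X Y : nat -> {RV P >-> R}).
Hypotheses (a0 : 0 < a) (ab : a < b).
Hypotheses (iX : iid P X) (iY : iid P Y)
  (X0 : forall i w, 0 <= X i w) (Y0 : forall i w, 0 <= Y i w)
  (XY : independent_systems P (sigma_of_family X) (sigma_of_family Y)).
Hypotheses (IX2 : intg P (fun w => X 0%N w ^+ 2)) (IY : intg P (Y 0%N)).

Let c : nat -> nat -> R := edge_weight a b.
Let c0 i u : 0 <= c i u. Proof. exact: edge_weight_ge0. Qed.

Let m1 : R := Ex P (X 0%N).
Let m2 : R := Ex P (fun w => X 0%N w ^+ 2).
Let b1 : R := Ex P (Y 0%N).

Let X_tail1 M : R := Ex P (fun w => X 0%N w * (M < X 0%N w)%R%:R).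
Let X_tail2 M : R := Ex P (fun w => X 0%N w ^+ 2 * (M < X 0%N w)%R%:R).
Let Y_tail M : R := Ex P (fun w => Y 0%N w * (M < Y 0%N w)%R%:R).

Let msqr : measurable_fun setT (fun x : R => x ^+ 2).
Proof. exact: measurable_funX. Qed.

Let mtail1 M : measurable_fun setT (fun x : R => x * (M < x)%R%:R).
Proof. by apply: measurable_funM => //; exact: measurable_ltr_nat. Qed.

Let mtail2 M : measurable_fun setT (fun x : R => x ^+ 2 * (M < x)%R%:R).
Proof. by apply: measurable_funM => //; exact: measurable_ltr_nat. Qed.

Let IX : intg P (X 0%N).
Proof.
apply: (intg_le _ _ (intgD (intg_cst P 1) IX2)) => //.
by move=> w; rewrite ger0_norm//; have := sqr_ge0 (X 0%N w - 1); have := sqr_ge0 (X 0%N w); rewrite !expr2; lra.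
Qed.

Let intg_tail (f g : Omega -> R) M : intg P f -> measurable_fun setT g ->
  intg P (fun w => f w * (M < g w)%R%:R).
Proof.
move=> If mg; apply: (intg_ext (f := fun w => (M < g w)%R%:R * f w)).
  by move=> w; rewrite mulrC.
apply: (@intgM_bounded _ _ _ _ _ _ 1) => //.
  by apply: (measurableT_comp (measurable_ltr_nat M)).
by move=> w; case: (_ < _); rewrite ?normr1 ?normr0.
Qed.

Let nat0 (p : bool) : 0 <= p%:R :> R. Proof. by case: p. Qed.

Let has_X i : has_Ex P (X i) m1.
Proof. exact: (Ex_iid iX X0 i (@measurable_id _ _ setT) (fun x h => h) IX). Qed.

Let has_Y i : has_Ex P (Y i) b1.
Proof. exact: (Ex_iid iY Y0 i (@measurable_id _ _ setT) (fun x h => h) IY). Qed.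

Let has_Xtail i M : has_Ex P (fun w => X i w * (M < X i w)%R%:R) (X_tail1 M).
Proof.
have := @Ex_iid _ _ _ P X iX X0 (fun x => x * (M < x)%R%:R) i (mtail1 M).
by apply; [move=> x x0; rewrite mulr_ge0|exact: intg_tail].
Qed.

Let has_X2Y i u : has_Ex P (fun w => X i w ^+ 2 * Y u w) (m2 * b1).
Proof.
have := @Ex_XY _ _ _ P X Y iX iY X0 Y0 XY (fun x => x ^+ 2) idfun i u msqr.
apply; [|exact: IX2|exact: measurable_id|by []|exact: IY].
by move=> x _; exact: sqr_ge0.
Qed.

Let has_X2tailY i u M :
  has_Ex P (fun w => X i w ^+ 2 * (M < X i w)%R%:R * Y u w) (X_tail2 M * b1).
Proof.
have := @Ex_XY _ _ _ P X Y iX iY X0 Y0 XY (fun x => x ^+ 2 * (M < x)%R%:R) idfun i u (mtail2 M).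
apply; [|exact: intg_tail|exact: measurable_id|by []|exact: IY].
by move=> x x0; rewrite mulr_ge0// sqr_ge0.
Qed.

Let has_X2Ytail i u M :
  has_Ex P (fun w => X i w ^+ 2 * (Y u w * (M < Y u w)%R%:R)) (m2 * Y_tail M).
Proof.
have := @Ex_XY _ _ _ P X Y iX iY X0 Y0 XY (fun x => x ^+ 2) (fun x => x * (M < x)%R%:R) i u msqr.
move=> h; apply: h; [|exact: IX2|exact: mtail1| |exact: intg_tail].
- by move=> x x0; exact: sqr_ge0.
- by move=> x x0; rewrite mulr_ge0.
Qed.

Let has_X2abs i s (k : nat -> R) g :
  has_Ex P (fun w => X i w ^+ 2 * `|\sum_(u <- s) k u * Y u w - g|)
    (m2 * Ex P (fun w => `|\sum_(u <- s) k u * Y u w - g|)).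
Proof.
apply: (@Ex_X_abs_sum_Y _ _ _ P X Y iX iY X0 Y0 XY (fun x => x ^+ 2)) => //.
by move=> x _; exact: sqr_ge0.
Qed.

Let has_X2XY i j u : i != j ->
  has_Ex P (fun w => X i w ^+ 2 * X j w * Y u w) (m2 * m1 * b1).
Proof.
move=> ij; apply: (@Ex_XXY _ _ _ P X Y iX iY X0 Y0 XY (fun x => x ^+ 2) idfun idfun) => //; try exact: measurable_id.
by move=> x _; exact: sqr_ge0.
Qed.

Let has_X2XtailY i j u M : i != j ->
  has_Ex P (fun w => X i w ^+ 2 * (X j w * (M < X j w)%R%:R) * Y u w)
    (m2 * X_tail1 M * b1).
Proof.
move=> ij; apply: (@Ex_XXY _ _ _ P X Y iX iY X0 Y0 XY (fun x => x ^+ 2)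
  (fun x => x * (M < x)%R%:R) idfun) => //; try exact: measurable_id.
- by move=> x _; exact: sqr_ge0.
- by move=> x x0; rewrite mulr_ge0.
- exact: intg_tail.
Qed.

Let has_X2XYtail i j u M : i != j ->
  has_Ex P (fun w => X i w ^+ 2 * X j w * (Y u w * (M < Y u w)%R%:R))
    (m2 * m1 * Y_tail M).
Proof.
move=> ij; apply: (@Ex_XXY _ _ _ P X Y iX iY X0 Y0 XY (fun x => x ^+ 2)
  idfun (fun x => x * (M < x)%R%:R)) => //; try exact: measurable_id.
- by move=> x _; exact: sqr_ge0.
- by move=> x x0; rewrite mulr_ge0.
- exact: intg_tail.
Qed.

Let m10 : 0 <= m1. Proof. exact: Ex_ge0. Qed.
Let m20 : 0 <= m2. Proof. by apply: Ex_ge0 => w; exact: sqr_ge0. Qed.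
Let b10 : 0 <= b1. Proof. exact: Ex_ge0. Qed.
Let X_tail1_ge0 M : 0 <= X_tail1 M.
Proof. by apply: Ex_ge0 => w; rewrite mulr_ge0. Qed.
Let X_tail2_ge0 M : 0 <= X_tail2 M.
Proof. by apply: Ex_ge0 => w; rewrite mulr_ge0// sqr_ge0. Qed.
Let Y_tail_ge0 M : 0 <= Y_tail M.
Proof. by apply: Ex_ge0 => w; rewrite mulr_ge0. Qed.

Let rt (t : nat) : R := root4_harmonic R t.
Let rt0 t : 0 < rt t. Proof. exact: root4_harmonic_gt0. Qed.

Let A1 : R := (Num.sqrt a)^-1.
Let A3 : R := Num.sqrt b / a.
Let C1 : R := 2 * Num.sqrt b.
Let C2 : R := 2 * (Num.sqrt a)^-1.
Let A10 : 0 <= A1. Proof. by rewrite invr_ge0 sqrtr_ge0. Qed.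
Let A30 : 0 <= A3. Proof. by rewrite divr_ge0 ?sqrtr_ge0// ltW. Qed.
Let C20 : 0 <= C2. Proof. by rewrite mulr_ge0 ?invr_ge0 ?sqrtr_ge0. Qed.

Let rtV2 t : t.+1%:R^-1 * (rt t)^-1 ^+ 2 = rt t ^+ 2.
Proof.
rewrite -root4_harmonic_exp4 -/(rt t) exprVn -{1}(addn2 2) exprD -mulrA divff ?mulr1//.
by rewrite expf_neq0// gt_eqF.
Qed.

Let row_M2 i t : c i t * (rt t)^-1 ^+ 2 <= A1 * rt t ^+ 2.
Proof.
rewrite -rtV2 [leRHS]mulrA ler_wpM2r ?sqr_ge0//.
exact: (edge_weight_le b a0).
Qed.

Let col_M2 i u t : c i t != 0 -> c i u * (rt t)^-1 ^+ 2 <= A3 * rt t ^+ 2.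
Proof.
move=> cit; rewrite -rtV2 [leRHS]mulrA ler_wpM2r ?sqr_ge0//.
exact: (edge_weight_le2 a0 ab u cit).
Qed.

(** The bound of [dist_pgf_expRN] on the event [Y t w <= K], with [Y t] replaced by [K] and
    [trunc_err] expanded. In each term a function of [X i], at most quadratic, multiplies a function
    of [Y], at most linear, so the expectation factors within the available moments. *)
Let majorant (s r : seq nat) t (K M g k : R) (phi : R -> R) (w : Omega) : R :=
  K * (\sum_(i <- s) c i t * (2 * (c i t * M ^+ 2) * X i w
     + 2 * (X i w * (M < X i w)%R%:R)
     + 2 * (M < K)%R%:R * X i w
     + \sum_(u <- r) 2 * c i u * (c i u * M ^+ 2 * (X i w ^+ 2 * Y u w)
          + X i w ^+ 2 * (M < X i w)%R%:R * Y u w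
          + X i w ^+ 2 * (Y u w * (M < Y u w)%R%:R))
     + X i w ^+ 2 * `|\sum_(u <- r) c i u * Y u w - g|))
  + K * `|\sum_(i <- s) c i t * phi (X i w) - k|.

Let has_majorant (s r : seq nat) t (K M g k : R) (phi : R -> R) :
  measurable_fun setT phi -> (forall x, 0 <= x -> 0 <= phi x) ->
  intg P (fun w => phi (X 0%N w)) ->
  has_Ex P (majorant s r t K M g k phi)
    (K * (\sum_(i <- s) c i t * (2 * (c i t * M ^+ 2) * m1
     + 2 * X_tail1 M + 2 * (M < K)%R%:R * m1
     + \sum_(u <- r) 2 * c i u * (c i u * M ^+ 2 * (m2 * b1)
          + X_tail2 M * b1 + m2 * Y_tail M)
     + m2 * Ex P (fun w => `|\sum_(u <- r) c i u * Y u w - g|)))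
    + K * Ex P (fun w => `|\sum_(i <- s) c i t * phi (X i w) - k|)).
Proof.
move=> mphi phi0 Iphi; apply: has_ExD; last first.
  apply: has_ExZ; split => //; apply: intg_norm; apply: intgB; last exact: intg_cst.
  by apply: intg_sum => i _; apply: intgZ; exact: (Ex_iid iX X0 i mphi phi0 Iphi).1.
apply/has_ExZ/has_Ex_sum => i; apply/has_ExZ/has_ExD; last exact: has_X2abs.
apply: has_ExD; last first.
  apply: has_Ex_sum => u; apply/has_ExZ/has_ExD; last exact: has_X2Ytail.
  by apply: has_ExD; [exact/has_ExZ/has_X2Y|exact: has_X2tailY].
apply: has_ExD; last exact/has_ExZ/has_X.
by apply: has_ExD; [exact/has_ExZ/has_X|exact/has_ExZ/has_Xtail].
Qed.

Let sum_seq_le (s : seq nat) t : (exists N, s = index_iota 0 N) ->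
  \sum_(i <- s) c i t <= C1.
Proof. by move=> [N ->]; exact: sum_edge_weight_row. Qed.

Let sum_col_le (r : seq nat) i N (p : pred nat) :
  r = [seq u <- index_iota 0 N | p u] -> \sum_(u <- r) c i u <= C2.
Proof.
move=> ->; rewrite big_filter.
apply: le_trans (sum_edge_weight_col a0 ab N i).
rewrite big_mkcond/=; apply: ler_sum => u _; case: ifP => // _; exact: c0.
Qed.

(** Row sums of the weights are at most [C1] and column sums at most [C2], so the double sum costs a
    constant factor and only small quantities remain. *)
Let Ex_majorant_le t N N' (p : pred nat) (K g k e : R) (phi : R -> R) :
  let s := index_iota 0 N in let r := [seq u <- index_iota 0 N' | p u] in
  let M := (rt t)^-1 in
  0 <= K -> 0 <= e ->
  measurable_fun setT phi -> (forall x, 0 <= x -> 0 <= phi x) ->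
  intg P (fun w => phi (X 0%N w)) ->
  (forall i, c i t != 0 -> Ex P (fun w => `|\sum_(u <- r) c i u * Y u w - g|) <= e) ->
  Ex P (majorant s r t K M g k phi) <=
   K * (C1 * (2 * (A1 * rt t ^+ 2) * m1 + 2 * X_tail1 M + 2 * (M < K)%R%:R * m1
     + 2 * C2 * (A3 * rt t ^+ 2 * (m2 * b1) + X_tail2 M * b1 + m2 * Y_tail M)
     + m2 * e))
    + K * Ex P (fun w => `|\sum_(i <- s) c i t * phi (X i w) - k|).
Proof.
move=> s r M K0 e0 mphi phi0 Iphi he.
rewrite (has_majorant s r t K M g k mphi phi0 Iphi).2 lerD2r ler_wpM2l//.
set B := (X in _ <= C1 * X).
have B0 : 0 <= B.
  rewrite /B; repeat first [by [] | exact: sqr_ge0 | apply: addr_ge0 | apply: mulr_ge0].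
apply: (@le_trans _ _ (\sum_(i <- s) c i t * B)); last first.
  by rewrite -mulr_suml ler_wpM2r//; apply: sum_seq_le; exists N.
(* Both [col_M2] and the bound by [e] are available only for the attributes with positive weight to
   [v_t]; the others contribute 0. *)
apply: ler_sum => i _; have [->|cit] := eqVneq (c i t) 0; first by rewrite !mul0r.
rewrite ler_wpM2l// /B lerD ?(ler_wpM2l _ (he i cit))// lerD// ?lerD//.
  by rewrite ler_wpM2r// ler_wpM2l//; exact: row_M2.
pose D := A3 * rt t ^+ 2 * (m2 * b1) + X_tail2 M * b1 + m2 * Y_tail M.
have D0 : 0 <= D.
  rewrite /D; repeat first [by [] | exact: sqr_ge0 | apply: addr_ge0 | apply: mulr_ge0].
apply: (@le_trans _ _ (\sum_(u <- r) 2 * c i u * D)); last first.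
  rewrite -mulr_suml ler_wpM2r// -mulr_sumr ler_wpM2l//.
  exact: (sum_col_le i (erefl r)).
apply: ler_sum => u _; rewrite ler_wpM2l ?mulr_ge0// /D !lerD2r ler_wpM2r ?mulr_ge0//.
exact: col_M2.
Qed.

Definition edge_pr (i u : nat) (w : Omega) : R :=
  Num.min 1 (edge_weight a b i u * X i w * Y u w).

Let p01 i u w : 0 <= edge_pr i u w <= 1.
Proof. by rewrite /edge_pr le_min ge_min lexx ler01 !mulr_ge0. Qed.

Let mp i u : measurable_fun setT (edge_pr i u).
Proof.
apply: measurable_minr; first exact: measurable_cst.
by apply: measurable_funM => //; apply: measurable_funM.
Qed.

Definition others (t : nat) : seq nat :=
  [seq u <- index_iota 0 (edge_range a b t) | u != t].

(** The conditional generating function at [s = 1 - sg], in a form visibly affine in each edge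
    probability, so that edges can be exchanged for probabilities. *)
Definition edge_pgf (sg : R) (t : nat) (w : Omega) : R :=
  \prod_(i <- index_iota 0 (edge_range a b t))
    (1 + edge_pr i t w * (\prod_(u <- others t) (1 + edge_pr i u w * - sg) - 1)).

Lemma edge_pgf01 sg t w : 0 <= sg <= 1 -> 0 <= edge_pgf sg t w <= 1.
Proof.
move=> /andP[sg0 sg1].
have f01 i u : 0 <= 1 + edge_pr i u w * - sg <= 1.
  have /andP[a1 a2] := p01 i u w; have h1 : 0 <= edge_pr i u w * sg by rewrite mulr_ge0.
  by have h2 : edge_pr i u w * sg <= 1 by [rewrite mulr_ile1]; apply/andP; split; lra.
have g01 i : 0 <= 1 + edge_pr i t w * (\prod_(u <- others t) (1 + edge_pr i u w * - sg) - 1) <= 1.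
  set q := \prod_(u <- _) _.
  have q0 : 0 <= q by apply: prodr_ge0 => u _; case/andP: (f01 i u).
  have q1 : q <= 1 by apply: prodr_ile1 => u _.
  have /andP[a1 a2] := p01 i t w; have b3 : 0 <= 1 - q by lra.
  have h1 : 0 <= edge_pr i t w * (1 - q) by rewrite mulr_ge0.
  have h2 : edge_pr i t w * (1 - q) <= 1 by rewrite mulr_ile1//; lra.
  by apply/andP; split; lra.
rewrite /edge_pgf; apply/andP; split; last by apply: prodr_ile1 => i _.
by apply: prodr_ge0 => i _; case/andP: (g01 i).
Qed.

Let sum_support (f : nat -> R) N N' : (forall u, f u != 0 -> (u < N)%N) ->
  (forall u, f u != 0 -> (u < N')%N) ->
  \sum_(u <- index_iota 0 N) f u = \sum_(u <- index_iota 0 N') f u.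
Proof.
wlog NN : N N' / (N <= N')%N => [hw h h'|h h'].
  by have [/hw->//|/ltnW/hw h2] := leqP N N'; rewrite h2.
rewrite [RHS](@big_cat_nat _ _ _ N)//= [X in _ = _ + X]big1_seq ?addr0// => u /andP[_].
rewrite mem_index_iota => /andP[Nu _]; apply/eqP; apply: contraTT Nu => /h.
by rewrite -ltnNge.
Qed.

(** Bounds the indices of vertices, not of attributes: positive weight at [w_i] forces
    [u + 1 <= (i + 1) / a]. *)
Let degree_range (i : nat) : nat := (Num.truncn (a^-1 * i.+1%:R)).+1.

Let gamma2 : R := 2 * ((Num.sqrt a)^-1 - (Num.sqrt b)^-1).
Let gamma1 : R := 2 * (Num.sqrt b - Num.sqrt a).

(** For a fixed attribute [w_i] this is a law of large numbers as [i] grows; it is uniform over the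
    [i] with positive weight to [v_t] because they satisfy [i + 1 >= a (t + 1)]. Leaving out [u = t]
    costs at most [A1 * b1 / (t+1)]. *)
Let near_col_mean (e : R) : 0 < e ->
  \forall t \near \oo, forall i, c i t != 0 ->
    Ex P (fun w => `|\sum_(u <- others t) c i u * Y u w - gamma2 * b1|) <= e.
Proof.
move=> e0.
have drE i : a^-1 * i.+1%:R <= (degree_range i)%:R by rewrite ltW// truncnS_gt.
pose full i := Ex P (fun w => `|\sum_(u < degree_range i) c i u * Y u w - gamma2 * b1|).
have cfull : full i @[i --> \oo] --> 0.
  apply: (@weighted_L1_lln _ _ _ P Y iY Y0 idfun c degree_range gamma2 (Num.sqrt b)) => //.
    exact: measurable_id.
    by move=> i u; rewrite c0 (edge_weight_le' a0 ab).
  exact: cvg_sum_edge_weight_col.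
have e2 : 0 < e / 2 by rewrite divr_gt0.
have /cvgrPdist_le/(_ _ e2)[i0 _ hi0] := cfull.
have ct : A1 * b1 * t.+1%:R^-1 @[t --> \oo] --> 0.
  by rewrite -[X in _ --> X](mulr0 (A1 * b1)); apply: cvgMl_tmp; exact: cvg_harmonic.
have /cvgrPdist_le/(_ _ e2) ht := ct.
near=> t => i cit.
have i0i : (i0 <= i)%N.
  rewrite -ltnS -(ltr_nat R).
  have /andP[h _] := edge_weight_neq0 cit; apply: lt_le_trans h.
  rewrite mulrC -ltr_pdivrMr//.
  near: t; exists (Num.truncn (i0%:R / a)).+1 => // t /= h.
  by rewrite (lt_le_trans (truncnS_gt _))// ler_nat (leq_trans h).
have IYs s' (k : nat -> R) : intg P (fun w => \sum_(u <- s') k u * Y u w).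
  by apply: intg_sum => u _; apply: intgZ; exact: (has_Y u).1.
(* Both ranges contain every vertex of positive weight at [w_i], so the sums over them agree, and
   the term [u = t] is split off. *)
have sE w : \sum_(u <- others t) c i u * Y u w
    = \sum_(u < degree_range i) c i u * Y u w - c i t * Y t w.
  rewrite -(big_mkord xpredT (fun u => c i u * Y u w)).
  rewrite (sum_support (N' := edge_range a b t)); last 2 first.
  - move=> u; apply: contraNT; rewrite -leqNgt => h.
    by rewrite /c (edge_weight_far b a0 (drE i) h) mul0r.
  - move=> u h; apply: (edge_weight_col a0 ab cit).
    by apply: contra_neq h => h; rewrite /c h mul0r.
  rewrite [in RHS](bigD1_seq t)/=; last 2 first.
  - by rewrite mem_index_iota/= (edge_weight_col a0 ab cit).
  - exact: (iota_uniq 0 (edge_range a b t)).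
  by rewrite /others big_filter addrC addrK.
apply: (@le_trans _ _ (full i + A1 * b1 * t.+1%:R^-1)).
  have -> : A1 * b1 * t.+1%:R^-1 = A1 * t.+1%:R^-1 * Ex P (Y t) by rewrite (has_Y t).2; ring.
  rewrite -ExZ; last exact: (has_Y t).1.
  rewrite -ExD; last 2 first.
  - apply: intg_norm; apply: intgB; last exact: intg_cst.
    by apply: intg_sum => u _; apply: intgZ; exact: (has_Y u).1.
  - by apply: intgZ; exact: (has_Y t).1.
  apply: le_Ex.
  - by apply: intg_norm; apply: intgB; [exact: IYs|exact: intg_cst].
  - apply: intgD; last by apply: intgZ; exact: (has_Y t).1.
    apply: intg_norm; apply: intgB; last exact: intg_cst.
    by apply: intg_sum => u _; apply: intgZ; exact: (has_Y u).1.
  move=> w; rewrite sE addrAC (le_trans (ler_normB _ _))// lerD2l ger0_norm ?mulr_ge0//.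
  by rewrite ler_wpM2r// (edge_weight_le b a0).
have h1 : full i <= e / 2.
  by have := hi0 i i0i; rewrite sub0r normrN ger0_norm// Ex_ge0.
have h2 : A1 * b1 * t.+1%:R^-1 <= e / 2.
  have : `|0 - A1 * b1 * t.+1%:R^-1| <= e / 2 by near: t; exact: ht.
  by rewrite sub0r normrN ger0_norm// !mulr_ge0.
by rewrite [leRHS]splitr lerD.
Unshelve. all: by end_near. Qed.

(** With [g = gamma2 * b1] and [s = 1 - sg], its expectation over [X] is, outside the degenerate
    case, [E X] times [1 - E s^kappa], where kappa has the size-biased law of the limit. *)
Definition size_biased_deficit (sg g x : R) : R := x * (1 - expR (- (sg * g * x))).

Let mdef sg g : measurable_fun setT (size_biased_deficit sg g).
Proof.
apply: measurable_funM => //; apply: measurable_funB => //.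
apply: (measurableT_comp (@measurable_expR R)).
by apply: measurableT_comp => //; exact: measurable_funM.
Qed.

Let def_ge0 sg g x : 0 <= sg -> 0 <= g -> 0 <= x -> 0 <= size_biased_deficit sg g x.
Proof.
by move=> ? ? ?; rewrite mulr_ge0// subr_ge0 expRN_le1// !mulr_ge0.
Qed.

Let Idef sg g : 0 <= sg -> 0 <= g ->
  intg P (fun w => size_biased_deficit sg g (X 0%N w)).
Proof.
move=> sg0 g0; apply: (intg_le _ _ IX).
  by apply: (measurableT_comp (mdef sg g)).
move=> w; rewrite ger0_norm; last exact: def_ge0.
by rewrite ler_piMr// lerBlDr lerDl expR_ge0.
Qed.

Let gamma20 : 0 <= gamma2.
Proof.
rewrite mulr_ge0// subr_ge0 lef_pV2 ?posrE ?sqrtr_gt0//; last exact: lt_trans ab.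
by rewrite ler_wsqrtr// ltW.
Qed.

Let gamma10 : 0 <= gamma1.
Proof. by rewrite mulr_ge0// subr_ge0 ler_wsqrtr// ltW. Qed.

Let majorant_ge0 s r t K M g k phi w : 0 <= K -> 0 <= majorant s r t K M g k phi w.
Proof.
move=> K0; rewrite /majorant addr_ge0// mulr_ge0//; apply: sumr_ge0 => i _.
rewrite mulr_ge0//; repeat first [by [] | exact: sqr_ge0 | apply: sumr_ge0 => ? _
  | apply: addr_ge0 | apply: mulr_ge0].
Qed.

(** Where [K < Y t], both quantities lie between 0 and 1 and the indicator alone suffices; elsewhere
    [dist_pgf_expRN] applies and [Y t] is replaced by [K]. *)
Let pgf_majorant t (K sg k : R) w :
  0 <= sg <= 1 -> 0 <= k -> 0 <= K ->
  let M := (rt t)^-1 in let g := gamma2 * b1 in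
  let s := index_iota 0 (edge_range a b t) in
  `|edge_pgf sg t w - expR (- (Y t w * k))|
  <= (K < Y t w)%R%:R + majorant s (others t) t K M g k (size_biased_deficit sg g) w.
Proof.
move=> sg01 k0 K0; cbv zeta.
set M := (rt t)^-1; set g := gamma2 * b1; set s := index_iota _ _.
have [KY|YK] := ltP K (Y t w).
  have /andP[h1 h2] := edge_pgf01 t w sg01.
  have h3 := expRN_le1 (mulr_ge0 (Y0 t w) k0).
  have h4 := expR_gt0 (- (Y t w * k)).
  have := majorant_ge0 s (others t) t M g k (size_biased_deficit sg g) w K0.
  by rewrite ler_norml /= => h5; apply/andP; split; lra.
rewrite add0r.
have M0 : 0 <= M by rewrite invr_ge0 ltW.
have g0 : 0 <= g by rewrite mulr_ge0.
have := @dist_pgf_expRN R c (fun i => X i w) (fun u => Y u w) c0 (X0^~ w)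
  (Y0^~ w) s (others t) t M sg g k M0 sg01 g0 k0.
move=> /le_trans; apply; apply: lerD; last by rewrite ler_wpM2r.
rewrite mulr_sumr; apply: ler_sum => i _.
set S := \sum_(u <- others t) _; set D := `|_ - g|.
have D0 : 0 <= D by rewrite normr_ge0.
have S0 : 0 <= S.
  by apply: sumr_ge0 => u _; rewrite mulr_ge0 ?trunc_err_ge0// !mulr_ge0.
have te : trunc_err M (c i t) (X i w) (Y t w)
    <= c i t * M ^+ 2 + (M < X i w)%R%:R + (M < K)%R%:R.
  rewrite lerD2l; case: (ltP M (Y t w)) => [MY|_]; last exact: nat0.
  by rewrite (lt_le_trans MY YK).
have -> : \sum_(u <- others t) 2 * c i u *
     (c i u * M ^+ 2 * (X i w ^+ 2 * Y u w) +
      X i w ^+ 2 * (M < X i w)%R%:R * Y u w +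
      X i w ^+ 2 * (Y u w * (M < Y u w)%R%:R)) = X i w * S.
  by rewrite mulr_sumr; apply: eq_bigr => u _; rewrite /trunc_err; ring.
apply: (@le_trans _ _ (c i t * X i w * K *
   (2 * (c i t * M ^+ 2 + (M < X i w)%R%:R + (M < K)%R%:R) + S + X i w * D))).
  apply: ler_pM.
  - by rewrite !mulr_ge0.
  - by rewrite !addr_ge0 ?mulr_ge0 ?trunc_err_ge0.
  - by rewrite ler_wpM2l// mulr_ge0.
  - by rewrite !lerD2r ler_wpM2l.
by rewrite le_eqVlt; apply/orP; left; apply/eqP; ring.
Qed.

Let cvg_rt2 (x : R) : x * rt t ^+ 2 @[t --> \oo] --> 0.
Proof.
rewrite -[X in _ --> X](mulr0 x); apply: cvgMl_tmp.
rewrite -[X in _ --> X](mul0r (0 : R)); under eq_fun do rewrite expr2.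
by apply: cvgM; exact: cvg_root4_harmonic.
Qed.

Let cvg_X_tail1 : X_tail1 (rt t)^-1 @[t --> \oo] --> 0.
Proof. exact: cvg_Ex_tail. Qed.

Let cvg_X_tail2 : X_tail2 (rt t)^-1 @[t --> \oo] --> 0.
Proof. by apply: cvg_Ex_tail => // w; exact: sqr_ge0. Qed.

Let cvg_Y_tail : Y_tail (rt t)^-1 @[t --> \oo] --> 0.
Proof. exact: cvg_Ex_tail. Qed.

Let cvg_rt_lt (K : R) : ((rt t)^-1 < K)%R%:R @[t --> \oo] --> (0 : R).
Proof.
apply: cvg_near_cst; apply: filterS (near_le_root4_harmonicV K) => n h.
by apply/eqP; rewrite ltNge h.
Qed.

(** All [Y t] have the law of [Y 0], so a single [K] works for every [t]. *)
Lemma small_Y_tail (e : R) : 0 < e -> exists2 K, 0 < K &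
  forall t, intg P (fun w => (K < Y t w)%R%:R) /\
    Ex P (fun w => (K < Y t w)%R%:R) <= e.
Proof.
have mY0 : measurable_fun setT (Y 0%N) by [].
move=> e0; have := cvg_Ex_tail (intg_cst P 1) (fun=> ler01) mY0.
move=> /cvgrPdist_le/(_ _ e0)[n0 _ /(_ n0 (leqnn _)) h].
exists (rt n0)^-1; first by rewrite invr_gt0.
move=> t.
have I0 : intg P (fun w => ((rt n0)^-1 < Y 0%N w)%R%:R).
  have := intg_tail (rt n0)^-1 (intg_cst P 1) mY0.
  by apply: intg_ext => w; rewrite mul1r.
have [I1 E1] := @Ex_iid _ _ _ P Y iY Y0 (fun x => ((rt n0)^-1 < x)%R%:R) t
  (measurable_ltr_nat _) (fun x _ => nat0 _) I0.
split; first exact: I1.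
rewrite E1; move: h; rewrite sub0r normrN; apply: le_trans.
rewrite ger0_norm; last by apply: Ex_ge0 => w; rewrite mul1r.
by under [leRHS]Ex_ext do rewrite mul1r.
Qed.

Lemma cvg_Ex_edge_pgf sg : 0 <= sg <= 1 ->
  Ex P (edge_pgf sg t) @[t --> \oo] -->
  Ex P (fun w => expR (- (Y 0%N w * (gamma1 *
    Ex P (fun w => size_biased_deficit sg (gamma2 * b1) (X 0%N w)))))).
Proof.
move=> sg01; have /andP[sg0 sg1] := sg01.
set g := gamma2 * b1; have g0 : 0 <= g by rewrite mulr_ge0.
pose phi := size_biased_deficit sg g; set mu := Ex P (fun w => size_biased_deficit sg g (X 0%N w)).
set k := gamma1 * mu.
have mu0 : 0 <= mu by apply: Ex_ge0 => w; exact: def_ge0.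
have k0 : 0 <= k by rewrite mulr_ge0.
have mphi : measurable_fun setT phi := mdef sg g.
have phi0 x : 0 <= x -> 0 <= phi x by move=> x0; exact: def_ge0.
have Iphi : intg P (fun w => phi (X 0%N w)) by exact: Idef.
pose st t := index_iota 0 (edge_range a b t).
pose l t := Ex P (fun w => `|\sum_(i <- st t) c i t * phi (X i w) - k|).
have cl : l t @[t --> \oo] --> 0.
  have := @weighted_L1_lln _ _ _ P X iX X0 phi (fun t i => c i t)
    (edge_range a b) gamma1 A1 mphi phi0 Iphi.
  rewrite -/mu -/k => h.
  have -> : l = (fun t => Ex P (fun w =>
      `|\sum_(i < edge_range a b t) c i t * phi (X i w) - k|)).
    by apply/funext => t; apply: Ex_ext => w; rewrite /st big_mkord.
  apply: h; last exact: cvg_sum_edge_weight_row.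
  by move=> t i; rewrite c0 (edge_weight_le b a0).
have mY t : measurable_fun setT (fun w => expR (- (Y t w * k))).
  apply: (measurableT_comp (@measurable_expR R)).
  by apply: measurableT_comp => //; exact: measurable_funM.
have IeY t : intg P (fun w => expR (- (Y t w * k))).
  apply: (@intg_bounded _ _ _ _ _ 1) => // w.
  by rewrite ger0_norm ?expR_ge0// expRN_le1// mulr_ge0.
(* By equality of laws the limit may be written with [Y t], the variable that occurs in
   [edge_pgf sg t]. *)
have EeY t : Ex P (fun w => expR (- (Y t w * k))) = Ex P (fun w => expR (- (Y 0%N w * k))).
  have me : measurable_fun setT (fun y : R => expR (- (y * k))).
    apply: (measurableT_comp (@measurable_expR R)).
    by apply: measurableT_comp => //; exact: measurable_funM.
  exact: (Ex_iid iY Y0 t me (fun x _ => expR_ge0 _) (IeY 0%N)).2.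
have Ipgf t : intg P (edge_pgf sg t).
  apply: (@intg_bounded _ _ _ _ _ 1); last first.
    by move=> w; have /andP[h1 h2] := edge_pgf01 t w sg01; rewrite ger0_norm.
  apply: measurable_prod => i _; apply: measurable_funD => //.
  apply: measurable_funM => //; apply: measurable_funB => //.
  apply: measurable_prod => u _; apply: measurable_funD => //.
  exact: measurable_funM.
apply/cvgrPdist_le => eps eps0.
(* One quarter each for the tail of [Y t] beyond [K], the truncation terms [K * B t], the column
   means through [e], and the row mean [K * l t]. [K] and [e] are fixed before [t]. *)
have e4 : 0 < eps / 4 by rewrite divr_gt0.
have [K K0 hK] := small_Y_tail e4.
have Kn := ltW K0.
(* Makes [K * (C1 * (m2 * e))] at most [eps / 4]; the added 1 covers a vanishing [m2]. *)
pose e := eps / 4 / (K * (C1 * m2) + 1).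
have den : 0 < K * (C1 * m2) + 1 by rewrite ltr_wpDl// !mulr_ge0.
have e0 : 0 < e by rewrite divr_gt0.
pose B t := C1 * (2 * A1 * m1 * rt t ^+ 2 + 2 * X_tail1 (rt t)^-1
   + 2 * m1 * ((rt t)^-1 < K)%R%:R
   + 2 * C2 * (A3 * (m2 * b1) * rt t ^+ 2 + X_tail2 (rt t)^-1 * b1 + m2 * Y_tail (rt t)^-1)).
have cB : K * B t @[t --> \oo] --> 0.
  have -> : 0 = K * (C1 * (0 + 2 * 0 + 2 * m1 * 0 + 2 * C2 * (0 + 0 * b1 + m2 * 0))) :> R.
    by ring.
  apply: cvgMl_tmp; apply: cvgMl_tmp; apply: cvgD; last first.
    apply: cvgMl_tmp; apply: cvgD; last exact: cvgMl_tmp.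
    by apply: cvgD => //; exact: cvgMr_tmp.
  apply: cvgD; last exact: cvgMl_tmp.
  by apply: cvgD => //; exact: cvgMl_tmp.
have cKl : K * l t @[t --> \oo] --> 0.
  by rewrite -[X in _ --> X](mulr0 K); exact: cvgMl_tmp.
move/cvgrPdist_le : cB => /(_ _ e4) hB.
move/cvgrPdist_le : cKl => /(_ _ e4) hl.
have hcol := near_col_mean e0.
near=> t.
have B1 : K * B t <= eps / 4.
  have : `|0 - K * B t| <= eps / 4 by near: t; exact: hB.
  by rewrite sub0r normrN; apply: le_trans; exact: ler_norm.
have l1 : K * l t <= eps / 4.
  have : `|0 - K * l t| <= eps / 4 by near: t; exact: hl.
  by rewrite sub0r normrN; apply: le_trans; exact: ler_norm.
have colt : forall i, c i t != 0 ->
    Ex P (fun w => `|\sum_(u <- others t) c i u * Y u w - gamma2 * b1|) <= e.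
  by near: t; exact: hcol.
have J1 := @Ex_majorant_le t (edge_range a b t) (edge_range a b t)
  (fun u => u != t) K g k e phi Kn (ltW e0) mphi phi0 Iphi colt.
have [IJ _] := has_majorant (st t) (others t) t K (rt t)^-1 g k mphi phi0 Iphi.
rewrite distrC -(EeY t) -ExB//.
apply: (le_trans (le_norm_Ex (intgB (Ipgf t) (IeY t)))).
apply: (@le_trans _ _ (Ex P (fun w => (K < Y t w)%R%:R
  + majorant (st t) (others t) t K (rt t)^-1 g k phi w))).
  apply: le_Ex.
  - exact: (intg_norm (intgB (Ipgf t) (IeY t))).
  - exact: intgD (hK t).1 IJ.
  - by move=> w; exact: pgf_majorant.
rewrite ExD; [|exact: (hK t).1|exact: IJ].
have e1 : K * (C1 * (m2 * e)) <= eps / 4.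
  rewrite (_ : K * (C1 * (m2 * e)) = (K * (C1 * m2)) * (eps / 4) / (K * (C1 * m2) + 1)); last first.
    by rewrite /e; ring.
  rewrite ler_pdivrMr// mulrC ler_wpM2l ?(ltW e4)//; lra.
have {}J1 : Ex P (majorant (st t) (others t) t K (rt t)^-1 g k phi)
    <= K * B t + K * (C1 * (m2 * e)) + K * l t.
  apply: (le_trans J1); rewrite lerD2r /B le_eqVlt; apply/orP; left; apply/eqP.
  by ring.
rewrite [leRHS](_ : _ = eps / 4 + (eps / 4 + eps / 4 + eps / 4)); last by field.
exact: lerD (hK t).2 (le_trans J1 (lerD (lerD B1 e1) l1)).
Unshelve. all: by end_near. Qed.

(** The two edges at [v_t] yield [c X K] each, the edge [(j, u)] yields [c X Y], and [(i, u)],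
    bounded by [trunc_err], yields the small factor. The total is of degree 2 in [X j] and 1 in
    [X i] and [Y u], within the available moments. *)
Let double_edge_bound t (K : R) i j u : 0 <= K -> j != i ->
  Ex P (fun w => \1_[set w | Y t w <= K] w *
    (edge_pr i t w * edge_pr j t w * edge_pr i u w * edge_pr j u w))
  <= c i t * (c j t * c j u) * (K ^+ 2 * (A3 * (m2 * m1 * b1) * rt t ^+ 2
     + m2 * X_tail1 (rt t)^-1 * b1 + m2 * m1 * Y_tail (rt t)^-1)).
Proof.
move=> K0 ji; set M := (rt t)^-1.
have M0 : 0 <= M by rewrite invr_ge0 ltW.
have mYK : measurable [set w | Y t w <= K].
  rewrite (_ : [set w | _] = Y t @^-1` `]-oo, K]%classic).
    by rewrite -[X in measurable X]setTI; exact: measurable_funP.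
  by apply/seteqP; split => w /=; rewrite in_itv.
have p0 i' u' w : 0 <= edge_pr i' u' w by case/andP: (p01 i' u' w).
have p1 i' u' w : edge_pr i' u' w <= 1 by case/andP: (p01 i' u' w).
pose kk := K ^+ 2 * (c i t * (c j t * c j u)).
have kk0 : 0 <= kk by rewrite !mulr_ge0 ?sqr_ge0.
have HE : has_Ex P (fun w => kk * (c i u * M ^+ 2 * (X j w ^+ 2 * X i w * Y u w)
    + X j w ^+ 2 * (X i w * (M < X i w)%R%:R) * Y u w
    + X j w ^+ 2 * X i w * (Y u w * (M < Y u w)%R%:R)))
    (kk * (c i u * M ^+ 2 * (m2 * m1 * b1) + m2 * X_tail1 M * b1 + m2 * m1 * Y_tail M)).
  apply/has_ExZ/has_ExD; last exact: has_X2XYtail.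
  by apply: has_ExD; [exact/has_ExZ/has_X2XY|exact: has_X2XtailY].
apply: (@le_trans _ _ (kk * (c i u * M ^+ 2 * (m2 * m1 * b1)
    + m2 * X_tail1 M * b1 + m2 * m1 * Y_tail M))).
  rewrite -HE.2; apply: le_Ex; last first.
  - move=> w; rewrite indicE; have [YK|nYK] := pselect (Y t w <= K); last first.
      rewrite memNset// mul0r; repeat first [by [] | exact: sqr_ge0
        | apply: addr_ge0 | apply: mulr_ge0].
    rewrite mem_set// mul1r.
    have q1 i' : edge_pr i' t w <= c i' t * X i' w * K.
      rewrite /edge_pr ge_min; apply/orP; right; rewrite ler_wpM2l//.
      by rewrite mulr_ge0.
    have q2 : edge_pr i u w <= trunc_err M (c i u) (X i w) (Y u w).
      exact: min1_le_trunc_err.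
    have q3 : edge_pr j u w <= c j u * X j w * Y u w.
      by rewrite /edge_pr ge_min lexx orbT.
    apply: (@le_trans _ _ (c i t * X i w * K * (c j t * X j w * K)
        * trunc_err M (c i u) (X i w) (Y u w) * (c j u * X j w * Y u w))).
      by apply: ler_pM => //; rewrite ?mulr_ge0//; apply: ler_pM => //; rewrite ?mulr_ge0//; apply: ler_pM.
    by rewrite le_eqVlt; apply/orP; left; apply/eqP; rewrite /trunc_err /kk; ring.
  - exact: HE.1.
  - apply: (@intg_bounded _ _ _ _ _ 1).
      apply: measurable_funM; first exact: measurable_indic.
      by apply: measurable_funM => //; apply: measurable_funM => //; apply: measurable_funM.
    move=> w; have i1 : \1_[set w | Y t w <= K] w <= 1 :> R.
      by rewrite indicE lern1 leq_b1.
    have p4 : edge_pr i t w * edge_pr j t w * edge_pr i u w * edge_pr j u w <= 1.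
      by rewrite !mulr_ile1 ?mulr_ge0.
    have p40 : 0 <= edge_pr i t w * edge_pr j t w * edge_pr i u w * edge_pr j u w.
      by rewrite !mulr_ge0.
    by rewrite ger0_norm ?mulr_ge0// mulr_ile1.
rewrite /kk; have [->|cit] := eqVneq (c i t) 0; first by rewrite !(mul0r, mulr0).
rewrite [leRHS]mulrA [X in _ <= X * _]mulrC ler_wpM2l//.
rewrite !lerD2r -[leRHS]mulrAC ler_wpM2r//; last exact: col_M2.
by rewrite !mulr_ge0.
Qed.

(** Summed over [i], [j] and [u], the three weights of [double_edge_bound] give two row sums and one
    column sum, all bounded; the remaining factor tends to 0. *)
Lemma cvg_double_edges (K : R) : 0 <= K ->
  \sum_(u <- others t) \sum_(i <- index_iota 0 (edge_range a b t))
    \sum_(j <- index_iota 0 (edge_range a b t) | j != i)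
    Ex P (fun w => \1_[set w | Y t w <= K] w *
      (edge_pr i t w * edge_pr j t w * edge_pr i u w * edge_pr j u w))
  @[t --> \oo] --> 0.
Proof.
move=> K0.
pose D t := K ^+ 2 * (A3 * (m2 * m1 * b1) * rt t ^+ 2
     + m2 * X_tail1 (rt t)^-1 * b1 + m2 * m1 * Y_tail (rt t)^-1).
have D0 t : 0 <= D t.
  rewrite /D; repeat first [by [] | exact: sqr_ge0 | apply: addr_ge0 | apply: mulr_ge0].
have cD : C1 * (C1 * C2) * D t @[t --> \oo] --> 0.
  rewrite (_ : 0 = C1 * (C1 * C2) * (K ^+ 2 * (0 + m2 * 0 * b1 + m2 * m1 * 0))); last by ring.
  apply: cvgMl_tmp; apply: cvgMl_tmp; apply: cvgD; last exact: cvgMl_tmp.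
  by apply: cvgD => //; apply: cvgMr_tmp; exact: cvgMl_tmp.
apply: (squeeze_cvgr _ (cvg_cst 0) cD); apply: nearW => t; apply/andP; split.
  apply: sumr_ge0 => u _; apply: sumr_ge0 => i _; apply: sumr_ge0 => j _.
  apply: Ex_ge0 => w.
  by rewrite !mulr_ge0//; [case/andP: (p01 i t w)|case/andP: (p01 j t w)|case/andP: (p01 i u w)|case/andP: (p01 j u w)].
set s := index_iota 0 _.
apply: (@le_trans _ _ (\sum_(u <- others t) \sum_(i <- s) \sum_(j <- s)
    c i t * (c j t * c j u) * D t)).
  apply: ler_sum => u _; apply: ler_sum => i _; rewrite big_mkcond/=.
  apply: ler_sum => j _; case: ifP => ji; first exact: double_edge_bound.
  by apply: mulr_ge0 => //; rewrite !mulr_ge0.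
rewrite (_ : \sum_(u <- others t) _ = (\sum_(i <- s) c i t) *
    (\sum_(j <- s) c j t * \sum_(u <- others t) c j u) * D t); last first.
  rewrite (eq_bigr (fun u => (\sum_(i <- s) c i t) * (\sum_(j <- s) c j t * c j u) * D t)).
    rewrite -mulr_suml -mulr_sumr exchange_big/=; congr (_ * _ * _).
    by apply: eq_bigr => j _; rewrite mulr_sumr.
  move=> u _; rewrite mulr_suml mulr_suml; apply: eq_bigr => i _.
  by rewrite mulr_sumr mulr_suml.
rewrite ler_wpM2r//.
have C1s : \sum_(i <- s) c i t <= C1 by exact: sum_edge_weight_row.
apply: ler_pM => //.
- exact: sumr_ge0.
- by apply: sumr_ge0 => j _; rewrite mulr_ge0// sumr_ge0.
apply: (@le_trans _ _ (\sum_(j <- s) c j t * C2)).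
  apply: ler_sum => j _; rewrite ler_wpM2l//; exact: (sum_col_le j (erefl (others t))).
by rewrite -mulr_suml ler_wpM2r.
Qed.

End ModelBounds.

(** * Degree and multiplicity *)

Lemma measurable_natR (R : realType) d (T : measurableType d) (f : T -> nat) :
  measurable_fun setT (fun w => (f w)%:R : R) -> measurable_fun setT f.
Proof.
move=> mf _ A _; rewrite setTI.
rewrite (_ : f @^-1` A = \bigcup_(n in A) (fun w => (f w)%:R : R) @^-1` [set n%:R]).
  apply: bigcup_measurable => n _; rewrite -[X in measurable X]setTI.
  by apply: mf => //; exact: measurable_set1.
apply/seteqP; split => w /=; first by exists (f w).
by move=> [n An /= /eqP]; rewrite eqr_nat => /eqP ->.
Qed.

Lemma counting_seq (R : realType) (T : choiceType) (s : seq T) : uniq s ->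
  counting [set` s] = (size s)%:R%:E :> \bar R.
Proof.
move=> us; rewrite /counting asboolT; last exact: finite_seq.
rewrite (_ : [set` s] = [set` seq_fset tt s]); last first.
  by apply/seteqP; split => x /=; rewrite (seq_fsetE tt s x).
by rewrite set_fsetK size_seq_fset undup_id.
Qed.

Lemma sum_bool_has (s : seq nat) (p : pred nat) : uniq s ->
  (forall i j, i \in s -> j \in s -> i != j -> ~~ (p i && p j)) ->
  (\sum_(i <- s) p i)%N = has p s.
Proof.
move=> us hp; have [/hasP[i si pi]|/hasPn h] := boolP (has p s).
  rewrite (bigD1_seq i)//= pi big1_seq// => j /andP[ji js].
  by have := hp i j si js; rewrite eq_sym ji pi /= => /(_ isT); case: (p j).
by rewrite big1_seq// => i /andP[_ /h /negbTE ->].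
Qed.

Lemma ler_sum_mem (R : realType) (I : eqType) (s : seq I) (F : I -> R) i :
  i \in s -> (forall j, 0 <= F j) -> F i <= \sum_(j <- s) F j.
Proof. by move=> si F0; rewrite (big_rem i)//= lerDl sumr_ge0. Qed.

Section EdgeIndicators.
Context d (Omega : measurableType d) (R : realType) (P : probability Omega R).
Context (a b : R) (X Y : nat -> {RV P >-> R}) (E : nat -> nat -> {RV P >-> bool}).
Hypothesis model : bipartite_model a b (fun t => t%:R) X Y E.

Let a0 : 0 < a. Proof. by case/andP: (model_ab model). Qed.
Let ab : a < b. Proof. by case/andP: (model_ab model). Qed.
Let X0 := model_X_ge0 model.
Let Y0 := model_Y_ge0 model.

Lemma edge_probE i u w :
  edge_prob a b (fun t => t%:R) X Y i u w = edge_pr a b X Y i u w.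
Proof.
rewrite /edge_prob /edge_pr /edge_weight /riemann_weight.
case: ifP => _; last by rewrite !mul0r min_r.
by congr (Num.min 1 _); rewrite -[RHS]mulrA mulrC.
Qed.

Let G : set_system Omega := <<s sigma_of_family X `|` sigma_of_family Y >>.

Let G_measurable C : G C -> measurable C.
Proof.
apply: smallest_sub; first exact: sigma_algebra_measurable.
by move=> B []; exact: sigma_of_family_measurable.
Qed.

Let GY t K : G [set w | Y t w <= K].
Proof.
apply: sub_sigma_algebra; right.
have := @sigma_measurable_comp _ _ _ P _ _ Y t idfun (@measurable_id _ _ setT) `]-oo, K]%classic.
move=> /(_ (measurable_itv _)).
by congr (sigma_of_family Y _); apply/seteqP; split => w /=; rewrite in_itv.
Qed.

Let mE i u : measurable [set w | E i u w].
Proof.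
rewrite (_ : [set w | E i u w] = E i u @^-1` [set true]); last first.
  by apply/seteqP; split => w /=.
by rewrite -[X in measurable X]setTI; exact: measurable_funP.
Qed.

Let e (ed : nat * nat) (w : Omega) : R := (E ed.1 ed.2 w)%:R.
Let p (ed : nat * nat) (w : Omega) : R := edge_pr a b X Y ed.1 ed.2 w.

Let e01 ed w : 0 <= e ed w <= 1.
Proof. by rewrite /e; case: (E _ _ _); rewrite ?lexx ?ler01. Qed.

Let p01 ed w : 0 <= p ed w <= 1.
Proof.
by rewrite /p /edge_pr le_min ge_min lexx ler01 !mulr_ge0// edge_weight_ge0.
Qed.

Let me ed : measurable_fun setT (e ed).
Proof.
rewrite (_ : e ed = \1_[set w | E ed.1 ed.2 w]); first exact: measurable_indic.
apply/funext => w; rewrite indicE /e; congr (nat_of_bool _)%:R.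
by apply/idP/idP; rewrite inE.
Qed.

Let mp ed : measurable_fun setT (p ed).
Proof.
apply: measurable_minr; first exact: measurable_cst.
by apply: measurable_funM => //; apply: measurable_funM.
Qed.

(** The conditional independence of the edges, integrated over an event [C] of the sigma-algebra of
    [X] and [Y]. Distinctness of the edges in [s] matters: an indicator equals its square, its
    probability in general does not. All later use of [model_edges] passes through this identity. *)
Lemma Ex_prod_edges C (s : seq (nat * nat)) : G C -> uniq s ->
  Ex P (fun w => \1_C w * \prod_(ed <- s) e ed w)
    = Ex P (fun w => \1_C w * \prod_(ed <- s) p ed w).
Proof.
move=> GC us; have mC := G_measurable GC.
have pE : perm_eq (seq_fset tt s) s.
  by rewrite (perm_trans (seq_fset_perm _ _))// undup_id.
have [_ /(_ C GC)] := model_edges model (seq_fset tt s).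
set A := \bigcap_(i in _) _ => PA.
have memE ed : [set` seq_fset tt s] ed <-> ed \in s.
  by rewrite -(seq_fsetE tt s ed).
have mA : measurable A.
  by apply: fin_bigcap_measurable => //; exact: finite_fset.
rewrite (Ex_ext (g := \1_(C `&` A))); last first.
  move=> w; rewrite indicI /=; congr (_ * _); rewrite indicE.
  have [Aw|nA] := pselect (A w).
    rewrite mem_set// big_seq big1// => ed eds; rewrite /e.
    by have := Aw ed ((memE ed).2 eds) => /= ->.
  rewrite memNset//; apply/eqP; rewrite prodf_seq_eq0; apply/hasP.
  apply: contrapT => h; apply: nA => ed /memE eds /=.
  by apply: contrapT => h'; apply: h; exists ed => //=; rewrite /e; move/negP/negbTE: h' => ->.
rewrite Ex_indic; last exact: measurableI.
rewrite PA /Ex.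
rewrite -[LHS]/(\int[P]_(w in C) (\prod_(ed <- seq_fset tt s)
   edge_prob a b (fun t => t%:R) X Y ed.1 ed.2 w))%R Rintegral_mkcond.
apply: Ex_ext => w; rewrite patchE indicE.
case: ifP => _; last by rewrite mul0r.
by rewrite mul1r (perm_big _ pE)/=; apply: eq_bigr => ed _; rewrite edge_probE.
Qed.

(* The degree of [v_t] counted with multiplicity, i.e. the number of paths
   [v_t - w_i - v_u] in the bipartite graph. *)
Definition multiplicity (t : nat) (w : Omega) : nat :=
  \sum_(i <- index_iota 0 (edge_range a b t)) \sum_(u <- others a b t)
    (E i t w && E i u w).

Lemma measurable_multiplicity t : measurable_fun setT (multiplicity t).
Proof.
apply: (@measurable_natR R).
have -> : (fun w => (multiplicity t w)%:R : R)
    = (fun w => \sum_(i <- index_iota 0 (edge_range a b t))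
        \sum_(u <- others a b t) e (i, t) w * e (i, u) w); last first.
  apply: measurable_sum => i; apply: measurable_sum => u.
  exact: measurable_funM.
apply/funext => w; rewrite /multiplicity natr_sum; apply: eq_bigr => i _.
rewrite natr_sum; apply: eq_bigr => u _; rewrite /e/=.
by case: (E i t w); case: (E i u w); rewrite /= ?(mulr0, mul0r, mulr1).
Qed.

(** At a 0/1-valued edge configuration the polynomial [F] is exactly [s ^+ multiplicity t]: an
    absent edge between [w_i] and [v_t] contributes 1, a present one a factor [s] for each further
    edge from [w_i] to [others]. [Ex_multiaffine] then puts the probabilities in place of the
    edges. *)
Lemma Ex_multiplicity_pgf (s : R) t : 0 <= s <= 1 ->
  Ex P (fun w => s ^+ multiplicity t w) = Ex P (edge_pgf a b X Y (1 - s) t).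
Proof.
move=> /andP[s0 s1].
pose r := others a b t; pose I := index_iota 0 (edge_range a b t).
pose F (x : nat * nat -> R) := \prod_(i <- I)
  (1 + x (i, t) * (\prod_(u <- r) (1 + x (i, u) * - (1 - s)) - 1)).
have ur : uniq (t :: r).
  by rewrite /= filter_uniq ?iota_uniq// mem_filter eqxx.
(* The edges at [w_i], the one to [v_t] in front. These lists are disjoint for distinct [i], so the
   product over [i] stays multiaffine. *)
pose D (i : nat) := [seq (i, u) | u <- t :: r].
have injp i : injective (pair i : nat -> nat * nat) by move=> u v [].
have MD i : multiaffine (D i) (fun x : nat * nat -> R => 1 + x (i, t) *
    (\prod_(u <- r) (1 + x (i, u) * - (1 - s)) - 1)).
  have uD : uniq (D i) by rewrite map_inj_uniq.
  have := uD; rewrite /D /= => /andP[tD urD].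
  apply: (@multiaffine_cons _ _ _ _ (fun=> 1)) => //; first exact: multiaffine_cst.
  apply: multiaffineD; last exact: multiaffine_cst.
  elim: (r) urD {ur tD uD} => [_|u r' ih /=].
    by exists 1 => x; rewrite big_nil.
  move=> /andP[ur' u'].
  have -> : (fun x : nat * nat -> R => \prod_(v <- u :: r') (1 + x (i, v) * - (1 - s)))
      = (fun x => \prod_(v <- r') (1 + x (i, v) * - (1 - s)) +
        x (i, u) * (- (1 - s) * \prod_(v <- r') (1 + x (i, v) * - (1 - s)))).
    by apply/funext => x; rewrite big_cons; ring.
  apply: multiaffine_cons => //; first exact: ih.
  by apply: multiaffineZ; exact: ih.
have MF : multiaffine (flatten [seq D i | i <- I]) F.
  apply: multiaffine_prod MD _.
  rewrite (_ : flatten _ = [seq (i, u) | i <- I, u <- t :: r])//.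
  by apply: allpairs_uniq => //; [exact: iota_uniq|move=> [? ?] [? ?]].
have := @Ex_multiaffine R _ _ _ P e p (fun=> 1) _ F me mp e01 p01 (intg_cst P 1) _ MF.
have -> : Ex P (fun w => s ^+ multiplicity t w) = Ex P (fun w => 1 * F (e^~ w)).
  apply: Ex_ext => w; rewrite mul1r /F /multiplicity.
  rewrite -/I; elim: (I) => [|i I' ih]; first by rewrite !big_nil expr0.
  rewrite !big_cons exprD ih; congr (_ * _); rewrite /e/=.
  case: (E i t w) => /=; last by rewrite big1// mul0r addr0.
  rewrite mul1r addrC subrK -/r; elim: (r) => [|u r' ih']; first by rewrite !big_nil.
  rewrite !big_cons exprD ih'; congr (_ * _).
  by case: (E i u w); rewrite /= ?expr1 ?expr0; ring.
move=> ->.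
  by apply: Ex_ext => w; rewrite mul1r.
move=> s' us'; have GT : G setT.
  exact: (@measurableT _ (g_sigma_algebraType (sigma_of_family X `|` sigma_of_family Y))).
have := Ex_prod_edges GT us'; rewrite indicT.
by rewrite (_ : (cst 1 : Omega -> R) = fun=> 1).
Qed.

(** An edge of weight 0 is absent only almost surely, while [degree] ranges over all attributes and
    vertices; these exceptional events are collected into one null set. *)
Let null_edge i u : set Omega := [set w | edge_weight a b i u = 0 /\ E i u w].

Let null_edges : set Omega := \bigcup_i \bigcup_u null_edge i u.

Let measurable_null_edge i u : measurable (null_edge i u).
Proof.
have [c0|c0] := pselect (edge_weight a b i u = 0).
  by rewrite (_ : null_edge i u = [set w | E i u w])//; apply/seteqP; split => w // [].
by rewrite (_ : null_edge i u = set0)//; apply/seteqP; split => w // [].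
Qed.

Let measurable_null_edges : measurable null_edges.
Proof. by do 2 apply: bigcup_measurable => ? _. Qed.

Let G_setT : G setT.
Proof.
exact: (@measurableT _ (g_sigma_algebraType (sigma_of_family X `|` sigma_of_family Y))).
Qed.

Let P_null_edge i u : P (null_edge i u) = 0%E.
Proof.
have [c0|c0] := pselect (edge_weight a b i u = 0); last first.
  rewrite (_ : null_edge i u = set0) ?measure0//.
  by apply/seteqP; split => w // [].
suff : fine (P (null_edge i u)) = 0.
  by move=> h; rewrite -[LHS]fineK ?fin_num_measure// h.
have := @Ex_prod_edges setT [:: (i, u)] G_setT isT.
rewrite (Ex_ext (g := \1_(null_edge i u))); last first.
  move=> w; rewrite indicT mul1r big_seq1 /e/= indicE; congr (nat_of_bool _)%:R.
  by apply/idP/idP; rewrite inE; [move=> h; split|case].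
rewrite Ex_indic// => ->; rewrite (Ex_ext (g := fun=> 0)) ?Ex_cst// => w.
by rewrite big_seq1 /p /edge_pr/= c0 !mul0r min_r// mulr0.
Qed.

Let P_null_edges : P null_edges = 0%E.
Proof.
apply/negligibleP => //; apply: negligible_bigcup => i; apply: negligible_bigcup => u.
by apply/negligibleP => //; exact: P_null_edge.
Qed.

(** Under the second hypothesis [v_t] and [v_u] have at most one common neighbour, so the sum over
    [i] for a given [u] is 0 or 1. Off [null_edges] every edge present has positive weight, and the
    finite ranges miss no path. *)
Lemma degree_multiplicity t w : ~ null_edges w ->
  (forall u i j, u \in others a b t -> i != j ->
    ~~ [&& E i t w, E j t w, E i u w & E j u w]) ->
  degree E t w = (multiplicity t w)%:R%:E.
Proof.
move=> nw hw.
have wpos i u : E i u w -> edge_weight a b i u != 0.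
  by move=> Eiu; apply/eqP => c0; apply: nw; exists i => //; exists u.
pose I := index_iota 0 (edge_range a b t).
pose S := [seq u <- others a b t | has (fun i => E i t w && E i u w) I].
have uo : uniq (others a b t) by rewrite filter_uniq// iota_uniq.
have uS : uniq S by rewrite filter_uniq.
have adjE : [set u | ri_adjacent E w u t] = [set` S].
  apply/seteqP; split => u /=.
    move=> [/eqP ut [i [Eu Et]]]; rewrite mem_filter; apply/andP; split.
      apply/hasP; exists i; last by rewrite Et Eu.
      by rewrite mem_index_iota (edge_weight_row a0 ab (wpos _ _ Et)).
    rewrite mem_filter ut mem_index_iota.
    by rewrite (edge_weight_col a0 ab (wpos _ _ Et) (wpos _ _ Eu)).
  rewrite mem_filter mem_filter => /andP[/hasP[i _ /andP[Et Eu]] /andP[ut _]].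
  by split; [exact/eqP|exists i].
rewrite /degree adjE counting_seq//; congr (_%:R%:E).
rewrite size_filter -sum1_count big_mkcond/= /multiplicity exchange_big/=.
rewrite big_seq [RHS]big_seq; apply: eq_bigr => u uot.
rewrite sum_bool_has ?iota_uniq//.
move=> i j _ _ ij; apply: contra (hw u i j uot ij).
by move=> /andP[/andP[-> ->] /andP[-> ->]].
Qed.

(** Pointwise union bound off the null set: the two indicators differ only if [K < Y t] or some four
    edges [(i, t), (j, t), (i, u), (j, u)] are all present. Taking expectations turns the edges into
    their probabilities. *)
Lemma dist_degree_multiplicity t (K x : R) :
  intg P (fun w => (K < Y t w)%R%:R) ->
  `|Ex P (\1_[set w | (degree E t w <= x%:E)%E])
    - Ex P (\1_[set w | (multiplicity t w)%:R <= x])|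
  <= Ex P (fun w => (K < Y t w)%R%:R) +
  \sum_(u <- others a b t) \sum_(i <- index_iota 0 (edge_range a b t))
    \sum_(j <- index_iota 0 (edge_range a b t) | j != i)
    Ex P (fun w => \1_[set w | Y t w <= K] w *
      (edge_pr a b X Y i t w * edge_pr a b X Y j t w *
       edge_pr a b X Y i u w * edge_pr a b X Y j u w)).
Proof.
move=> IK; set I := index_iota 0 _.
pose four (i j u : nat) := [:: (i, t); (j, t); (i, u); (j, u)].
pose H w := (K < Y t w)%R%:R + \sum_(u <- others a b t) \sum_(i <- I)
    \sum_(j <- I | j != i) \1_[set w | Y t w <= K] w * \prod_(ed <- four i j u) e ed w.
have I4 i j u : intg P (fun w => \1_[set w | Y t w <= K] w * \prod_(ed <- four i j u) e ed w).
  apply: (@intg_bounded _ _ _ _ _ 1).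
    apply: measurable_funM; first by apply: measurable_indic; apply: G_measurable; exact: GY.
    by apply: measurable_prod => ed _; exact: me.
  have q1 w : \prod_(ed <- four i j u) e ed w <= 1 by apply: prodr_ile1 => ed _.
  have q0 w : 0 <= \prod_(ed <- four i j u) e ed w.
    by apply: prodr_ge0 => ed _; case/andP: (e01 ed w).
  have i1 w : \1_[set w | Y t w <= K] w <= 1 :> R by rewrite indicE lern1 leq_b1.
  by move=> w; rewrite ger0_norm ?mulr_ge0// mulr_ile1.
have Isum : intg P (fun w => \sum_(u <- others a b t) \sum_(i <- I)
    \sum_(j <- I | j != i) \1_[set w | Y t w <= K] w * \prod_(ed <- four i j u) e ed w).
  by do 3 (apply: intg_sum => ? _).
have IH : intg P H by exact: intgD.
have IN : intg P \1_null_edges by exact: intg_indic.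
have mdeg : measurable [set w | (degree E t w <= x%:E)%E].
  rewrite -[X in measurable X]setTI; apply: emeasurable_fun_infty_c => //.
have mmul : measurable [set w | (multiplicity t w)%:R <= x].
  have := measurable_multiplicity t => /(_ measurableT [set n | n%:R <= x] _).
  by rewrite setTI; apply.
have <- : Ex P H = Ex P (fun w => (K < Y t w)%R%:R) +
  \sum_(u <- others a b t) \sum_(i <- I) \sum_(j <- I | j != i)
    Ex P (fun w => \1_[set w | Y t w <= K] w *
      (edge_pr a b X Y i t w * edge_pr a b X Y j t w *
       edge_pr a b X Y i u w * edge_pr a b X Y j u w)).
  rewrite /H ExD//; congr (_ + _).
  rewrite Ex_sum => [|u _]; last by do 2 (apply: intg_sum => ? _).
  rewrite big_seq [RHS]big_seq; apply: eq_bigr => u uo.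
  rewrite Ex_sum => [|i _]; last by apply: intg_sum.
  apply: eq_bigr => i _; rewrite Ex_sum//; apply: eq_bigr => j ji.
  have ut : u != t by move: uo; rewrite mem_filter => /andP[].
  (* The four edges are pairwise distinct because [j != i] and [u != t]. *)
  rewrite Ex_prod_edges//; last first.
    rewrite /four /= !inE !xpair_eqE !eqxx/= !andbT (eq_sym i) (negbTE ji) (eq_sym t) (negbTE ut).
    by rewrite /= ?andbF.
  by apply: Ex_ext => w; rewrite !big_cons big_nil mulr1 /p/= !mulrA.
have Ed : intg P (\1_[set w | (degree E t w <= x%:E)%E]) by exact: intg_indic.
have Em : intg P (\1_[set w | (multiplicity t w)%:R <= x]) by exact: intg_indic.
rewrite -ExB// (le_trans (le_norm_Ex (intgB Ed Em)))//.
(* The indicator of the null set has expectation 0; adding it makes the bound hold at every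
   point. *)
have -> : Ex P H = Ex P (fun w => \1_null_edges w + H w).
  rewrite [RHS]ExD//; have -> : Ex P (fun w => \1_null_edges w) = 0.
    by rewrite -[LHS]/(Ex P \1_null_edges) Ex_indic// P_null_edges.
  by rewrite add0r.
apply: le_Ex.
- exact/intg_norm/intgB.
- exact: intgD.
move=> w.
have H0 : 0 <= H w.
  rewrite addr_ge0//; do 3 (apply: sumr_ge0 => ? _).
  by rewrite mulr_ge0// prodr_ge0// => ed _; case/andP: (e01 ed w).
have i1 (A B : set Omega) : `|\1_A w - \1_B w| <= 1 :> R.
  by rewrite !indicE; case: (w \in A); case: (w \in B);
    rewrite /= ?subrr ?subr0 ?sub0r ?normrN ?normr0 ?normr1.
have [nw|nw] := pselect (null_edges w).
  by rewrite (le_trans (i1 _ _))// [\1_null_edges w]indicE mem_set// lerDl.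
rewrite [\1_null_edges w]indicE memNset// add0r.
have [YK|YK] := ltP K (Y t w).
  rewrite (le_trans (i1 _ _))// /H YK lerDl; do 3 (apply: sumr_ge0 => ? _).
  by rewrite mulr_ge0// prodr_ge0// => ed _; case/andP: (e01 ed w).
have [hw|hw] := pselect (forall u i j, u \in others a b t -> i != j ->
    ~~ [&& E i t w, E j t w, E i u w & E j u w]).
  rewrite !indicE (_ : (w \in _) = (w \in [set w | (multiplicity t w)%:R <= x])).
    by rewrite subrr normr0.
  by apply/idP/idP; rewrite !inE /= degree_multiplicity// lee_fin.
rewrite (le_trans (i1 _ _))//.
have [u [i [j [uo ij Eall]]]] : exists u i j, [/\ u \in others a b t, i != j &
    [&& E i t w, E j t w, E i u w & E j u w]].
  apply: contrapT => h; apply: hw => u i j uo ij; apply/negP => Eall; apply: h.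
  by exists u, i, j.
have wpos i' u' : E i' u' w -> edge_weight a b i' u' != 0.
  by move=> Eiu; apply/eqP => c0; apply: nw; exists i' => //; exists u'.
have /and4P[Eit Ejt Eiu Eju] := Eall.
have iI : i \in I by rewrite mem_index_iota (edge_weight_row a0 ab (wpos _ _ Eit)).
have jI : j \in I by rewrite mem_index_iota (edge_weight_row a0 ab (wpos _ _ Ejt)).
have pos u' i' j' : 0 <= \1_[set w | Y t w <= K] w * \prod_(ed <- four i' j' u') e ed w.
  by rewrite mulr_ge0// prodr_ge0// => ed _; case/andP: (e01 ed w).
pose F u' i' j' : R := if j' != i' then
  \1_[set w | Y t w <= K] w * \prod_(ed <- four i' j' u') e ed w else 0.
have F0 u' i' j' : 0 <= F u' i' j' by rewrite /F; case: ifP.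
have F1 : F u i j = 1.
  rewrite /F eq_sym ij indicE mem_set// mul1r /four !big_cons big_nil /e/=.
  by rewrite Eit Ejt Eiu Eju !mulr1.
have -> : H w = (K < Y t w)%R%:R
    + \sum_(u' <- others a b t) \sum_(i' <- I) \sum_(j' <- I) F u' i' j'.
  by congr (_ + _); apply: eq_bigr => u' _; apply: eq_bigr => i' _; rewrite big_mkcond.
suff : F u i j <= \sum_(u' <- others a b t) \sum_(i' <- I) \sum_(j' <- I) F u' i' j'.
  by rewrite F1 => h; rewrite ler_wpDl ?ler0n.
apply: (le_trans (ler_sum_mem (F := F u i) jI (F0 u i))).
apply: (le_trans (ler_sum_mem (F := fun i' => \sum_(j' <- I) F u i' j') iI _)).
  by move=> i'; exact: sumr_ge0.
apply: (ler_sum_mem (F := fun u' => \sum_(i' <- I) \sum_(j' <- I) F u' i' j') uo _).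
by move=> u'; do 2 (apply: sumr_ge0 => ? _).
Qed.

End EdgeIndicators.

(** * Mixed Poisson variables *)

Section MixedPoisson.
Context (R : realType).
Local Open Scope ereal_scope.

Lemma nneseries_expR (x : R) : (0 <= x)%R ->
  \sum_(n <oo) (x ^+ n / n`!%:R)%:E = (expR x)%:E.
Proof.
move=> x0; rewrite /expR -EFin_lim; last exact: is_cvg_series_exp_coeff.
congr (limn _); apply/funext => n /=.
by rewrite sumEFin.
Qed.

Lemma nneseriesS (f : nat -> \bar R) : (forall n, 0 <= f n) -> f 0%N = 0 ->
  \sum_(n <oo) f n = \sum_(n <oo) f n.+1.
Proof.
move=> f0 f00; rewrite (nneseries_split 0 1)// big_nat1 f00 add0e add0n.
by rewrite -(nneseries_addn 1)//; apply: eq_eseriesr => n _; rewrite addn1.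
Qed.

Lemma poisson_series (l z : R) : (0 <= l)%R -> (0 <= z)%R ->
  \sum_(r <oo) (z ^+ r * (expR (- l) * l ^+ r / r`!%:R))%:E
    = (expR (- (l * (1 - z))))%:E.
Proof.
move=> l0 z0.
rewrite (eq_eseriesr (g := fun r => (expR (- l))%:E * ((z * l) ^+ r / r`!%:R)%:E)); last first.
  by move=> r _; rewrite -EFinM exprMn; congr _%:E; ring.
rewrite nneseriesZl; last by move=> r _; rewrite lee_fin divr_ge0// exprn_ge0// mulr_ge0.
rewrite nneseries_expR ?mulr_ge0// -EFinM -expRD; congr (expR _)%:E; ring.
Qed.

(** Derivative in [z] of the identity [poisson_series]. *)
Lemma poisson_size_biased_series (l z : R) : (0 <= l)%R -> (0 <= z)%R ->
  \sum_(r <oo) (r%:R * z ^+ r.-1 * (expR (- l) * l ^+ r / r`!%:R))%:E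
    = (l * expR (- (l * (1 - z))))%:E.
Proof.
move=> l0 z0; rewrite nneseriesS; last 2 first.
- by move=> r; rewrite lee_fin !mulr_ge0 ?expR_ge0 ?exprn_ge0// invr_ge0.
- by rewrite !mul0r.
rewrite EFinM -(poisson_series l0 z0) -nneseriesZl; last first.
  by move=> r _; rewrite lee_fin !mulr_ge0 ?expR_ge0 ?exprn_ge0// invr_ge0.
apply: eq_eseriesr => r _; rewrite -EFinM; congr _%:E.
rewrite factS natrM exprS /=; field.
by rewrite nat1r !pnatr_eq0 -lt0n fact_gt0.
Qed.

Lemma integral_nat_comp d (T : measurableType d) (P : probability T R)
    (L : {RV P >-> nat}) (f : nat -> R) : (forall n, 0 <= f n)%R ->
  \int[P]_w (f (L w))%:E = \sum_(n <oo) (f n)%:E * P (L @^-1` [set n]).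
Proof.
move=> f0.
have mL n : measurable (L @^-1` [set n]).
  by rewrite -[X in measurable X]setTI; exact: measurable_funP.
rewrite (eq_integral (fun w => \sum_(n <oo) (f n)%:E * (\1_(L @^-1` [set n]) w)%:E)); last first.
  move=> w _; rewrite (@nneseriesD1 _ _ (L w))//; last first.
    by move=> n _; rewrite -EFinM lee_fin mulr_ge0.
  rewrite indicE mem_set// mule1 eseries0 ?adde0// => n _ /= nL.
  by rewrite indicE memNset ?mule0// => /= h; rewrite h eqxx in nL.
rewrite integral_nneseries//; last 2 first.
- move=> n; apply: measurable_funeM; apply/measurable_EFinP.
  exact: measurable_indic.
- by move=> n w _; rewrite -EFinM lee_fin mulr_ge0.
apply: eq_eseriesr => n _.
have mi : measurable_fun setT (fun w => (\1_(L @^-1` [set n]) w)%:E : \bar R).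
  by apply/measurable_EFinP; exact: measurable_indic.
rewrite (ge0_integralZl_EFin _ _ _ mi)//; first by rewrite integral_indic// setIT.
Qed.

(** Conditioning on the rate: the series over the values of [L] and the expectation over [l] are
    exchanged, all terms being nonnegative. [g x] is the expectation of [f] under a Poisson law of
    rate [x]. *)
Lemma integral_mixed_poisson d (T : measurableType d) (P : probability T R)
    d' (T' : measurableType d') (P' : probability T' R)
    (l : T -> R) (L : {RV P' >-> nat}) (f : nat -> R) (g : R -> R) :
  measurable_fun setT l -> (forall w, 0 <= l w)%R ->
  mixed_poisson P l L -> (forall n, 0 <= f n)%R ->
  (forall x, (0 <= x)%R ->
    \sum_(r <oo) (f r * (expR (- x) * x ^+ r / r`!%:R))%:E = (g x)%:E) ->
  \int[P']_w (f (L w))%:E = \int[P]_w (g (l w))%:E.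
Proof.
move=> ml l0 lL f0 fg; rewrite integral_nat_comp//.
under eq_eseriesr do rewrite lL.
have ml' r : measurable_fun setT (fun w => expR (- l w) * l w ^+ r / r`!%:R)%R.
  apply: measurable_funM => //; apply: measurable_funM; last exact: measurable_funX.
  by apply: (measurableT_comp (@measurable_expR R)); exact: measurableT_comp.
have pos r w : (0 <= expR (- l w) * l w ^+ r / r`!%:R)%R.
  by rewrite !mulr_ge0 ?expR_ge0 ?exprn_ge0// invr_ge0.
rewrite (eq_integral (fun w => \sum_(r <oo)
    (f r * (expR (- l w) * l w ^+ r / r`!%:R))%:E)); last first.
  by move=> w _; rewrite fg.
rewrite integral_nneseries//; last 2 first.
- by move=> r; apply/measurable_EFinP; apply: measurable_funM.
- by move=> r w _; rewrite lee_fin mulr_ge0.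
apply: eq_eseriesr => r _; rewrite unlock.
under eq_integral do rewrite EFinM.
have mi : measurable_fun setT (fun w => (expR (- l w) * l w ^+ r / r`!%:R)%:E).
  exact/measurable_EFinP.
by rewrite (ge0_integralZl_EFin _ _ _ mi)// => w _; rewrite lee_fin pos.
Qed.

End MixedPoisson.

(** * Generating function of the compound mixed Poisson limit *)

Section CompoundMixedPoisson.
Context d (T : measurableType d) (R : realType) (P : probability T R).
Context d' (T' : measurableType d') (P' : probability T' R).

(** Conditioning on [N]: on [N = n] the sum has [n] i.i.d. terms, independent of that event, and the
    nonnegative series over [n] is exchanged with the integral. *)
Lemma Ex_random_sum_pgf (N : {RV P' >-> nat}) (kappa : nat -> {RV P' >-> nat})
    (s : R) : 0 <= s <= 1 -> iid P' kappa ->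
  independent_systems P' (g_sigma_algebra_preimage N) (sigma_of_family kappa) ->
  Ex P' (fun w => s ^+ (\sum_(j < N w) kappa j w))
    = Ex P' (fun w => Ex P' (fun w => s ^+ kappa 0%N w) ^+ N w).
Proof.
move=> /andP[s0 s1] ik Nk; set k := Ex P' (fun w => s ^+ kappa 0%N w).
have mpow : measurable_fun setT (fun n : nat => s ^+ n : R) by [].
have k0 : 0 <= k by apply: Ex_ge0 => w; exact: exprn_ge0.
have Ik j : intg P' (fun w => s ^+ kappa j w).
  apply: (@intg_bounded _ _ _ _ _ 1); first exact: (measurableT_comp mpow).
  by move=> w; rewrite ger0_norm ?exprn_ge0// exprn_ile1.
have prodE n w : s ^+ (\sum_(j < n) kappa j w) = \prod_(j <- iota 0 n) s ^+ kappa j w.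
  rewrite (big_morph (fun n => s ^+ n) (exprD s) (expr0 s)).
  by rewrite -(big_mkord xpredT (fun j => s ^+ kappa j w)) /index_iota subn0.
have Eprod n : intg P' (fun w => \prod_(j <- iota 0 n) s ^+ kappa j w) /\
    Ex P' (fun w => \prod_(j <- iota 0 n) s ^+ kappa j w) = k ^+ n.
  have [|||| I EI] := @intg_Ex_prod _ _ _ P' _ _ nat kappa (fun _ m => s ^+ m) (iota 0 n) ik.1.
  - exact: iota_uniq.
  - by move=> _; exact: mpow.
  - by move=> _ y; exact: exprn_ge0.
  - by move=> i _; exact: Ik.
  split; first exact: I.
  rewrite EI (eq_bigr (fun=> k)); last first.
    move=> j _; exact: (iid_Ex ik.2 mpow (fun y => exprn_ge0 y s0) (Ik 0%N) j).2.
  by rewrite big_const_seq count_predT size_iota -Monoid.iteropE.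
have mN n : measurable (N @^-1` [set n]).
  by rewrite -[X in measurable X]setTI; exact: measurable_funP.
have joint n : (\int[P']_w ((\1_(N @^-1` [set n]) w
    * \prod_(j <- iota 0 n) s ^+ kappa j w)%:E))%E
    = ((k ^+ n)%:E * P' (N @^-1` [set n]))%E.
  have [I1 E1] := Eprod n.
  have [||||| I2 E2] := @Ex_mul_indep _ _ _ P' (\1_(N @^-1` [set n]))
    (fun w => \prod_(j <- iota 0 n) s ^+ kappa j w).
  - exact: intg_indic.
  - by [].
  - exact: I1.
  - by move=> w; apply: prodr_ge0 => j _; exact: exprn_ge0.
  - move=> A B mA mB; apply: Nk.
      by exists ((\1_[set n] : nat -> R) @^-1` A) => //; rewrite setTI.
    have : sigma_measurable kappa (fun w => \prod_(j <- iota 0 n) s ^+ kappa j w).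
      apply: sigma_measurable_fun; apply: measurable_prod => j _.
      by apply: (measurableT_comp mpow); exact: measurable_family.
    by apply.
  by rewrite -EFin_Ex// E2 E1 Ex_indic// EFinM fineK ?fin_num_measure// muleC.
rewrite /Ex /Rintegral; congr fine.
rewrite (integral_nat_comp N (fun n => exprn_ge0 n k0)).
rewrite (eq_integral (fun w => (\sum_(n <oo) (\1_(N @^-1` [set n]) w
    * \prod_(j <- iota 0 n) s ^+ kappa j w)%:E)%E)); last first.
  move=> w _; rewrite (@nneseriesD1 _ _ (N w))//; last first.
    by move=> n _; rewrite lee_fin mulr_ge0// prodr_ge0// => j _; exact: exprn_ge0.
  rewrite indicE mem_set// mul1r eseries0 ?adde0 ?prodE// => n _ /= nL.
  by rewrite indicE memNset ?mul0r// => /= h; rewrite h eqxx in nL.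
rewrite integral_nneseries//; last 2 first.
- move=> n; apply/measurable_EFinP; apply: measurable_funM.
    exact: measurable_indic.
  exact: intg_measurable (Eprod n).1.
- by move=> n w _; rewrite lee_fin mulr_ge0// prodr_ge0// => j _; exact: exprn_ge0.
by apply: eq_eseriesr => n _; exact: joint.
Qed.

(** The generating function of [kappa 0] is the derivative of that of [Lambda2], normalized to be 1
    at 1; for a mixed Poisson variable this is [E (x exp (- (1 - s) g2 b1 x)) / a1]. Inserted into
    the generating function of [Lambda1], it cancels the factor [a1] of the rate. *)
Lemma Ex_compound_mixed_poisson_pgf (x y : T -> R) (g1 g2 : R)
    (Lambda1 Lambda2 : {RV P' >-> nat}) (kappa : nat -> {RV P' >-> nat}) (s : R) :
  let EL2 := 'E_P'[fun w => (Lambda2 w)%:R]%E in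
  intg P x -> (forall w, 0 <= x w) -> intg P y -> (forall w, 0 <= y w) ->
  0 <= g1 -> 0 <= g2 ->
  mixed_poisson P (fun w => g1 * Ex P x * y w) Lambda1 ->
  mixed_poisson P (fun w => g2 * Ex P y * x w) Lambda2 ->
  iid P' kappa ->
  independent_systems P' (g_sigma_algebra_preimage Lambda1)
    (sigma_of_family kappa) ->
  (EL2 != 0%E -> forall r : nat,
    P' (kappa 0%N @^-1` [set r])
      = ((r.+1%:R / fine EL2)%:E * P' (Lambda2 @^-1` [set r.+1]))%E) ->
  0 <= s <= 1 ->
  Ex P' (fun w => s ^+ (if (EL2 == 0)%E then 0%N
     else (\sum_(j < Lambda1 w) kappa j w)%N))
  = Ex P (fun w => expR (- (y w * (g1 *
      Ex P (fun w => size_biased_deficit (1 - s) (g2 * Ex P y) (x w)))))).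
Proof.
move=> EL2 Ix x0 Iy y0 g10 g20 mp1 mp2 ik Lk kE s01; have /andP[s0 s1] := s01.
set a1 := Ex P x in mp1 *; set b1 := Ex P y in mp2 *.
have a10 : 0 <= a1 by exact: Ex_ge0.
have b10 : 0 <= b1 by exact: Ex_ge0.
have [mx my] := (intg_measurable Ix, intg_measurable Iy).
pose l1 w := g1 * a1 * y w; pose l2 w := g2 * b1 * x w.
have l10 w : 0 <= l1 w by rewrite !mulr_ge0.
have l20 w : 0 <= l2 w by rewrite !mulr_ge0.
have ml1 : measurable_fun setT l1 by exact: measurable_funM.
have ml2 : measurable_fun setT l2 by exact: measurable_funM.
(* Derivative at [z] of the generating function of [Lambda2]: at [z = 1] it is the mean, at [z = s]
   the numerator for [kappa]. *)
have size_biased z : 0 <= z <= 1 ->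
    (\int[P']_w ((Lambda2 w)%:R * z ^+ (Lambda2 w).-1)%:E
     = \int[P]_w (l2 w * expR (- (l2 w * (1 - z))))%:E)%E.
  move=> /andP[z0 z1].
  apply: (integral_mixed_poisson ml2 l20 mp2 (f := fun r => r%:R * z ^+ r.-1)
    (g := fun u => u * expR (- (u * (1 - z))))).
  - by move=> r; rewrite mulr_ge0// exprn_ge0.
  - by move=> u u0; exact: poisson_size_biased_series.
pose h w := x w * expR (- ((1 - s) * (g2 * b1) * x w)).
have h0 w : 0 <= h w by rewrite mulr_ge0// expR_ge0.
have mh : measurable_fun setT h.
  apply: measurable_funM => //; apply: (measurableT_comp (@measurable_expR R)).
  by apply: measurableT_comp => //; exact: measurable_funM.
have s10 : 0 <= 1 - s by rewrite subr_ge0.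
have Ih : intg P h.
  apply: (intg_le mh _ Ix) => w; rewrite ger0_norm// ler_piMr// expRN_le1//.
  by rewrite !mulr_ge0.
have defE : Ex P (fun w => size_biased_deficit (1 - s) (g2 * b1) (x w)) = a1 - Ex P h.
  by rewrite -ExB//; apply: Ex_ext => w; rewrite /size_biased_deficit mulrBr mulr1.
rewrite defE.
have EL2E : EL2 = (g2 * b1 * a1)%:E.
  rewrite /EL2 unlock -ExZ// EFin_Ex; last exact: intgZ.
  have := size_biased 1; rewrite ler01 lexx => /(_ isT).
  under eq_integral do rewrite expr1n mulr1.
  by under [X in _ = X -> _]eq_integral do rewrite subrr mulr0 oppr0 expR0 mulr1.
(* In the degenerate case either [g2 * b1 = 0], and the exponential in [h] is 1, or [a1 = 0], and
   [h] has expectation 0; the exponent on the right vanishes and both sides are 1. *)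
have [EL20|EL20] := eqVneq EL2 0%E.
  move: EL20; rewrite EL2E => -[m0].
  have -> : a1 - Ex P h = 0.
    have [g0|g0] := eqVneq (g2 * b1) 0.
      apply/eqP; rewrite subr_eq0; apply/eqP; apply: Ex_ext => w.
      by rewrite /h g0 mulr0 mul0r oppr0 expR0 mulr1.
    have a00 : a1 = 0 by move/eqP : m0; rewrite mulf_eq0 (negbTE g0) => /eqP.
    have : Ex P h <= a1.
      apply: le_Ex => // w; rewrite ler_piMr// expRN_le1//.
      by rewrite !mulr_ge0.
    have : 0 <= Ex P h by exact: Ex_ge0.
    by rewrite a00; lra.
  under Ex_ext do rewrite expr0.
  under [RHS]Ex_ext do rewrite !mulr0 oppr0 expR0.
  by rewrite !Ex_cst.
rewrite (Ex_random_sum_pgf s01 ik Lk).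
set k := Ex P' (fun w => s ^+ kappa 0%N w).
have m0 : 0 < g2 * b1 * a1.
  by rewrite lt_neqAle !mulr_ge0// andbT eq_sym -eqe -EL2E.
have [gb0 a1n0] : g2 * b1 != 0 /\ a1 != 0.
  by apply/andP; have := lt0r_neq0 m0; rewrite mulf_eq0 negb_or.
have /andP[g2n b1n] : (g2 != 0) && (b1 != 0) by rewrite -negb_or -mulf_eq0.
have Ik : intg P' (fun w => s ^+ kappa 0%N w).
  apply: (@intg_bounded _ _ _ _ _ 1).
    by apply: (@measurableT_comp _ _ _ _ _ _ (fun n : nat => s ^+ n : R)).
  by move=> w; rewrite ger0_norm ?exprn_ge0// exprn_ile1.
have kval : k = Ex P h / a1.
  apply: EFin_inj; rewrite EFin_Ex//.
  rewrite (integral_nat_comp (kappa 0%N) (f := fun n => s ^+ n)); last first.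
    by move=> n; exact: exprn_ge0.
  under eq_eseriesr do rewrite (kE EL20) EL2E/=.
  have := size_biased s s01.
  rewrite (integral_nat_comp Lambda2 (f := fun n => n%:R * s ^+ n.-1)); last first.
    by move=> n; rewrite mulr_ge0// exprn_ge0.
  rewrite nneseriesS; last 2 first.
  - by move=> n; rewrite mule_ge0// lee_fin mulr_ge0// exprn_ge0.
  - by rewrite mul0r mul0e.
  rewrite (_ : (\int[P]_w (l2 w * expR (- (l2 w * (1 - s))))%:E)%E
      = (g2 * b1 * Ex P h)%:E); last first.
    rewrite -ExZ// EFin_Ex; last exact: intgZ.
    by apply: eq_integral => w _; congr _%:E; rewrite /l2 /h [RHS]mulrA; congr (_ * expR (- _)); ring.
  move=> E.
  transitivity (((g2 * b1 * a1)^-1)%:E * \sum_(n <oo) (n.+1%:R * s ^+ n)%:E * P' (Lambda2 @^-1` [set n.+1]))%E.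
    rewrite -nneseriesZl; last first.
      by move=> n _; rewrite mule_ge0// lee_fin mulr_ge0// exprn_ge0.
    apply: eq_eseriesr => n _; rewrite !muleA -!EFinM; congr (_%:E * _)%E; ring.
  rewrite E -EFinM; congr _%:E; field.
  by rewrite a1n0 g2n b1n.
have k0 : 0 <= k by apply: Ex_ge0 => w; exact: exprn_ge0.
have -> : Ex P' (fun w => k ^+ Lambda1 w) = Ex P (fun w => expR (- (l1 w * (1 - k)))).
  rewrite /Ex /Rintegral; congr fine.
  apply: (integral_mixed_poisson ml1 l10 mp1 (f := fun n => k ^+ n)
    (g := fun u => expR (- (u * (1 - k))))).
  - by move=> n; exact: exprn_ge0.
  - by move=> u u0; exact: poisson_series.
apply: Ex_ext => w; congr (expR (- _)); rewrite /l1 kval.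
by field.
Qed.

End CompoundMixedPoisson.

(** * Convergence of the degree *)

Lemma natR_le_threshold (R : realType) (x : R) :
  exists m, forall n : nat, (n%:R <= x) = (n < m)%N.
Proof.
have [x0|x0] := ltP x 0.
  exists 0%N => n; rewrite ltn0; apply/negbTE; rewrite -ltNge.
  by rewrite (lt_le_trans x0).
by exists (Num.truncn x).+1 => n; rewrite ltnS truncn_ge_nat.
Qed.

Lemma Ex_le_nat (R : realType) d (T : measurableType d) (P : probability T R)
    (L : T -> nat) (x : R) m : measurable_fun setT L ->
  (forall n : nat, (n%:R <= x) = (n < m)%N) ->
  Ex P \1_[set w | (L w)%:R <= x] = \sum_(n < m) Ex P (fun w => (L w == n)%:R).
Proof.
move=> mL xm; rewrite -Ex_sum => [|n _]; last first.
  apply: (@intg_bounded _ _ _ _ _ 1).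
    by apply: (@measurableT_comp _ _ _ _ _ _ (fun k : nat => (k == n)%:R : R)).
  by move=> w; case: (_ == _); rewrite ?normr1 ?normr0.
apply: Ex_ext => w; rewrite indicE; have [Lm|mL'] := ltnP (L w) m.
  rewrite mem_set/=; last by rewrite xm.
  rewrite (bigD1 (Ordinal Lm))//= eqxx big1 ?addr0// => k kL.
  by rewrite (_ : (L w == k) = false)//; apply/negbTE; rewrite eq_sym -val_eqE/= in kL *.
rewrite memNset/=; last by rewrite xm ltnNge mL'.
by rewrite big1// => k _; rewrite (gtn_eqF (leq_trans (ltn_ord k) mL')).
Qed.

Theorem theorem1 (R : realType)
    (d : measure_display) (Omega : measurableType d) (P : probability Omega R)
    (d' : measure_display) (Omega' : measurableType d')
    (P' : probability Omega' R)
    (a b : R) (X Y : nat -> {RV P >-> R}) (E : nat -> nat -> {RV P >-> bool})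
    (Lambda1 Lambda2 : {RV P' >-> nat}) (kappa : nat -> {RV P' >-> nat}) :
  let a1 : R := fine 'E_P[X 0%N]%E in
  let b1 : R := fine 'E_P[Y 0%N]%E in
  let lambda1 : Omega -> R :=
    fun w => 2 * (Num.sqrt b - Num.sqrt a) * a1 * Y 0%N w in
  let lambda2 : Omega -> R :=
    fun w => 2 * ((Num.sqrt a)^-1 - (Num.sqrt b)^-1) * b1 * X 0%N w in
  let ELambda2 : \bar R := 'E_P'[fun w => (Lambda2 w)%:R]%E in
  bipartite_model a b (fun t => t%:R) X Y E ->
  ('E_P[fun w => (X 0%N w ^+ 2)%R] < +oo)%E ->
  ('E_P[Y 0%N] < +oo)%E ->
  mixed_poisson P lambda1 Lambda1 ->
  mixed_poisson P lambda2 Lambda2 ->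
  iid P' kappa ->
  independent_systems P' (g_sigma_algebra_preimage Lambda1)
    (sigma_of_family kappa) ->
  (ELambda2 != 0%E -> forall r : nat,
    P' (kappa 0%N @^-1` [set r])
      = ((r.+1%:R / fine ELambda2)%:E * P' (Lambda2 @^-1` [set r.+1]))%E) ->
  cvg_in_distribution P P' (fun t => degree E t) (dstar Lambda1 Lambda2 kappa).
Proof.
move=> a1 b1 lambda1 lambda2 ELambda2 model X2 Y1 mp1 mp2 ik Lk kE.
have /andP[a0 ab] := model_ab model.
have [X0 Y0] := (model_X_ge0 model, model_Y_ge0 model).
have [iX iY] := (model_X_iid model, model_Y_iid model).
have XY := model_XY_independent model.
have IX2 : intg P (fun w => X 0%N w ^+ 2).
  apply: intg_ge0; first exact: measurable_funX.
  - by move=> w; exact: sqr_ge0.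
  - by move: X2; rewrite unlock.
have IY : intg P (Y 0%N).
  by apply: intg_ge0 => //; move: Y1; rewrite unlock.
have IX : intg P (X 0%N).
  apply: (intg_le _ _ (intgD (intg_cst P 1) IX2)) => // w.
  rewrite ger0_norm//; have := sqr_ge0 (X 0%N w - 1).
  by have := sqr_ge0 (X 0%N w); rewrite !expr2; lra.
have a1E : a1 = Ex P (X 0%N) by rewrite /a1 unlock.
have b1E : b1 = Ex P (Y 0%N) by rewrite /b1 unlock.
pose g1 : R := 2 * (Num.sqrt b - Num.sqrt a).
pose g2 : R := 2 * ((Num.sqrt a)^-1 - (Num.sqrt b)^-1).
have sab : Num.sqrt a <= Num.sqrt b by rewrite ler_wsqrtr// ltW.
have sa0 : 0 < Num.sqrt a by rewrite sqrtr_gt0.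
have g10 : 0 <= g1 by rewrite mulr_ge0// subr_ge0.
have g20 : 0 <= g2.
  by rewrite mulr_ge0// subr_ge0 lef_pV2// posrE// (lt_le_trans sa0).
(* [dstar] as a natural number, the form to which generating functions apply. *)
pose Q w := if (ELambda2 == 0)%E then 0%N else (\sum_(j < Lambda1 w) kappa j w)%N.
have dQ w : dstar Lambda1 Lambda2 kappa w = (Q w)%:R.
  by rewrite /dstar /Q -/ELambda2; case: ifP.
have mQ : measurable_fun setT Q.
  apply: (@measurable_natR R); have := measurable_dstar Lambda1 Lambda2 kappa.
  suff -> : dstar Lambda1 Lambda2 kappa = (fun w => (Q w)%:R) :> (Omega' -> R) by [].
  by apply/funext => w; exact: dQ.
have mmult t : measurable_fun setT (multiplicity a b E t).
  exact: measurable_multiplicity.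
have pmf n : Ex P (fun w => (multiplicity a b E t w == n)%:R) @[t --> \oo]
    --> Ex P' (fun w => (Q w == n)%:R).
  apply: pgf_continuity => // s /andP[s0 s1].
  have s01 : 0 <= s <= 1 by rewrite !ltW.
  under eq_fun do rewrite (Ex_multiplicity_pgf model _ s01).
  rewrite (@Ex_compound_mixed_poisson_pgf _ _ _ P _ _ P' (X 0%N) (Y 0%N) g1 g2)//.
  - apply: (cvg_Ex_edge_pgf a0 ab) => //.
    by apply/andP; split; lra.
  - by rewrite -a1E.
  - by rewrite -b1E.
move=> x _.
(* The event that a natural number is at most [x] consists of the values below [m], so the
   convergence of finitely many point probabilities suffices. *)
have [m xm] := natR_le_threshold x.
have cmult : Ex P \1_[set w | (multiplicity a b E t w)%:R <= x] @[t --> \oo]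
    --> Ex P' \1_[set w | (Q w)%:R <= x].
  rewrite (Ex_le_nat P' mQ xm).
  have -> : (fun t => Ex P \1_[set w | (multiplicity a b E t w)%:R <= x])
      = (fun t => \sum_(n < m) Ex P (fun w => (multiplicity a b E t w == n)%:R)).
    by apply/funext => t; rewrite (Ex_le_nat P (mmult t) xm).
  by apply: cvg_sumr => n; exact: pmf.
have mdeg t : measurable [set w | (degree E t w <= x%:E)%E].
  rewrite -[X in measurable X]setTI; apply: emeasurable_fun_infty_c => //.
have cdeg : Ex P \1_[set w | (degree E t w <= x%:E)%E] @[t --> \oo]
    --> Ex P' \1_[set w | (Q w)%:R <= x].
  apply/cvgrPdist_le => e e0.
  (* One third each for the tail of [Y t], for the double connections, and for the convergence of
     the multiplicity; [K] is fixed before [t]. *)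
  have e3 : 0 < e / 3 by rewrite divr_gt0.
  have [K K0 hK] := small_Y_tail iY Y0 e3.
  have := cvg_double_edges a0 ab iX iY X0 Y0 XY IX2 IY (ltW K0).
  move=> /cvgrPdist_le/(_ _ e3) hdouble.
  move/cvgrPdist_le : cmult => /(_ _ e3) hmult.
  near=> t.
  have h1 := dist_degree_multiplicity model x (hK t).1.
  have h2 : `|Ex P' \1_[set w | (Q w)%:R <= x]
      - Ex P \1_[set w | (multiplicity a b E t w)%:R <= x]| <= e / 3.
    by near: t; exact: hmult.
  have h3 := (hK t).2.
  have h4 : `|0 - \sum_(u <- others a b t) \sum_(i <- index_iota 0 (edge_range a b t))
      \sum_(j <- index_iota 0 (edge_range a b t) | j != i)
      Ex P (fun w => \1_[set w | Y t w <= K] w *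
      (edge_pr a b X Y i t w * edge_pr a b X Y j t w *
       edge_pr a b X Y i u w * edge_pr a b X Y j u w))| <= e / 3.
    by near: t; exact: hdouble.
  rewrite sub0r normrN in h4; have h5 := le_trans (ler_norm _) h4.
  have h6 := le_trans h1 (lerD h3 h5).
  rewrite [leRHS](_ : _ = e / 3 + (e / 3 + e / 3)); last by field.
  rewrite (le_trans (ler_distD (Ex P \1_[set w | (multiplicity a b E t w)%:R <= x]) _ _))//.
  by rewrite lerD// distrC.
have mQx : measurable [set w | (Q w)%:R <= x].
  have := mQ measurableT [set n | n%:R <= x] I.
  by rewrite setTI.
have -> : @cdf _ _ _ P' (dstar Lambda1 Lambda2 kappa) x
    = (Ex P' \1_[set w | (Q w)%:R <= x])%:E.
  rewrite Ex_indic// fineK; last exact: fin_num_measure.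
  have -> : [set w | (Q w)%:R <= x] =
      dstar Lambda1 Lambda2 kappa @^-1` `]-oo, x]%classic :> set Omega'.
    by apply/seteqP; split => w /=; rewrite in_itv/= dQ.
  by [].
have -> : (fun t => P [set w | (degree E t w <= x%:E)%E])
    = (fun t => (Ex P \1_[set w | (degree E t w <= x%:E)%E])%:E).
  by apply/funext => t; rewrite Ex_indic// fineK//; exact: fin_num_measure.
by apply: cvg_EFin => //; exact: nearW.
Unshelve. all: by end_near. Qed.
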